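(* Let $v$ be a generic Gelfand--Tsetlin tableau of height $n$ satisfying the standing conventions (A) and (B) of the context, and let $\overline V(T(v))=\mathrm U_q(T(v))\big/\sum_{1\le j\le k\le n-1}W_{kj}$ for a choice of the submodules $W_{kj}$ as described in the context. (1) $\overline V(T(v))$ is a $\mathrm U_q$-module of dimension $m^{n(n-1)/2}$, and the action of the generators $K_k^{\pm1},E_k,F_k$ on the (images of the) vectors $T(v+z)$ is given by the Gelfand--Tsetlin formulae. (2) For every $1\le r\le n$, $0\le s\le r$ and every $T(w)=T(v+z)\in\overline V(T(v))$, one has $c_{rs}T(w)=\gamma_{rs}(w)\,T(w)$, where $$\gamma_{rs}(w)=[s]_q!\,[r-s]_q!\,q^{rs-r^2+s}\sum_{\tau}q^{\sum_{i=1}^{s}w_{r\tau(i)}-\sum_{i=s+1}^{r}w_{r\tau(i)}},$$ the sum being over all $(s,r-s)$-shuffles $\tau\in S_r$, i.e. $\tau(1)<\dots<\tau(s)$ and $\tau(s+1)<\dots<\tau(r)$. (3) For fixed $v$, the modules $\overline V(T(v))$ obtained from distinct choices of the $W_{kj}$, $1\le j\le k\le n-1$, are pairwise non-isomorphic.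
   Context: Let $n\ge2$, $m\ge3$ odd, $\theta=2\pi/m$, $q=e^{\mathbf i\theta}$, $\mathbf i=\sqrt{-1}$. For $x\in\mathbb C$: $q^x=e^{\mathbf i\theta x}$, $[x]_q=\frac{q^x-q^{-x}}{q-q^{-1}}$; $[k]_q!=[1]_q\cdots[k]_q$. $\mathrm U_q=\mathrm U_q(\mathfrak{gl}_n)$ is the unital associative $\mathbb C$-algebra generated by $E_i,F_i$ ($1\le i\le n-1$), $K_j^{\pm1}$ ($1\le j\le n$) with relations: the $K_j$ commute and are invertible; $K_iE_jK_i^{-1}=q^{\delta_{ij}-\delta_{i,j+1}}E_j$; $K_iF_jK_i^{-1}=q^{\delta_{i,j+1}-\delta_{ij}}F_j$; $[E_i,F_j]=\delta_{ij}\frac{K_iK_{i+1}^{-1}-K_{i+1}K_i^{-1}}{q-q^{-1}}$; $[E_i,E_j]=[F_i,F_j]=0$ for $|i-j|\ge2$; $E_i^2E_{i\pm1}-(q+q^{-1})E_iE_{i\pm1}E_i+E_{i\pm1}E_i^2=0$ and the same with $F$. A Gelfand--Tsetlin tableau of height $n$ is an array $v=(v_{ij})_{1\le j\le i\le n}$ of complex numbers; $\delta^{ij}$ is the array with $1$ at $(i,j)$ and $0$ elsewhere. $v$ is generic if $v_{ki}-v_{kj}\notin\frac{\mathbb Z}{2}$ for all $1\le k\le n-1$, $i\ne j$. Standing conventions: (A) for all positions $(a,b),(i,j)$, either $v_{ab}-v_{ij}\in\mathbb Z$ or $v_{ab}-v_{ij}\notin\frac{\mathbb Z}{2}$. (B)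 For $2\le k\le n-1$: if $\{j\mid v_{k,j}-v_{k-1,i}\in\mathbb Z\}\ne\emptyset$, then this set is $\{i\}$ and $v_{k,i}=v_{k-1,i}$; for $k=n$: if $\{j\mid v_{n,j}-v_{n-1,i}\in\mathbb Z\}\neq\emptyset$ (several such $j$ are allowed), then $v_{n,i}=v_{n-1,i}$. $V(T(v))$ is the vector space with basis the symbols $T(v+z)$, $z=(z_{ij})_{1\le j\le i\le n}$ an integer array with $z_{ni}=0$ for all $i$, made a $\mathrm U_q$-module by the Gelfand--Tsetlin formulae: for $w=v+z$, $K_kT(w)=q^{a_k}T(w)$, $a_k=\sum_{i=1}^kw_{k,i}-\sum_{i=1}^{k-1}w_{k-1,i}+k$; $E_kT(w)=-\sum_{j=1}^k\frac{\prod_{i=1}^{k+1}[w_{k,j}-w_{k+1,i}]_q}{\prod_{i\ne j}[w_{k,j}-w_{k,i}]_q}T(w+\delta^{kj})$; $F_kT(w)=\sum_{j=1}^k\frac{\prod_{i=1}^{k-1}[w_{k,j}-w_{k-1,i}]_q}{\prod_{i\ne j}[w_{k,j}-w_{k,i}]_q}T(w-\delta^{kj})$. $\mathrm U_q(T(v))$ is the submodule generated by $T(v)$. For $1\le j\le k\le n-1$, let $t$ ($j\le t\le k$) be determined by $v_{kj}=v_{k-1,j}=\dots=v_{tj}\ne v_{t-1,j}$ (with $t=j$ if all of $v_{kj},\dots,v_{jj}$ are equal). $W_{kj}^{(1)}$ is the submodule of $\mathrm U_q(T(v))$ generated by $T(v-m\delta^{kj}-m\delta^{k-1,j}-\dots-m\delta^{tj})-T(v)$;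 $W_{kj}^{(2)}$ is the submodule generated by $T(v-m\delta^{kj}-m\delta^{k-1,j}-\dots-m\delta^{tj})$. If $v_{k+1,j}\ne v_{kj}$, then $W_{kj}=W_{kj}^{(1)}$. If $v_{k+1,j}=v_{kj}$, then $W_{kj}$ is chosen to be either $W_{kj}^{(1)}$ or $W_{kj}^{(2)}$. The image of $T(v+z)$ in the quotient $\overline V(T(v))$ is again denoted $T(v+z)$. Central elements: for $1\le r\le n$, $0\le s\le r$, $c_{rs}\in\mathrm U_q(\mathfrak{gl}_r)\subset\mathrm U_q$ is $$c_{rs}=\sum_{\sigma,\sigma'\in S_r}(-q)^{-l(\sigma)-l(\sigma')}l^+_{\sigma(1),\sigma'(1)}\cdots l^+_{\sigma(s),\sigma'(s)}l^-_{\sigma(s+1),\sigma'(s+1)}\cdots l^-_{\sigma(r),\sigma'(r)},$$ where $l_{ii}^\pm=K_i^{\pm1}$, $l^+_{i,i+1}=(q-q^{-1})K_iF_i$, $l^-_{i+1,i}=-(q-q^{-1})E_iK_i^{-1}$, $l^+_{ij}=0$ for $i>j$, $l^-_{ij}=0$ for $i<j$, and the remaining entries are determined by the relations $RL_1^\pm L_2^\pm=L_2^\pm L_1^\pm R$, $RL_1^+L_2^-=L_2^-L_1^+R$ for $L^\pm=(l^\pm_{ij})$, $R=q\sum_ie_{ii}\otimes e_{ii}+\sum_{i\ne j}e_{ii}\otimes e_{jj}+(q-q^{-1})\sum_{i<j}e_{ij}\otimes e_{ji}$. *)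

(* Defs.v *)
(* The complex numbers are R[i], for an arbitrary R : realType. *)
From HB Require Import structures.
From mathcomp Require Import all_boot all_order all_algebra perm.
From mathcomp Require Import finmap complex mxtens.
From mathcomp Require Import boolp reals sequences exp trigo.

Set Implicit Arguments.
Unset Strict Implicit.
Unset Printing Implicit Defensive.

Import Order.TTheory GRing.Theory Num.Theory.
Local Open Scope ring_scope.
Local Open Scope complex_scope.
Local Open Scope quotient_scope.

Section SpanModule.
Variables (A : pzRingType) (M : lmodType A).

Definition spanmod (S : M -> Prop) : {pred M} := fun x =>
  `[< forall P : {pred M}, submod_closed P ->
        (forall y, S y -> y \in P) -> x \in P >].

Lemma spanmod_closed S : submod_closed (spanmod S).
Proof.
split=> [|a x y /asboolP Sx /asboolP Sy]; apply/asboolP => P clP SP.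
  by case: clP.
by case: (clP) => _; apply; [apply: Sx | apply: Sy].
Qed.

HB.instance Definition _ S :=
  GRing.isSubmodClosed.Build A M (spanmod S) (spanmod_closed S).

Definition spanmod_type (S : M -> Prop) : Type := {x : M | x \in spanmod S}.

HB.instance Definition _ S := [isSub of spanmod_type S for @proj1_sig _ _].
HB.instance Definition _ S := [Choice of spanmod_type S by <:].
HB.instance Definition _ S :=
  [SubChoice_isSubLmodule of spanmod_type S by <:].

End SpanModule.

Section QuotientModule.
Variables (A : pzRingType) (M : lmodType A) (S : M -> Prop).

Definition quotmod : Type := Quotient.quot (spanmod S).
HB.instance Definition _ := GRing.Zmodule.on quotmod.
HB.instance Definition _ := EqQuotient.on quotmod.

Definition quotmod_scale (a : A) (x : quotmod) : quotmod :=
  \pi_quotmod (a *: repr x).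

Lemma quotmodW (P : quotmod -> Type) :
  (forall x, P (\pi_quotmod x)) -> forall x, P x.
Proof. by move=> Ppi x; rewrite -[x]reprK; apply: Ppi. Qed.

Lemma quotmod_pi x y : (x - y \in spanmod S) -> \pi_quotmod x = \pi_quotmod y.
Proof. by rewrite Quotient.idealrBE => /eqP. Qed.

Lemma quotmod_piD x y :
  \pi_quotmod (x + y) = \pi_quotmod x + \pi_quotmod y.
Proof. exact: Quotient.pi_add. Qed.

Lemma quotmod_scale_pi a x : quotmod_scale a (\pi_quotmod x) = \pi_quotmod (a *: x).
Proof.
apply: quotmod_pi; rewrite -scalerBr; apply: rpredZ.
by rewrite Quotient.idealrBE reprK.
Qed.

Lemma quotmod_scalerA a b x :
  quotmod_scale a (quotmod_scale b x) = quotmod_scale (a * b) x.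
Proof. by elim/quotmodW: x => x; rewrite !quotmod_scale_pi scalerA. Qed.

Lemma quotmod_scale1r : left_id 1 quotmod_scale.
Proof. by elim/quotmodW=> x; rewrite quotmod_scale_pi scale1r. Qed.

Lemma quotmod_scalerDr : right_distributive quotmod_scale +%R.
Proof.
move=> a; elim/quotmodW=> x; elim/quotmodW=> y.
by rewrite -quotmod_piD !quotmod_scale_pi -quotmod_piD scalerDr.
Qed.

Lemma quotmod_scalerDl x : {morph quotmod_scale^~ x : a b / a + b}.
Proof.
elim/quotmodW: x => x a b.
by rewrite !quotmod_scale_pi -quotmod_piD scalerDl.
Qed.

HB.instance Definition _ := GRing.Zmodule_isLmodule.Build A quotmod
  quotmod_scalerA quotmod_scale1r quotmod_scalerDr quotmod_scalerDl.

End QuotientModule.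

Section QNumbers.
Variables (R : realType) (m : nat).

Definition cexp (z : R[i]) : R[i] :=
  (expR (complex.Re z))%:C * (cos (complex.Im z) +i* sin (complex.Im z)).

Definition theta : R := 2 * trigo.pi / m%:R.

Definition qpow (x : R[i]) : R[i] := cexp ('i * theta%:C * x).

Definition qpar : R[i] := cexp ('i * theta%:C).

Definition qnum (x : R[i]) : R[i] :=
  (qpow x - qpow (- x)) / (qpar - qpar^-1).

Definition qfact (k : nat) : R[i] := \prod_(1 <= i < k.+1) qnum i%:R.

End QNumbers.

Section QuantumGL.
Variables (R : realType) (n m : nat).
Local Notation C := R[i].
Local Notation q := (qpar R m).

Inductive uq_gen :=
  | GE of {i : nat | (1 <= i < n)%N}
  | GF of {i : nat | (1 <= i < n)%N}
  | GK of {j : nat | (1 <= j <= n)%N}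
  | GKi of {j : nat | (1 <= j <= n)%N}.

Inductive uq_term :=
  | Gen of uq_gen
  | Cst of C
  | Add of uq_term & uq_term
  | Mul of uq_term & uq_term.

Local Notation "x +' y" := (Add x y) (at level 50, left associativity).
Local Notation "x *' y" := (Mul x y) (at level 40, left associativity).
Local Notation "c %:U" := (Cst c) (at level 1, format "c %:U").
Local Notation "x -' y" := (x +' (-1)%:U *' y) (at level 50, left associativity).

(* Total in the index: an index out of range gives 0. *)
Definition tE (i : nat) : uq_term := oapp (fun i => Gen (GE i)) 0%:U (insub i).
Definition tF (i : nat) : uq_term := oapp (fun i => Gen (GF i)) 0%:U (insub i).
Definition tK (j : nat) : uq_term := oapp (fun j => Gen (GK j)) 0%:U (insub j).
Definition tKi (j : nat) : uq_term := oapp (fun j => Gen (GKi j)) 0%:U (insub j).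

Definition tserre (x y : uq_term) : uq_term :=
  x *' x *' y -' (q + q^-1)%:U *' (x *' y *' x) +' y *' x *' x.

Inductive uq_rel : uq_term -> uq_term -> Prop :=
  | rel_KK i j of (1 <= i <= n)%N & (1 <= j <= n)%N :
      uq_rel (tK i *' tK j) (tK j *' tK i)
  | rel_KKi j of (1 <= j <= n)%N : uq_rel (tK j *' tKi j) 1%:U
  | rel_KiK j of (1 <= j <= n)%N : uq_rel (tKi j *' tK j) 1%:U
  | rel_KE i j of (1 <= i <= n)%N & (1 <= j < n)%N :
      uq_rel (tK i *' tE j *' tKi i)
             ((q ^ ((i == j)%:Z - (i == j.+1)%:Z))%:U *' tE j)
  | rel_KF i j of (1 <= i <= n)%N & (1 <= j < n)%N :
      uq_rel (tK i *' tF j *' tKi i)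
             ((q ^ ((i == j.+1)%:Z - (i == j)%:Z))%:U *' tF j)
  | rel_EF i j of (1 <= i < n)%N & (1 <= j < n)%N :
      uq_rel (tE i *' tF j -' tF j *' tE i)
             (((i == j)%:R / (q - q^-1))%:U *'
                (tK i *' tKi i.+1 -' tK i.+1 *' tKi i))
  | rel_EE i j of (1 <= i)%N & (i.+1 < j < n)%N :
      uq_rel (tE i *' tE j) (tE j *' tE i)
  | rel_FF i j of (1 <= i)%N & (i.+1 < j < n)%N :
      uq_rel (tF i *' tF j) (tF j *' tF i)
  | rel_serreE i j of (1 <= i < n)%N & (1 <= j < n)%N &
      (j == i.+1) || (i == j.+1) : uq_rel (tserre (tE i) (tE j)) 0%:U
  | rel_serreF i j of (1 <= i < n)%N & (1 <= j < n)%N &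
      (j == i.+1) || (i == j.+1) : uq_rel (tserre (tF i) (tF j)) 0%:U.

(* The congruence generated by the axioms of unital associative C-algebras
   and the defining relations; the quotient is the presented algebra. *)
Inductive uq_cong : uq_term -> uq_term -> Prop :=
  | cong_rel x y of uq_rel x y : uq_cong x y
  | cong_refl x : uq_cong x x
  | cong_sym x y of uq_cong x y : uq_cong y x
  | cong_trans y x z of uq_cong x y & uq_cong y z : uq_cong x z
  | cong_add x x' y y' of uq_cong x x' & uq_cong y y' :
      uq_cong (x +' y) (x' +' y')
  | cong_mul x x' y y' of uq_cong x x' & uq_cong y y' :
      uq_cong (x *' y) (x' *' y')
  | cong_addA x y z : uq_cong (x +' (y +' z)) (x +' y +' z)
  | cong_addC x y : uq_cong (x +' y) (y +' x)
  | cong_add0 x : uq_cong (0%:U +' x) x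
  | cong_mulA x y z : uq_cong (x *' (y *' z)) (x *' y *' z)
  | cong_1mul x : uq_cong (1%:U *' x) x
  | cong_mul1 x : uq_cong (x *' 1%:U) x
  | cong_mulDl x y z : uq_cong ((x +' y) *' z) (x *' z +' y *' z)
  | cong_mulDr x y z : uq_cong (x *' (y +' z)) (x *' y +' x *' z)
  | cong_cstD a b : uq_cong (a + b)%:U (a%:U +' b%:U)
  | cong_cstM a b : uq_cong (a * b)%:U (a%:U *' b%:U)
  | cong_cstC a x : uq_cong (a%:U *' x) (x *' a%:U)
  | cong_0mul x : uq_cong (0%:U *' x) 0%:U.

HB.instance Definition _ := gen_eqMixin uq_term.
HB.instance Definition _ := gen_choiceMixin uq_term.

Definition uq_eq (x y : uq_term) : bool := `[< uq_cong x y >].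

Lemma uq_eq_equiv : equiv_class_of uq_eq.
Proof.
split=> [x|x y|y x z].
- by apply/asboolP/cong_refl.
- by apply/asboolP/asboolP => /cong_sym.
- by move=> /asboolP xy /asboolP yz; apply/asboolP/(cong_trans xy).
Qed.

Canonical uq_equiv := EquivRelPack uq_eq_equiv.

Definition Uq : Type := {eq_quot uq_equiv}.
HB.instance Definition _ := Choice.on Uq.
HB.instance Definition _ := EqQuotient.on Uq.

Lemma uqW (P : Uq -> Type) : (forall x, P (\pi_Uq x)) -> forall x, P x.
Proof. by move=> Ppi x; rewrite -[x]reprK; apply: Ppi. Qed.

Lemma uq_piP x y : reflect (uq_cong x y) (\pi_Uq x == \pi_Uq y).
Proof. by rewrite piE; apply: asboolP. Qed.

Lemma uq_pi x y : uq_cong x y -> \pi_Uq x = \pi_Uq y.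
Proof. by move=> /uq_piP/eqP. Qed.

Lemma uq_repr x : uq_cong (repr (\pi_Uq x)) x.
Proof. by apply/uq_piP; rewrite reprK. Qed.

Definition uq_add (x y : Uq) : Uq := \pi_Uq (repr x +' repr y).
Definition uq_mul (x y : Uq) : Uq := \pi_Uq (repr x *' repr y).
Definition uq_opp (x : Uq) : Uq := \pi_Uq ((-1)%:U *' repr x).
Definition uq_scale (a : C) (x : Uq) : Uq := \pi_Uq (a%:U *' repr x).

Lemma uq_addE x y : uq_add (\pi_Uq x) (\pi_Uq y) = \pi_Uq (x +' y).
Proof. by apply/uq_pi/cong_add; apply: uq_repr. Qed.

Lemma uq_mulE x y : uq_mul (\pi_Uq x) (\pi_Uq y) = \pi_Uq (x *' y).
Proof. by apply/uq_pi/cong_mul; apply: uq_repr. Qed.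

Lemma uq_scaleE a x : uq_scale a (\pi_Uq x) = \pi_Uq (a%:U *' x).
Proof. by apply/uq_pi/cong_mul; [apply: cong_refl | apply: uq_repr]. Qed.

Lemma uq_oppE x : uq_opp (\pi_Uq x) = \pi_Uq ((-1)%:U *' x).
Proof. exact: uq_scaleE. Qed.

Let piE' := (uq_addE, uq_mulE, uq_oppE, uq_scaleE).

Lemma uq_addA : associative uq_add.
Proof.
elim/uqW=> x; elim/uqW=> y; elim/uqW=> z; rewrite !piE'.
exact/uq_pi/cong_addA.
Qed.

Lemma uq_addC : commutative uq_add.
Proof.
by elim/uqW=> x; elim/uqW=> y; rewrite !piE'; apply/uq_pi/cong_addC.
Qed.

Lemma uq_add0 : left_id (\pi_Uq 0%:U) uq_add.
Proof. by elim/uqW=> x; rewrite !piE'; apply/uq_pi/cong_add0. Qed.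

Lemma uq_addN : left_inverse (\pi_Uq 0%:U) uq_opp uq_add.
Proof.
elim/uqW=> x; rewrite !piE'; apply/uq_pi.
apply: (@cong_trans ((-1)%:U *' x +' 1%:U *' x)).
  by apply: cong_add; [apply: cong_refl | apply/cong_sym/cong_1mul].
apply: cong_trans (cong_0mul x).
apply: (@cong_trans (((-1)%:U +' 1%:U) *' x)); first exact/cong_sym/cong_mulDl.
apply: cong_mul (cong_refl x).
by apply: cong_sym; rewrite -(addNr (1 : C)); apply: cong_cstD.
Qed.

Lemma uq_mulA : associative uq_mul.
Proof.
elim/uqW=> x; elim/uqW=> y; elim/uqW=> z; rewrite !piE'.
exact/uq_pi/cong_mulA.
Qed.

Lemma uq_mul1l : left_id (\pi_Uq 1%:U) uq_mul.
Proof. by elim/uqW=> x; rewrite !piE'; apply/uq_pi/cong_1mul. Qed.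

Lemma uq_mul1r : right_id (\pi_Uq 1%:U) uq_mul.
Proof. by elim/uqW=> x; rewrite !piE'; apply/uq_pi/cong_mul1. Qed.

Lemma uq_mulDl : left_distributive uq_mul uq_add.
Proof.
elim/uqW=> x; elim/uqW=> y; elim/uqW=> z; rewrite !piE'.
exact/uq_pi/cong_mulDl.
Qed.

Lemma uq_mulDr : right_distributive uq_mul uq_add.
Proof.
elim/uqW=> x; elim/uqW=> y; elim/uqW=> z; rewrite !piE'.
exact/uq_pi/cong_mulDr.
Qed.

(* The trivial representation, only used to see that 1 <> 0 in Uq. *)
Fixpoint uq_triv (x : uq_term) : C :=
  match x with
  | Gen (GE _) | Gen (GF _) => 0
  | Gen (GK _) | Gen (GKi _) => 1
  | Cst c => c
  | x +' y => uq_triv x + uq_triv y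
  | x *' y => uq_triv x * uq_triv y
  end.

Lemma uq_triv_cong x y : uq_cong x y -> uq_triv x = uq_triv y.
Proof.
have tK1 j : (1 <= j <= n)%N -> uq_triv (tK j) = 1 /\ uq_triv (tKi j) = 1.
  by move=> hj; rewrite /tK /tKi insubT.
have tE0 j : uq_triv (tE j) = 0 by rewrite /tE; case: insubP.
have tF0 j : uq_triv (tF j) = 0 by rewrite /tF; case: insubP.
elim=> {x y} //=.
- move=> x y [] {x y} /=.
  + by move=> i j _ _; rewrite mulrC.
  + by move=> j /tK1[-> ->]; rewrite mulr1.
  + by move=> j /tK1[-> ->]; rewrite mulr1.
  + by move=> i j _ _; rewrite tE0 !(mulr0, mul0r).
  + by move=> i j _ _; rewrite tF0 !(mulr0, mul0r).
  + move=> i j /andP[i1 ltin] _; rewrite tE0 tF0.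
    have [|-> ->] := tK1 i; first by rewrite i1 ltnW.
    have [|-> ->] := tK1 i.+1; first by rewrite ltin.
    by rewrite !(mulr0, mul0r, mulr1, addr0, subrr).
  + by move=> i j _ _; rewrite mulrC.
  + by move=> i j _ _; rewrite mulrC.
  + by move=> i j _ _ _; rewrite !tE0 !(mulr0, mul0r, addr0).
  + by move=> i j _ _ _; rewrite !tF0 !(mulr0, mul0r, addr0).
- by move=> y x z _ -> _ ->.
- by move=> x x' y y' _ -> _ ->.
- by move=> x x' y y' _ -> _ ->.
- by move=> x y z; rewrite addrA.
- by move=> x y; rewrite addrC.
- by move=> x; rewrite add0r.
- by move=> x y z; rewrite mulrA.
- by move=> x; rewrite mul1r.
- by move=> x; rewrite mulr1.
- by move=> x y z; rewrite mulrDl.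
- by move=> x y z; rewrite mulrDr.
- by move=> a x; rewrite mulrC.
- by move=> x; rewrite mul0r.
Qed.

Lemma uq_1neq0 : \pi_Uq 1%:U != \pi_Uq 0%:U.
Proof.
by apply/negP => /uq_piP/uq_triv_cong /= /eqP; rewrite oner_eq0.
Qed.

HB.instance Definition _ := GRing.isZmodule.Build Uq
  uq_addA uq_addC uq_add0 uq_addN.
HB.instance Definition _ := GRing.Zmodule_isNzRing.Build Uq
  uq_mulA uq_mul1l uq_mul1r uq_mulDl uq_mulDr uq_1neq0.

Lemma uq_scaleA a b x : uq_scale a (uq_scale b x) = uq_scale (a * b) x.
Proof.
elim/uqW: x => x; rewrite !piE'; apply/uq_pi.
apply: cong_trans (cong_mulA _ _ _) _.
by apply: cong_mul (cong_refl x); apply/cong_sym/cong_cstM.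
Qed.

Lemma uq_scale1 : left_id 1 uq_scale.
Proof. by elim/uqW=> x; rewrite !piE'; apply/uq_pi/cong_1mul. Qed.

Lemma uq_scaleDr : right_distributive uq_scale +%R.
Proof.
move=> a; elim/uqW=> x; elim/uqW=> y; rewrite /GRing.add /= !piE'.
exact/uq_pi/cong_mulDr.
Qed.

Lemma uq_scaleDl x : {morph uq_scale^~ x : a b / a + b}.
Proof.
elim/uqW: x => x a b; rewrite [RHS]/GRing.add /= !piE'; apply/uq_pi.
apply: cong_trans (cong_mulDl _ _ _).
by apply: cong_mul (cong_refl x); apply: cong_cstD.
Qed.

HB.instance Definition _ := GRing.Zmodule_isLmodule.Build C Uq
  uq_scaleA uq_scale1 uq_scaleDr uq_scaleDl.

Lemma uq_scaleAl (a : C) (x y : Uq) : a *: (x * y) = (a *: x) * y.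
Proof.
elim/uqW: x => x; elim/uqW: y => y.
rewrite /GRing.scale /GRing.mul /= !piE'; exact/uq_pi/cong_mulA.
Qed.

Lemma uq_scaleAr (a : C) (x y : Uq) : a *: (x * y) = x * (a *: y).
Proof.
elim/uqW: x => x; elim/uqW: y => y.
rewrite /GRing.scale /GRing.mul /= !piE'; apply/uq_pi.
apply: cong_trans (cong_mulA _ _ _) _.
apply: cong_trans (cong_sym (cong_mulA _ _ _)).
by apply: cong_mul (cong_refl y); apply: cong_cstC.
Qed.

HB.instance Definition _ := GRing.Lmodule_isLalgebra.Build C Uq uq_scaleAl.
HB.instance Definition _ := GRing.Lalgebra_isAlgebra.Build C Uq uq_scaleAr.

Definition uqE (i : nat) : Uq := \pi_Uq (tE i).
Definition uqF (i : nat) : Uq := \pi_Uq (tF i).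
Definition uqK (j : nat) : Uq := \pi_Uq (tK j).
Definition uqKi (j : nat) : Uq := \pi_Uq (tKi j).

End QuantumGL.

Section GroundBasis.
Variables (F : fieldType) (A : algType F) (M : lmodType A).

(* F acts on M through F -> A, c |-> c%:A. *)
Definition ground_basis (I : choiceType) (b : I -> M) : Prop :=
  forall x : M, exists! a : {fsfun I -> F with 0},
    x = \sum_(i <- finsupp a) (a i)%:A *: b i.

Definition ground_dim (d : nat) : Prop :=
  exists b : 'I_d -> M, ground_basis b.

End GroundBasis.

Definition position (n : nat) : Type :=
  {p : 'I_n.+1 * 'I_n.+1 | (1 <= p.2 <= p.1)%N}.
HB.instance Definition _ n := SubFinite.on (position n).

Notation tableau n K := {ffun position n -> K}.

(* The entry (i, j); it is 0 outside of the positions, since inord sends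
   an index that exceeds n to 0. *)
Definition ent n (K : zmodType) (w : tableau n K) (i j : nat) : K :=
  oapp w 0 (insub (inord i, inord j)).

Definition delta_tab n (K : nzRingType) (k j : nat) : tableau n K :=
  [ffun p : position n => (((val p).1 == k :> nat) && ((val p).2 == j :> nat))%:R].

Definition lattice (n : nat) : Type :=
  {z : tableau n int | [forall j : 'I_n.+1, ent z n j == 0]}.
HB.instance Definition _ n := SubChoice.on (lattice n).

Section Tableaux.
Variables (R : realType) (n m : nat).
Local Notation C := R[i].
Local Notation q := (qpar R m).
Local Notation U := (Uq R n m).
Local Notation tab := (tableau n C).
Implicit Types (v w : tab) (z : lattice n).

Definition shift v z : tab := v + [ffun p : position n => (val z p)%:~R].

Definition in_Z (x : C) : Prop := exists a : int, x = a%:~R.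
Definition in_halfZ (x : C) : Prop := exists a : int, x = a%:~R / 2.

Definition generic v : Prop :=
  forall k i j, (1 <= k < n)%N -> (1 <= i <= k)%N -> (1 <= j <= k)%N ->
    i != j -> ~ in_halfZ (ent v k i - ent v k j).

Definition conventionA v : Prop :=
  forall a b i j, (1 <= b <= a)%N -> (a <= n)%N ->
    (1 <= j <= i)%N -> (i <= n)%N ->
    in_Z (ent v a b - ent v i j) \/ ~ in_halfZ (ent v a b - ent v i j).

Definition integral_cols v (k i j : nat) : Prop :=
  (1 <= j <= k)%N /\ in_Z (ent v k j - ent v k.-1 i).

Definition conventionB v : Prop :=
  (forall k i, (2 <= k < n)%N -> (1 <= i <= k.-1)%N ->
     (exists j, integral_cols v k i j) ->
     (forall j, integral_cols v k i j <-> j = i) /\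
     ent v k i = ent v k.-1 i) /\
  (forall i, (1 <= i <= n.-1)%N ->
     (exists j, integral_cols v n i j) -> ent v n i = ent v n.-1 i).

Definition gt_a w (k : nat) : C :=
  \sum_(1 <= i < k.+1) ent w k i - \sum_(1 <= i < k) ent w k.-1 i + k%:R.

Definition gt_denom w (k j : nat) : C :=
  \prod_(1 <= i < k.+1 | i != j) qnum m (ent w k j - ent w k i).

Definition gt_coefE w (k j : nat) : C :=
  (\prod_(1 <= i < k.+2) qnum m (ent w k j - ent w k.+1 i)) / gt_denom w k j.

Definition gt_coefF w (k j : nat) : C :=
  (\prod_(1 <= i < k) qnum m (ent w k j - ent w k.-1 i)) / gt_denom w k j.

Definition gt_action (M : lmodType U) (T : tab -> M) w : Prop :=
  [/\ forall k, (1 <= k <= n)%N ->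
        uqK R n m k *: T w = (qpow m (gt_a w k))%:A *: T w,
      forall k, (1 <= k <= n)%N ->
        uqKi R n m k *: T w = (qpow m (- gt_a w k))%:A *: T w,
      forall k, (1 <= k < n)%N ->
        uqE R n m k *: T w =
        - \sum_(1 <= j < k.+1)
            (gt_coefE w k j)%:A *: T (w + delta_tab n C k j)
    & forall k, (1 <= k < n)%N ->
        uqF R n m k *: T w =
        \sum_(1 <= j < k.+1)
          (gt_coefF w k j)%:A *: T (w - delta_tab n C k j)].

(* This determines the U_q-module V up to isomorphism.  The values of T
   outside of v + lattice are irrelevant. *)
Definition is_gt_module v (V : lmodType U) (T : tab -> V) : Prop :=
  ground_basis (fun z => T (shift v z)) /\
  forall z, gt_action T (shift v z).

Section Quotient.
Variables (v : tab) (V : lmodType U) (T : tab -> V).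

Definition cyclic_gen (x : V) : Prop := x = T v.
Definition UqT : {pred V} := spanmod cyclic_gen.
Definition UqT_type := spanmod_type cyclic_gen.

(* Exactly one t satisfies this for given j <= k. *)
Definition column_run (k j t : nat) : Prop :=
  [/\ (j <= t <= k)%N,
      forall l, (t <= l <= k)%N -> ent v l j = ent v k j
    & (j < t)%N -> ent v t j <> ent v t.-1 j].

Definition lower (k j t : nat) : tab :=
  v - \sum_(t <= l < k.+1) delta_tab n C l j *+ m.

Definition W1 (k j t : nat) : {pred V} :=
  spanmod (fun x => x = T (lower k j t) - T v).

Definition W2 (k j t : nat) : {pred V} :=
  spanmod (fun x => x = T (lower k j t)).

Definition is_choice (W : nat -> nat -> {pred V}) : Prop :=
  forall k j t, (1 <= j <= k)%N -> (k < n)%N -> column_run k j t ->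
    (ent v k.+1 j <> ent v k j -> W k j =i W1 k j t) /\
    (ent v k.+1 j = ent v k j -> W k j =i W1 k j t \/ W k j =i W2 k j t).

Definition same_choice (W W' : nat -> nat -> {pred V}) : Prop :=
  forall k j, (1 <= j <= k)%N -> (k < n)%N -> W k j =i W' k j.

(* Each W_kj of a choice lies in U_q(T(v)), so the submodule generated by
   their union there is their sum. *)
Definition Vbar (W : nat -> nat -> {pred V}) :=
  @quotmod U UqT_type (fun y => exists k j,
     [/\ (1 <= j <= k)%N, (k < n)%N & val y \in W k j]).

(* The image of T(w) if T(w) lies in U_q(T(v)), and 0 otherwise. *)
Definition Tbar (W : nat -> nat -> {pred V}) (w : tab) : Vbar W :=
  \pi_(Vbar W) (insubd (0 : UqT_type) (T w)).

End Quotient.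

Definition Rmat : 'M[C]_(n * n) :=
  let e (i j : 'I_n) : 'M[C]_n := delta_mx i j in
  q *: (\sum_i e i i *t e i i) +
  \sum_i \sum_(j | i != j) e i i *t e j j +
  (q - q^-1) *: (\sum_(i < n) \sum_(j < n | (i < j)%N) e i j *t e j i).

(* R L_1 L'_2 = L'_2 L_1 R with L_1 = L (x) 1 and L'_2 = 1 (x) L'. *)
Definition RLL (L L' : 'M[U]_n) : Prop :=
  let RU : 'M[U]_(n * n) := map_mx (fun c => c%:A) Rmat in
  let L1 : 'M[U]_(n * n) := L *t 1%:M in
  let L2 : 'M[U]_(n * n) := 1%:M *t L' in
  RU *m L1 *m L2 = L2 *m L1 *m RU.

(* Matrix indices start at 0, the indices of the generators at 1. *)
Definition is_Lpair (Lp Lm : 'M[U]_n) : Prop :=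
  [/\ forall i : 'I_n,
        Lp i i = uqK R n m i.+1 /\ Lm i i = uqKi R n m i.+1,
      forall i j : 'I_n, j = i.+1 :> nat ->
        Lp i j = (q - q^-1) *: (uqK R n m i.+1 * uqF R n m i.+1) /\
        Lm j i = - (q - q^-1) *: (uqE R n m i.+1 * uqKi R n m i.+1),
      forall i j : 'I_n, (j < i)%N -> Lp i j = 0 /\ Lm j i = 0
    & [/\ RLL Lp Lp, RLL Lm Lm & RLL Lp Lm]].

Definition perm_length r (s : 'S_r) : nat :=
  #|[set p : 'I_r * 'I_r | (p.1 < p.2)%N && (s p.2 < s p.1)%N]|.

Definition central (Lp Lm : 'M[U]_n) (r s : nat) (le_rn : (r <= n)%N) : U :=
  \sum_(u : 'S_r) \sum_(u' : 'S_r)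
    ((- q) ^- (perm_length u + perm_length u')) *:
      \prod_(i < r) (if (i < s)%N then Lp else Lm)
                      (widen_ord le_rn (u i)) (widen_ord le_rn (u' i)).

Definition is_shuffle r (s : nat) (t : 'S_r) : bool :=
  [forall i : 'I_r, forall j : 'I_r,
     (i < j)%N && ((j < s)%N || (s <= i)%N) ==> (t i < t j)%N].

Definition gamma (r s : nat) (w : tab) : C :=
  qfact R m s * qfact R m (r - s) *
  qpow m ((r * s)%:R - (r ^ 2)%:R + s%:R) *
  \sum_(t : 'S_r | is_shuffle s t)
    qpow m (\sum_(i < r | (i < s)%N) ent w r (t i).+1
            - \sum_(i < r | (s <= i)%N) ent w r (t i).+1).

End Tableaux.

(* Main.v *)
(** Write $T_z$ for $T(v+z)$.  The coefficient of $T_{z-\delta^{kj}}$ in $F_kT_z$ vanishes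
exactly when $v_{kj}=v_{k-1,j}$ (the position is then called linked) and $z_{kj}\equiv z_{k-1,j}$ mod $m$, and
similarly for $E_k$.  By interpolation from the eigenvalues of the $K_k$ and of products such as
$E_kF_k$, the algebra contains the projectors onto the span of the $T_z$ with $z$ in a given class
modulo $m$; hence every single step with a nonzero coefficient can be performed separately.  It
follows that $U_q(T(v))$ has basis the $T_z$ with $z_{kj}\ge z_{k-1,j}$ at the linked positions.
With $\rho_p=\delta^{kj}+\dots+\delta^{tj}$ for $p=(k,j)$, the translation $S_p$ by $-m\rho_p$
commutes with $U_q$, and $W_p$ is the image of $S_p-\epsilon_p$ with $\epsilon_p\in\{0,1\}$; so in
the quotient the coordinates of $z$ on the $-\rho_p$ are reduced modulo $m$, which gives the basis.
An element of $U_q$ that acts on the class of $0$ as $S_p$ and kills the other classes tells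
$\epsilon_p=0$ from $\epsilon_p=1$.

For the central elements, let $D_r(x)$ be the quantum minor of $L^++xL^-$ on the first $r$ rows and
columns, the $i$-th row being taken at $q^{2i}x$.  Up to explicit factors the $c_{rs}$ are
the coefficients of $D_r$ in $x$.  A quantum Sylvester identity reads
$D_r(x)D_{r-2}(q^2x)=S(x)D_{r-1}(x)-q\,B(q^2x)C(x)$ with $C=D_{r-1}E-qED_{r-1}$ and
$B=FD_{r-1}-q^{-1}D_{r-1}F$ for $E=E_{r-1}$, $F=F_{r-1}$.  At a zero of the eigenvalue of
$D_{r-1}$ on $T_z$ it determines $D_r(x)T_z$; these $r-1$ points and the two extreme coefficients
of $D_r$ determine it for all $x$. *)
Require Import Defs.
From HB Require Import structures.
From mathcomp Require Import fingroup.
From mathcomp Require Import all_boot all_order all_algebra perm.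
From mathcomp Require Import finmap complex mxtens.
From mathcomp Require Import boolp reals sequences exp trigo.
From mathcomp Require Import ring lra zify.

Set Implicit Arguments.
Unset Strict Implicit.
Unset Printing Implicit Defensive.

Import Order.TTheory GRing.Theory Num.Theory.
Local Open Scope ring_scope.
Local Open Scope complex_scope.
Local Open Scope quotient_scope.

Lemma dist_half (F : realFieldType) (x y : F) :
  y <= x + 2^-1 -> x + 2^-1 < y + 1 -> `|x - y| <= 2^-1.
Proof. by move=> h1 h2; rewrite ler_norml; apply/andP; split; lra. Qed.

Lemma half_period (F : realFieldType) (t p : F) :
  0 < p -> t <= 2^-1 -> t * (p *+ 2) <= p.
Proof. by move=> p0 ht; rewrite mulr2n; nra. Qed.

(** * q-numbers *)

Section QFacts.
Variables (R : realType) (m : nat).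
Hypotheses (m_ge3 : (3 <= m)%N) (m_odd : odd m).
Local Notation C := R[i].
Local Notation q := (qpar R m).
Local Notation Q := (@qpow R m).
Local Notation qn := (@qnum R m).

Lemma cexpD (x y : C) : cexp (x + y) = cexp x * cexp y.
Proof.
case: x => a b; case: y => c d; rewrite /cexp /=.
rewrite expRD cosD sinD; apply/eqP; rewrite eq_complex /=; apply/andP; split; apply/eqP; ring.
Qed.

Lemma cexp0 : cexp (0 : C) = 1.
Proof. by rewrite /cexp /= expR0 cos0 sin0 mul1r. Qed.

Lemma cosDint (y : R) (k : int) : cos (y + (trigo.pi *+ 2) *~ k) = cos y.
Proof.
case: k => k; first by rewrite -pmulrn periodicn //; exact: cosD2pi.
rewrite NegzE mulrNz -pmulrn -[in RHS](subrK ((trigo.pi *+ 2) *+ k.+1) y).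
by rewrite (periodicn (@cosD2pi R)).
Qed.

Lemma cos_eq1 (y : R) : cos y = 1 -> exists k : int, y = trigo.pi *+ 2 *~ k.
Proof.
move=> cosy; have pi0 := pi_gt0 R.
have pi20 : 0 < trigo.pi *+ 2 :> R by rewrite mulrn_wgt0.
pose k := Num.floor (y / (trigo.pi *+ 2) + 2^-1).
have /andP[h1 h2] := real_floor_itv (num_real (y / (trigo.pi *+ 2) + 2^-1)).
exists k; apply/eqP; rewrite -subr_eq0; set z := y - _.
have cosz : cos z = 1 by rewrite /z -mulrNz cosDint.
have zE : z = (y / (trigo.pi *+ 2) - k%:~R) * (trigo.pi *+ 2).
  by rewrite mulrBl divfK ?gt_eqF // /z mulrzl.
have hz : `|z| <= trigo.pi.
  have ht : `|y / (trigo.pi *+ 2) - k%:~R| <= 2^-1.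
    by apply: dist_half h1 _; move: h2; rewrite intrD.
  by rewrite zE normrM (gtr0_norm pi20) half_period.
have := @cos_inj R `|z| 0; rewrite !in_itv /= normr_ge0 hz lexx ltW //= cos0 cos_norm cosz.
by move=> /(_ isT isT erefl) /eqP; rewrite normr_eq0.
Qed.

Lemma qpowD x y : Q (x + y) = Q x * Q y.
Proof. by rewrite /qpow mulrDr cexpD. Qed.

Lemma qpow0 : Q 0 = 1.
Proof. by rewrite /qpow mulr0 cexp0. Qed.

Lemma qpowN x : Q (- x) = (Q x)^-1.
Proof.
have h : Q x * Q (- x) = 1 by rewrite -qpowD subrr qpow0.
have x0 : Q x != 0 by apply/eqP => x0; move: h; rewrite x0 mul0r => /esym/eqP; rewrite oner_eq0.
by apply: (mulfI x0); rewrite h divff.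
Qed.

Lemma qpow_neq0 x : Q x != 0.
Proof.
have h : Q x * Q (- x) = 1 by rewrite -qpowD subrr qpow0.
by apply/eqP => x0; move: h; rewrite x0 mul0r => /esym/eqP; rewrite oner_eq0.
Qed.

Lemma qpowB x y : Q (x - y) = Q x / Q y.
Proof. by rewrite qpowD qpowN. Qed.

Lemma qpow1 : Q 1 = q.
Proof. by rewrite /qpow mulr1. Qed.

Lemma qpowMn x (k : nat) : Q (x *+ k) = Q x ^+ k.
Proof. by elim: k => [|k IH]; rewrite ?mulr0n ?qpow0 ?expr0 // mulrS qpowD IH exprS. Qed.

Lemma qpow_nat (k : nat) : Q k%:R = q ^+ k.
Proof. by rewrite -qpow1 -qpowMn. Qed.

Lemma qpar_neq0 : q != 0. Proof. by rewrite -qpow1 qpow_neq0. Qed.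

Let m_gt0 : (0 < m)%N. Proof. by case: m m_ge3. Qed.

Lemma qpow_eq1 x : Q x = 1 -> exists a : int, x = a%:~R * m%:R.
Proof.
case: x => a b; rewrite /qpow /cexp /= => /eqP; rewrite eq_complex /= => /andP[/eqP h1 /eqP h2].
have th0 : 0 < theta R m by rewrite /theta divr_gt0 ?ltr0n // mulr_gt0 ?pi_gt0 // ltr0n.
move: h1 h2; rewrite !(oppr0, mul0r, mul1r, mulr0, subr0, sub0r, addr0, add0r) => h1 h2.
set t := theta R m in h1 h2 th0 *.
have e0 := expR_gt0 (- (t * b)).
have sin_eq0 : sin (t * a) = 0.
  by apply/eqP; move/eqP: h2; rewrite mulf_eq0 (gt_eqF e0).
have cos1 : cos (t * a) = 1.
  have := cos2Dsin2 (t * a); rewrite sin_eq0 expr0n /= addr0 => /eqP; rewrite sqrf_eq1 => /orP[/eqP //|/eqP hh].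
  by move: h1; rewrite hh mulrN1 => h1; move: e0; rewrite -oppr_lt0 h1 ltr10.
have b0 : b = 0.
  move: h1; rewrite cos1 mulr1 => h1; have := expRK (- (t * b)); rewrite h1 ln1 => /esym/eqP.
  by rewrite oppr_eq0 mulf_eq0 gt_eqF //= => /eqP.
have [k hk] := cos_eq1 cos1; exists k.
have am : a = k%:~R * m%:R.
  apply: (mulfI (lt0r_neq0 th0)); rewrite hk /t /theta -mulrzl -mulr_natl.
  have m0 : m%:R != 0 :> R by rewrite pnatr_eq0 -lt0n.
  by field.
rewrite b0 am -[LHS]/((k%:~R * m%:R)%:C).
by rewrite rmorphM /= rmorph_int rmorph_nat.
Qed.

Lemma qpowm : Q m%:R = 1.
Proof.
rewrite /qpow /cexp.
have -> : 'i * (theta R m)%:C * m%:R = 0 +i* (trigo.pi *+ 2).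
  rewrite -(rmorph_nat (real_complex R) m) -mulrA -rmorphM /=.
  have -> : theta R m * m%:R = trigo.pi *+ 2.
    by rewrite /theta divfK ?mulr_natl // pnatr_eq0 -lt0n.
  by apply/eqP; rewrite eq_complex /= !(mul0r, oppr0, mul1r, mulr0, subr0, add0r, addr0) !eqxx.
by rewrite /= expR0 cos2pi sin2pi mul1r.
Qed.

Lemma qpow_mint (a : int) : Q (m%:R *~ a) = 1.
Proof.
have hn (k : nat) : Q (m%:R *+ k) = 1 by rewrite qpowMn qpowm expr1n.
by case: a => k; rewrite ?NegzE ?mulrNz ?qpowN -pmulrn hn ?invr1.
Qed.

Lemma qpow_int_eq1 (a : int) : Q a%:~R = 1 <-> (m %| a)%Z.
Proof.
split=> [/qpow_eq1 [k] /eqP|/dvdzP [k ->]].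
  by rewrite -[m%:R]/((Posz m)%:~R) -intrM eqr_int => /eqP ->; rewrite dvdz_mull.
by rewrite intrM mulrzl -[_%:~R]/m%:R qpow_mint.
Qed.

Lemma dvdz2 (a : int) : (m %| 2 * a)%Z = (m %| a)%Z.
Proof. by rewrite Gauss_dvdzr // coprimezE /= coprimen2. Qed.

Lemma expq_eq1 (k : nat) : (q ^+ k == 1) = (m %| k)%N.
Proof.
rewrite -qpow_nat; apply/eqP/idP => h.
  by apply/(qpow_int_eq1 (Posz k)).
by apply/(qpow_int_eq1 (Posz k)).
Qed.

Lemma q2_neq1 : q ^+ 2 != 1.
Proof. by rewrite expq_eq1; apply/negP => /dvdn_leq; lia. Qed.

Lemma q2_neqN1 : 1 + q ^+ 2 != 0.
Proof.
apply/eqP => h; have : q ^+ 4 == 1.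
  have -> : q ^+ 4 = 1 + (q ^+ 2 - 1) * (1 + q ^+ 2) by ring.
  by rewrite h mulr0 addr0.
rewrite expq_eq1 -[4%N]/(2 * 2)%N !Gauss_dvdr ?coprimen2 // => /dvdn_leq; lia.
Qed.

Lemma qlam_neq0 : q - q^-1 != 0.
Proof.
rewrite subr_eq0; apply/eqP => h; move: q2_neq1.
by rewrite expr2 {2}h divff ?qpar_neq0 ?eqxx.
Qed.

Lemma qnumE x : qn x = (Q x - Q (- x)) / (q - q^-1).
Proof. by []. Qed.

Lemma qnum1 : qn 1 = 1.
Proof. by rewrite qnumE qpowN qpow1 divff ?qlam_neq0. Qed.

Lemma qnum0 : qn 0 = 0.
Proof. by rewrite qnumE oppr0 subrr mul0r. Qed.

Lemma qnum_eq0 x : (qn x == 0) = (Q (x *+ 2) == 1).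
Proof.
rewrite qnumE mulf_eq0 invr_eq0 (negbTE qlam_neq0) orbF subr_eq0 qpowN.
rewrite -(inj_eq (mulIf (qpow_neq0 x))) mulVf ?qpow_neq0 //.
by rewrite mulr2n qpowD.
Qed.

Lemma qnum_half x : qn x = 0 -> in_halfZ x.
Proof.
move/eqP; rewrite qnum_eq0 => /eqP /qpow_eq1 [a ha]; exists (a * m).
by rewrite intrM -[(Posz m)%:~R]/(m%:R) -ha -(mulr_natr x) mulfK ?pnatr_eq0.
Qed.

Lemma qnum_int_eq0 (a : int) : (qn a%:~R == 0) = (m %| a)%Z.
Proof.
rewrite qnum_eq0; have -> : a%:~R *+ 2 = (2 * a)%:~R :> C by rewrite -(mulr_natl a%:~R) intrM.
by rewrite -dvdz2; apply/eqP/idP => /qpow_int_eq1.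
Qed.

Lemma qpowDm x (a : int) : Q (x + m%:R *~ a) = Q x.
Proof. by rewrite qpowD qpow_mint mulr1. Qed.

Lemma qnumDm x (a : int) : qn (x + m%:R *~ a) = qn x.
Proof. by rewrite !qnumE qpowDm opprD -mulrNz qpowDm. Qed.

End QFacts.

(** * Tableaux and their integral translates *)

Section Entries.
Variable n : nat.

Definition posn (k j : nat) (h : (1 <= j <= k)%N) (hk : (k <= n)%N) : position n.
Proof.
exists (inord k, inord j) => /=.
by case/andP: h => h1 h2; rewrite !inordK ?h1 ?h2 // ltnS // (leq_trans h2).
Defined.

Lemma ent_posn (K : zmodType) (w : tableau n K) k j h hk : ent w k j = w (@posn k j h hk).
Proof. by rewrite /ent (insubT _ (valP (posn h hk))) /=; congr (w _); apply: val_inj. Qed.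

Lemma posnP (p : position n) : exists k j h hk, p = @posn k j h hk.
Proof.
case: p => [[k j] /= h]; have hk : (k <= n)%N by rewrite -ltnS.
exists k, j, h, hk; apply: val_inj => /=; by rewrite !inord_val.
Qed.

Lemma tableau_eqP (K : zmodType) (w w' : tableau n K) :
  (forall k j, (1 <= j <= k)%N -> (k <= n)%N -> ent w k j = ent w' k j) -> w = w'.
Proof.
by move=> h; apply/ffunP => p; have [k [j [h1 [h2 ->]]]] := posnP p; rewrite -!ent_posn h.
Qed.

Lemma entD (K : zmodType) (w w' : tableau n K) k j : ent (w + w') k j = ent w k j + ent w' k j.
Proof. by rewrite /ent; case: insub => /= [p|]; rewrite ?ffunE ?addr0. Qed.

Lemma entN (K : zmodType) (w : tableau n K) k j : ent (- w) k j = - ent w k j.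
Proof. by rewrite /ent; case: insub => /= [p|]; rewrite ?ffunE ?oppr0. Qed.

Lemma ent0 (K : zmodType) k j : ent (0 : tableau n K) k j = 0.
Proof. by rewrite /ent; case: insub => /= [p|]; rewrite ?ffunE. Qed.

Lemma ent_ffun (K : zmodType) (f : nat -> nat -> K) k j : (1 <= j <= k)%N -> (k <= n)%N ->
  ent [ffun p : position n => f (val p).1 (val p).2] k j = f k j.
Proof.
move=> h hk; rewrite (ent_posn _ h hk) ffunE /= !inordK //.
by case/andP: h => _ h; rewrite ltnS (leq_trans h).
Qed.

Lemma ent_out (K : zmodType) (w : tableau n K) k j : (k <= n)%N -> (j <= n)%N ->
  ~~ (1 <= j <= k)%N -> ent w k j = 0.
Proof. by move=> hk hj h; rewrite /ent insubF //= !inordK ?ltnS // (negbTE h). Qed.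

Lemma ent_delta (K : nzRingType) k j k' j' : (1 <= j' <= k')%N -> (k' <= n)%N ->
  ent (delta_tab n K k j) k' j' = ((k' == k) && (j' == j))%:R.
Proof.
by move=> h hk; rewrite /delta_tab (ent_ffun (fun a b => ((a == k) && (b == j))%:R)).
Qed.

Definition lat_pred : {pred tableau n int} :=
  fun z => [forall j : 'I_n.+1, ent z n j == 0].

Lemma lat_zmod_closed : zmod_closed lat_pred.
Proof.
split=> [|x y /forallP hx /forallP hy]; apply/forallP => j; first by rewrite ent0.
by rewrite entD entN (eqP (hx j)) (eqP (hy j)) subr0.
Qed.

Lemma lat_predB (x y : lattice n) : lat_pred (val x - val y).
Proof. by have [_ h] := lat_zmod_closed; apply: (h _ _ (valP x) (valP y)). Qed.

Definition lat0 : lattice n := @exist (tableau n int) lat_pred 0 (proj1 lat_zmod_closed).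
Definition lat_sub (x y : lattice n) : lattice n := @exist (tableau n int) lat_pred _ (lat_predB x y).
Definition lat_opp (x : lattice n) := lat_sub lat0 x.
Definition lat_add (x y : lattice n) := lat_sub x (lat_opp y).

Lemma val_lat_add x y : val (lat_add x y) = val x + val y.
Proof. by rewrite /= sub0r opprK. Qed.

Lemma lat_addA : associative lat_add.
Proof. by move=> x y z; apply: val_inj; rewrite !val_lat_add addrA. Qed.
Lemma lat_addC : commutative lat_add.
Proof. by move=> x y; apply: val_inj; rewrite !val_lat_add addrC. Qed.
Lemma lat_add0 : left_id lat0 lat_add.
Proof. by move=> x; apply: val_inj; rewrite !val_lat_add add0r. Qed.
Lemma lat_addN : left_inverse lat0 lat_opp lat_add.
Proof. by move=> x; apply: val_inj; rewrite !val_lat_add /= sub0r addNr. Qed.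

HB.instance Definition _ := GRing.isZmodule.Build (lattice n)
  lat_addA lat_addC lat_add0 lat_addN.

Lemma val_latD (x y : lattice n) : val (x + y) = val x + val y.
Proof. exact: val_lat_add. Qed.

Lemma val_latN (x : lattice n) : val (- x) = - val x.
Proof. by rewrite /= sub0r. Qed.

Lemma val_lat0 : val (0 : lattice n) = 0.
Proof. by []. Qed.

Definition e (z : lattice n) k j : int := ent (val z) k j.

Lemma eD z z' k j : e (z + z') k j = e z k j + e z' k j.
Proof. by rewrite /e val_latD entD. Qed.

Lemma eN z k j : e (- z) k j = - e z k j.
Proof. by rewrite /e val_latN entN. Qed.

Lemma e0 k j : e 0 k j = 0.
Proof. by rewrite /e val_lat0 ent0. Qed.

Lemma etop z j : (j <= n)%N -> e z n j = 0.
Proof.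
move=> hj; have := forallP (valP z) (inord j); by rewrite inordK ?ltnS // => /eqP.
Qed.

Lemma lat_eqP (z z' : lattice n) :
  (forall k j, (1 <= j <= k)%N -> (k < n)%N -> e z k j = e z' k j) -> z = z'.
Proof.
move=> h; apply: val_inj; apply: tableau_eqP => k j hj; rewrite leq_eqVlt => /orP[/eqP kn|]; last exact: h.
by subst k; rewrite -[LHS]/(e z n j) -[RHS]/(e z' n j) !etop //; case/andP: hj.
Qed.

Lemma mklat_subproof (f : nat -> nat -> int) :
  lat_pred [ffun p : position n => if ((val p).1 < n)%N then f (val p).1 (val p).2 else 0].
Proof.
apply/forallP => j; case: (boolP (1 <= j <= n)%N) => hj.
  by rewrite (ent_ffun (fun k j => if (k < n)%N then f k j else 0)) // ltnn.
by rewrite ent_out // -ltnS.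
Qed.

Definition mklat f : lattice n := @exist (tableau n int) lat_pred _ (mklat_subproof f).

Lemma e_mklat f k j : (1 <= j <= k)%N -> (k < n)%N -> e (mklat f) k j = f k j.
Proof.
move=> hj hk; rewrite /e /= (ent_ffun (fun k j => if (k < n)%N then f k j else 0)) ?hk //.
exact: ltnW.
Qed.

Definition dl k j : lattice n := mklat (fun k' j' => ((k' == k) && (j' == j))%:R).

Lemma e_dl k j k' j' : (1 <= j' <= k')%N -> (k' < n)%N -> e (dl k j) k' j' = ((k' == k) && (j' == j))%:R.
Proof. exact: e_mklat. Qed.

Lemma e_dl_le k j k' j' : (1 <= j' <= k')%N -> (k' <= n)%N -> (k < n)%N ->
  e (dl k j) k' j' = ((k' == k) && (j' == j))%:R.
Proof.
move=> h; rewrite leq_eqVlt => /orP[/eqP kn hk|hk' _]; last exact: e_dl.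
by move: h; rewrite kn => /andP[_ h]; rewrite etop // gtn_eqF.
Qed.

Lemma ent_shift (R : realType) (v : tableau n R[i]) (z : lattice n) k j :
  ent (shift v z) k j = ent v k j + (e z k j)%:~R.
Proof.
rewrite /shift entD; congr (_ + _); rewrite /e /ent.
by case: insub => //= p; rewrite ffunE.
Qed.

Lemma shiftD_dl (R : realType) (v : tableau n R[i]) (z : lattice n) k j : (k < n)%N ->
  shift v z + delta_tab n _ k j = shift v (z + dl k j).
Proof.
move=> hk; apply: tableau_eqP => a b hb ha.
by rewrite entD !ent_shift eD e_dl_le // ent_delta // intrD addrA; case: (_ && _).
Qed.

Lemma shiftB_dl (R : realType) (v : tableau n R[i]) (z : lattice n) k j : (k < n)%N ->
  shift v z - delta_tab n _ k j = shift v (z - dl k j).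
Proof.
by move=> hk; rewrite -[z in LHS](subrK (dl k j)) -shiftD_dl // addrK.
Qed.

Lemma shift0 (R : realType) (v : tableau n R[i]) : shift v 0 = v.
Proof. by apply: tableau_eqP => a b _ _; rewrite ent_shift e0 addr0. Qed.

End Entries.

Lemma quotW (R : realType) n m (P : Uq R n m -> Prop) : 
  (forall c : R[i], P c%:A) -> (forall x y, P x -> P y -> P (x + y)) ->
  (forall x y, P x -> P y -> P (x * y)) ->
  (forall i, (1 <= i < n)%N -> P (uqE R n m i)) ->
  (forall i, (1 <= i < n)%N -> P (uqF R n m i)) ->
  (forall i, (1 <= i <= n)%N -> P (uqK R n m i)) ->
  (forall i, (1 <= i <= n)%N -> P (uqKi R n m i)) -> forall u, P u.
Proof.
move=> Pc PD PM PE PF PK PKi; elim/uqW; elim=> [g|c|x IHx y IHy|x IHx y IHy].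
- have tE (i : {i : nat | (1 <= i < n)%N}) : @Gen R n (GE i) = tE R n (val i).
    by rewrite /tE valK.
  have tF (i : {i : nat | (1 <= i < n)%N}) : @Gen R n (GF i) = tF R n (val i).
    by rewrite /tF valK.
  have tK (i : {i : nat | (1 <= i <= n)%N}) : @Gen R n (GK i) = tK R n (val i).
    by rewrite /tK valK.
  have tKi (i : {i : nat | (1 <= i <= n)%N}) : @Gen R n (GKi i) = tKi R n (val i).
    by rewrite /tKi valK.
  case: g => i; rewrite ?tE ?tF ?tK ?tKi; [apply: PE|apply: PF|apply: PK|apply: PKi]; exact: (valP i).
- suff -> : \pi_(Uq R n m) (Cst n c) = c%:A by [].
  rewrite /GRing.scale /= -[1]/(\pi_(Uq R n m) (Cst n 1)) uq_scaleE.
  apply/uq_pi; rewrite -{1}[c]mulr1.  apply: cong_cstM.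
- by rewrite -uq_addE; apply: PD.
- by rewrite -uq_mulE; apply: PM.
Qed.

Notation "c *' x" := ((c%:A : Uq _ _ _) *: x) (at level 40, left associativity) : ring_scope.

Section ScalarAction.
Variables (R : realType) (n m : nat) (V : lmodType (Uq R n m)).
Implicit Types (c d : R[i]) (x y : V) (u : Uq R n m).

Lemma scA c d x : c *' (d *' x) = (c * d) *' x.
Proof. by rewrite scalerA mulr_algl scalerA. Qed.
Lemma sc1 x : 1 *' x = x. Proof. by rewrite !scale1r. Qed.
Lemma sc0 x : 0 *' x = 0. Proof. by rewrite !scale0r. Qed.
Lemma scx0 c : c *' (0 : V) = 0. Proof. by rewrite scaler0. Qed.
Lemma scDl c d x : (c + d) *' x = c *' x + d *' x.
Proof. by rewrite !scalerDl. Qed.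
Lemma scDr c x y : c *' (x + y) = c *' x + c *' y.
Proof. by rewrite !scalerDr. Qed.
Lemma scN c x : (- c) *' x = - (c *' x).
Proof. by rewrite !scaleNr. Qed.
Lemma scC c u x : u *: (c *' x) = c *' (u *: x).
Proof. by rewrite !scalerA mulr_algl mulr_algr. Qed.
Lemma sc_Z c u x : (c *: u) *: x = c *' (u *: x).
Proof. by rewrite scalerA mulr_algl. Qed.
Lemma sc_sumr c (I : Type) (s : seq I) (F : I -> V) :
  c *' (\sum_(i <- s) F i) = \sum_(i <- s) c *' F i.
Proof. by rewrite scaler_sumr. Qed.
Lemma sc_suml (I : Type) (s : seq I) (F : I -> R[i]) x :
  (\sum_(i <- s) F i) *' x = \sum_(i <- s) F i *' x.
Proof. by rewrite !scaler_suml. Qed.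
Lemma sc_inj c x : c != 0 -> c *' x = 0 -> x = 0.
Proof. by move=> c0 h; rewrite -[x]sc1 -(mulVf c0) -scA h scx0. Qed.
End ScalarAction.

Section Coordinates.
Variables (R : realType) (n m : nat) (V : lmodType (Uq R n m)).
Variables (I : choiceType) (b : I -> V).
Hypothesis b_basis : ground_basis b.
Local Notation C := R[i].

Definition co (x : V) : {fsfun I -> C with 0} := sval (cid (b_basis x)).

Lemma coE x : x = \sum_(z <- finsupp (co x)) co x z *' b z.
Proof. by rewrite {1}(svalP (cid (b_basis x))).1. Qed.

Lemma sum_finsupp (a : {fsfun I -> C with 0}) (s : seq I) : uniq s ->
  {subset finsupp a <= s} ->
  \sum_(z <- s) a z *' b z = \sum_(z <- finsupp a) a z *' b z.
Proof.
move=> us sub; rewrite (bigID (mem (finsupp a))) /= [X in _ + X]big1 ?addr0; last first.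
  by move=> z; rewrite memNfinsupp => /eqP ->; rewrite sc0.
rewrite -big_filter; apply: perm_big; apply: uniq_perm; rewrite ?filter_uniq ?fset_uniq //.
move=> z; rewrite mem_filter; case: (boolP (z \in finsupp a)) => //= h; exact: sub.
Qed.

Lemma co_sum (s : seq I) (a : I -> C) : uniq s ->
  forall z, co (\sum_(y <- s) a y *' b y) z = if z \in s then a z else 0.
Proof.
move=> us; set x := \sum_(y <- s) _.
pose f : {fsfun I -> C with 0} := [fsfun z in seq_fset tt s => a z].
have fE z : f z = if z \in s then a z else 0.
  by rewrite fsfunE seq_fsetE.
suff -> : co x = f by [].
apply: (svalP (cid (b_basis x))).2.
rewrite -(sum_finsupp us); last first.
  by move=> z; rewrite mem_finsupp fE; case: ifP => //; rewrite eqxx.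
by rewrite /x big_seq [RHS]big_seq; apply: eq_bigr => z zs; rewrite fE zs.
Qed.

Lemma coE_sub x (s : seq I) : uniq s -> {subset finsupp (co x) <= s} ->
  x = \sum_(z <- s) co x z *' b z.
Proof. by move=> us sub; rewrite sum_finsupp // -coE. Qed.

Lemma coD x y z : co (x + y) z = co x z + co y z.
Proof.
pose s := undup (finsupp (co x) ++ finsupp (co y)).
have us : uniq s by rewrite undup_uniq.
have hx : {subset finsupp (co x) <= s} by move=> i; rewrite mem_undup mem_cat => ->.
have hy : {subset finsupp (co y) <= s} by move=> i; rewrite mem_undup mem_cat orbC => ->.
rewrite {1}(coE_sub us hx) {1}(coE_sub us hy) -big_split /=.
under eq_bigr do rewrite -scDl.
rewrite (co_sum (fun i => co x i + co y i)) //; case: ifP => // /negbT zs.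
by rewrite (fsfun_dflt (contra (@hx z) zs)) (fsfun_dflt (contra (@hy z) zs)) addr0.
Qed.

Lemma coZ c x z : co (c *' x) z = c * co x z.
Proof.
rewrite {1}[x]coE sc_sumr; under eq_bigr do rewrite scA.
rewrite (co_sum (fun i => c * co x i)) ?fset_uniq //; case: ifP => // /negbT zs.
by rewrite (fsfun_dflt zs) mulr0.
Qed.

Lemma co0 z : co 0 z = 0.
Proof. by rewrite -(sc0 0) coZ mul0r. Qed.

Lemma cob y z : co (b y) z = (z == y)%:R.
Proof.
have := @co_sum [:: y] (fun=> 1) isT z; rewrite big_seq1 sc1 => ->.
by rewrite inE; case: eqP.
Qed.

Lemma co_eq x y : (forall z, co x z = co y z) -> x = y.
Proof. by move=> h; rewrite [x]coE [y]coE (iffLR (fsfunP _ _) h). Qed.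

Lemma V_ind (P : V -> Prop) : P 0 -> (forall x y, P x -> P y -> P (x + y)) ->
  (forall c z, P (c *' b z)) -> forall x, P x.
Proof.
move=> P0 PD Pb x; rewrite [x]coE; elim: (enum_fset _) => [|z s IH]; rewrite ?big_nil // big_cons.
exact: PD.
Qed.

Definition lmap (W : lmodType (Uq R n m)) (h : I -> W) (x : V) : W :=
  \sum_(z <- finsupp (co x)) co x z *' h z.

Definition lfun (h : I -> C) (x : V) : C :=
  \sum_(z <- finsupp (co x)) co x z * h z.

Lemma lmap_sub (W : lmodType (Uq R n m)) (h : I -> W) x (s : seq I) : uniq s -> {subset finsupp (co x) <= s} ->
  lmap h x = \sum_(z <- s) co x z *' h z.
Proof.
move=> us sub; rewrite [RHS](bigID (mem (finsupp (co x)))) /= [X in _ + X]big1 ?addr0; last first.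
  by move=> z; rewrite memNfinsupp => /eqP ->; rewrite sc0.
rewrite -big_filter; apply: perm_big; apply: uniq_perm; rewrite ?filter_uniq ?fset_uniq //.
move=> z; rewrite mem_filter; case: (boolP (z \in finsupp (co x))) => //= h'; exact/esym/sub.
Qed.

Lemma lfun_sub (h : I -> C) x (s : seq I) : uniq s -> {subset finsupp (co x) <= s} ->
  lfun h x = \sum_(z <- s) co x z * h z.
Proof.
move=> us sub; rewrite [RHS](bigID (mem (finsupp (co x)))) /= [X in _ + X]big1 ?addr0; last first.
  by move=> z; rewrite memNfinsupp => /eqP ->; rewrite mul0r.
rewrite -big_filter; apply: perm_big; apply: uniq_perm; rewrite ?filter_uniq ?fset_uniq //.
move=> z; rewrite mem_filter; case: (boolP (z \in finsupp (co x))) => //= h'; exact/esym/sub.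
Qed.

Lemma lmapD (W : lmodType (Uq R n m)) (h : I -> W) x y : lmap h (x + y) = lmap h x + lmap h y.
Proof.
pose s := undup (finsupp (co x) ++ finsupp (co y) ++ finsupp (co (x + y))).
have us : uniq s by rewrite undup_uniq.
rewrite !(@lmap_sub _ _ _ s) //; try by move=> i; rewrite mem_undup !mem_cat => ->; rewrite ?orbT.
by rewrite -big_split /=; apply: eq_bigr => i _; rewrite coD scDl.
Qed.

Lemma lfunD (h : I -> C) x y : lfun h (x + y) = lfun h x + lfun h y.
Proof.
pose s := undup (finsupp (co x) ++ finsupp (co y) ++ finsupp (co (x + y))).
have us : uniq s by rewrite undup_uniq.
rewrite !(@lfun_sub _ _ s) //; try by move=> i; rewrite mem_undup !mem_cat => ->; rewrite ?orbT.
by rewrite -big_split /=; apply: eq_bigr => i _; rewrite coD mulrDl.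
Qed.

Lemma lmapZ (W : lmodType (Uq R n m)) (h : I -> W) c x : lmap h (c *' x) = c *' lmap h x.
Proof.
pose s := undup (finsupp (co x) ++ finsupp (co (c *' x))).
have us : uniq s by rewrite undup_uniq.
rewrite !(@lmap_sub _ _ _ s) //; try by move=> i; rewrite mem_undup !mem_cat => ->; rewrite ?orbT.
by rewrite sc_sumr; apply: eq_bigr => i _; rewrite coZ scA.
Qed.

Lemma lfunZ (h : I -> C) c x : lfun h (c *' x) = c * lfun h x.
Proof.
pose s := undup (finsupp (co x) ++ finsupp (co (c *' x))).
have us : uniq s by rewrite undup_uniq.
rewrite !(@lfun_sub _ _ s) //; try by move=> i; rewrite mem_undup !mem_cat => ->; rewrite ?orbT.
by rewrite mulr_sumr; apply: eq_bigr => i _; rewrite coZ mulrA.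
Qed.

Lemma lmapb (W : lmodType (Uq R n m)) (h : I -> W) z : lmap h (b z) = h z.
Proof.
have us : uniq [:: z] by [].
rewrite (@lmap_sub _ h (b z) _ us); first by rewrite big_seq1 cob eqxx sc1.
by move=> i; rewrite mem_finsupp cob inE; case: (i == z); rewrite // eqxx.
Qed.

Lemma lfunb (h : I -> C) z : lfun h (b z) = h z.
Proof.
have us : uniq [:: z] by [].
rewrite (@lfun_sub h (b z) _ us); first by rewrite big_seq1 cob eqxx mul1r.
by move=> i; rewrite mem_finsupp cob inE; case: (i == z); rewrite // eqxx.
Qed.

End Coordinates.

(** * Permutations and shuffles *)

Lemma perm_length_sum r (s : 'S_r) :
  perm_length s = (\sum_(a < r) \sum_(b < r) ((a < b)%N && (s b < s a)%N))%N.
Proof.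
rewrite /perm_length pair_bigA -sum1_card big_mkcond /=; apply: eq_bigr => p _.
by rewrite inE; case: ifP.
Qed.

Lemma ltn_lift r (p : 'I_r.+1) (a b : 'I_r) : (lift p a < lift p b)%N = (a < b)%N.
Proof. by rewrite /= /bump; case: (leqP p a); case: (leqP p b); lia. Qed.

Lemma count_lt_ord r (p : 'I_r.+1) : (\sum_(a < r) (a < p)%N = p)%N.
Proof.
have hp : (p <= r)%N by rewrite -ltnS.
rewrite (bigID (fun a : 'I_r => (a < p)%N)) /= [X in (_ + X)%N]big1 => [|a /negbTE -> //].
rewrite addn0 (eq_bigr (fun=> 1%N)) => [|a -> //].
by rewrite (big_ord_narrow hp) sum1_card card_ord.
Qed.

Lemma perm_length_lift r (i j : 'I_r.+1) (s : 'S_r) : (i == ord0) || (j == ord0) ->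
  perm_length (lift_perm i j s) = (i + j + perm_length s)%N.
Proof.
move=> ij; rewrite !perm_length_sum (bigD1_ord i) //= (bigD1_ord i) //= ltnn add0n.
have -> : (\sum_(a < r) \sum_(b < r.+1) ((lift i a < b) && (lift_perm i j s b < lift_perm i j s (lift i a))) =
  \sum_(a < r) ((lift i a < i) && (j < lift j (s a))) + \sum_(a < r) \sum_(b < r) ((a < b) && (s b < s a)))%N.
  rewrite -big_split; apply: eq_bigr => a _ /=; rewrite (bigD1_ord i) //= lift_perm_id lift_perm_lift.
  congr (_ + _)%N; apply: eq_bigr => b _; rewrite lift_perm_lift.
  by have := ltn_lift i a b; have := ltn_lift j (s b) (s a); rewrite /= => -> ->.
rewrite addnA; congr (_ + _)%N; under eq_bigr do rewrite lift_perm_id lift_perm_lift.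
have bl (p : 'I_r.+1) (a : 'I_r) : (lift p a < p)%N = (a < p)%N.
  by rewrite /= /bump; case: leqP; lia.
case/orP: ij => /eqP ->; rewrite ?add0n ?addn0.
  rewrite [X in (_ + X)%N]big1 ?addn0 => [|a _ //].
  transitivity (\sum_(b < r) (b < j)%N)%N; last exact: count_lt_ord.
  rewrite [RHS](reindex_inj (@perm_inj _ s)) /=; apply: eq_bigr => b _.
  by have := bl j (s b); rewrite /= => ->.
rewrite big1 => [|a _]; last by rewrite andbC.
rewrite add0n -[RHS]count_lt_ord; apply: eq_bigr => b _; rewrite -bl /=.
by rewrite andbC.
Qed.

Lemma sum_lift_perm (M : nmodType) r (i : 'I_r.+1) (F : 'S_r.+1 -> M) :
  \sum_s F s = \sum_(j < r.+1) \sum_(s : 'S_r) F (lift_perm i j s).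
Proof.
pose f (p : 'I_r.+1 * 'S_r) := lift_perm i p.1 p.2.
have finj : injective f.
  move=> [j s] [j' s'] /permP h; have := h i; rewrite !lift_perm_id /= => jj; subst j'.
  congr (_, _); apply/permP => k; have := h (lift i k); rewrite !lift_perm_lift /=.
  exact: lift_inj.
have fbij : bijective f.
  by apply: inj_card_bij finj _; rewrite card_prod !card_Sn card_ord factS.
rewrite (reindex f) /=; last by apply: onW_bij.
by rewrite pair_bigA.
Qed.

Lemma sum_lift_perm0 (M : nmodType) r (F : 'S_r.+1 -> M) :
  \sum_s F s = \sum_(p < r.+1) \sum_(s : 'S_r) F (lift_perm p ord0 s).
Proof.
rewrite (reindex_inj invg_inj) /= (sum_lift_perm ord0); apply: eq_bigr => p _.
rewrite [RHS](reindex_inj invg_inj) /=; apply: eq_bigr => s _.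
by rewrite lift_permV.
Qed.

Section Shuffles.
Variables (r s : nat).
Implicit Types (u : 'S_r) (J : {set 'I_r}).

Definition tail_set u : {set 'I_r} := [set u i | i : 'I_r & (s <= i)%N].

Lemma mem_tail_set u i : (u i \in tail_set u) = (s <= i)%N.
Proof.
apply/imsetP/idP => [[j + /perm_inj ->]|si]; first by rewrite inE.
by exists i; rewrite ?inE.
Qed.

Let ltI : rel 'I_r := fun i j => (i < j)%N.
Let ltI_trans : transitive ltI. Proof. by move=> x y z; apply: ltn_trans. Qed.
Let ltI_irr : irreflexive ltI. Proof. by move=> x; apply: ltnn. Qed.
Let sorted_enum (P : pred 'I_r) : sorted ltI (enum P).
Proof.
rewrite /enum_mem (sorted_filter ltI_trans) // -enumT.
by have := iota_ltn_sorted 0 r; rewrite -val_enum_ord sorted_map.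
Qed.

Lemma shuffle_inj u u' : is_shuffle s u -> is_shuffle s u' -> tail_set u = tail_set u' -> u = u'.
Proof.
move=> su su' uu.
have mono w (P : pred 'I_r) : is_shuffle s w -> (forall i j, P i -> P j -> (j < s)%N || (s <= i)%N) ->
    sorted ltI [seq w i | i <- enum P].
  move=> sw hP; rewrite sorted_map; apply: (@sub_in_sorted _ P _ _ _ _ _ (sorted_enum P)).
    move=> i j Pi Pj ij; have /forallP/(_ i)/forallP/(_ j) := sw.
    by rewrite -/(ltI i j) ij hP.
  by apply/allP => i; rewrite mem_enum.
have memE (w : 'S_r) (P : pred 'I_r) i : (w i \in [seq w j | j <- enum P]) = P i.
  by rewrite mem_map ?mem_enum //; apply: perm_inj.
have eqP (P : pred 'I_r) : (forall i j, P i -> P j -> (j < s)%N || (s <= i)%N) ->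
   (forall x, x \in [seq u i | i <- enum P] = (x \in [seq u' i | i <- enum P])) -> forall i, P i -> u i = u' i.
  move=> hP hx i Pi; have E := irr_sorted_eq ltI_trans ltI_irr (mono u P su hP) (mono u' P su' hP) hx.
  by have /eq_in_map := E; apply; rewrite mem_enum.
have tE (w : 'S_r) x : x \in [seq w i | i <- enum [pred i : 'I_r | (s <= i)%N]] = (x \in tail_set w).
  by rewrite -{1}(permKV w x) memE /= -(mem_tail_set w) permKV.
have hE (w : 'S_r) x : x \in [seq w i | i <- enum [pred i : 'I_r | (i < s)%N]] = (x \notin tail_set w).
  by rewrite -{1}(permKV w x) memE /= ltnNge -(mem_tail_set w) permKV.
apply/permP => i; case: (leqP s i) => si.
  apply: (eqP [pred i : 'I_r | (s <= i)%N]) => //= [a b -> _|x]; first by rewrite orbT.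
  by rewrite !tE uu.
apply: (eqP [pred i : 'I_r | (i < s)%N]) => //= [a b _ ->|x] //.
by rewrite !hE uu.
Qed.

Lemma shuffle_ex J : (s <= r)%N -> #|J| = (r - s)%N -> exists2 u, is_shuffle s u & tail_set u = J.
Proof.
move=> sr cJ; pose c := enum (~: J) ++ enum J.
have s1 : size (enum (~: J)) = s by rewrite -cardE cardsCs setCK card_ord cJ subKn.
have sc : size c = r by rewrite size_cat s1 -cardE cJ subnKC.
have uc : uniq c.
  rewrite cat_uniq !enum_uniq andbT /=; apply/hasPn => x; rewrite !mem_enum inE.
  by move=> ->.
pose f (i : 'I_r) := nth i c i.
have fE (i x : 'I_r) : f i = nth x c i by apply: set_nth_default; rewrite sc.
have finj : injective f.
  move=> i j; rewrite (fE i j) => /eqP; rewrite nth_uniq ?sc // => /eqP; exact: val_inj.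
exists (perm finj).
  apply/forallP => i; apply/forallP => j; apply/implyP => /andP[ij h].
  rewrite !permE (fE j i) /f; rewrite !nth_cat !s1.
  case: (ltnP j s) h => [js _|sj /= si].
    rewrite (ltn_trans ij js); apply: (sorted_ltn_nth ltI_trans _ (sorted_enum _)) => //; rewrite inE s1 //.
    exact: ltn_trans js.
  rewrite [(i < s)%N]ltnNge si /=; apply: (sorted_ltn_nth ltI_trans _ (sorted_enum _)); have := ltn_ord i; have := ltn_ord j; rewrite ?inE -?cardE ?cJ; move: (nat_of_ord i) (nat_of_ord j) ij si sj => a b; lia.
apply/setP => x; rewrite -{1}(permKV (perm finj) x) mem_tail_set.
set i := ((perm finj)^-1%g x); have -> : x = f i by rewrite -[f i](permE finj) permKV.
rewrite /f nth_cat s1; case: ltnP => h.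
  by have := mem_nth i (_ : (i < size (enum (~: J)))%N); rewrite s1 mem_enum inE => /(_ h) /negbTE ->.
have := mem_nth i (_ : (i - s < size (enum J))%N); rewrite mem_enum -cardE cJ => -> //.
by rewrite ltn_sub2r // (leq_ltn_trans h).
Qed.

Lemma sum_shuffle (M : nmodType) (G : {set 'I_r} -> M) : (s <= r)%N ->
  \sum_(u : 'S_r | is_shuffle s u) G (tail_set u) = \sum_(J : {set 'I_r} | #|J| == (r - s)%N) G J.
Proof.
move=> sr; rewrite (partition_big tail_set (fun J => #|J| == (r - s)%N)) /= => [|u _].
  apply: eq_bigr => J /eqP cJ; have [u su uJ] := shuffle_ex sr cJ.
  rewrite (big_pred1 u) ?uJ // => w; apply/andP/eqP => [[sw /eqP wJ]|->]; last by rewrite uJ.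
  by apply: shuffle_inj; rewrite ?wJ.
rewrite card_imset; last exact: perm_inj.
rewrite -[r in (r - s)%N]card_ord -(cardsC [set i : 'I_r | (i < s)%N]).
have -> : ~: [set i : 'I_r | (i < s)%N] = [set i : 'I_r | (s <= i)%N].
  by apply/setP => i; rewrite !inE -leqNgt.
rewrite (_ : #|[set i : 'I_r | (i < s)%N]| = s) ?addKn //.
by rewrite -sum1dep_card (big_ord_narrow sr) sum1_card card_ord.
Qed.
End Shuffles.

(** * Quantum minors of L^+ + u L^- *)

Section QuantumMinors.
Variables (C : fieldType) (A : algType C) (n : nat) (q : C).
Hypotheses (q0 : q != 0) (q2N : 1 + q ^+ 2 != 0).
Local Notation lam := (q - q^-1).
Implicit Types (i j k r : 'I_n) (J : {set 'I_n}) (g : {set 'I_n} -> A) (x y : 'I_n -> A).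

Definition sg i J : C := (- q^-1) ^+ #|[set k in J | (k < i)%N]|.

(* Left multiplication by sum_i x_i psi_i on functions, J |-> g J standing for
   sum_J g(J) psi_J, where psi_j psi_i = - q^-1 psi_i psi_j for i < j, psi_i^2 = 0. *)
Definition Zop x g : {set 'I_n} -> A := fun J => \sum_(i in J) sg i J *: (x i * g (J :\ i)).

Definition mn x y i j : A := x i * y j - q^-1 *: (x j * y i).

Lemma sgD1 i j J : (i < j)%N -> sg i (J :\ j) = sg i J.
Proof.
move=> ij; rewrite /sg; congr (_ ^+ _); apply: eq_card => k; rewrite !inE.
by case: (eqVneq k j) => [->|] //=; rewrite ltnNge (ltnW ij) andbF.
Qed.

Lemma sgD1r i j J : (i < j)%N -> i \in J -> sg j J = - q^-1 * sg j (J :\ i).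
Proof.
move=> ij iJ; rewrite /sg -exprS; congr (_ ^+ _).
rewrite (cardsD1 i) !inE iJ ij add1n; congr _.+1; apply: eq_card => k; rewrite !inE.
by rewrite andbA.
Qed.

Lemma ZopZop x y g J : Zop x (Zop y g) J =
  \sum_(i in J) \sum_(j in J | (i < j)%N) (sg i J * sg j (J :\ i)) *: (mn x y i j * g (J :\ i :\ j)).
Proof.
pose F i j : A := (sg i J * sg j (J :\ i)) *: (x i * y j * g (J :\ i :\ j)).
transitivity (\sum_(i in J) \sum_(j in J | (i < j)%N) (F i j + F j i)); last first.
  apply: eq_bigr => i iJ; apply: eq_bigr => j /andP[jJ ij].
  rewrite /F (sgD1r ij iJ) (sgD1 _ ij) /mn mulrBl scalerBr; congr (_ + _).
  rewrite setDDl setUC -setDDl -scalerAl -scalerN -scaleNr scalerA; congr (_ *: _).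
  by rewrite mulrC; ring.
transitivity (\sum_(i in J) \sum_(j in J | j != i) F i j).
  apply: eq_bigr => i iJ; rewrite /Zop mulr_sumr scaler_sumr.
  apply: eq_big => [j|j _]; first by rewrite !inE andbC.
  by rewrite /F -scalerAr scalerA mulrA.
transitivity (\sum_(i in J) (\sum_(j in J | (i < j)%N) F i j + \sum_(j in J | (j < i)%N) F i j)).
  apply: eq_bigr => i iJ; rewrite (bigID (fun j => (i < j)%N)) /=; congr (_ + _).
    apply: eq_bigl => j; rewrite -andbA; congr (_ && _).
    by case: ltngtP => [ij|ij|ij]; rewrite ?andbF // andbT neq_ltn ij orbT.
  apply: eq_bigl => j; rewrite -andbA; congr (_ && _).
  by rewrite -leqNgt ltn_neqAle.
rewrite !big_split /=; under [RHS]eq_bigr do rewrite big_split /=.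
rewrite big_split; congr (_ + _).
rewrite (exchange_big_dep (mem J)) //=; last by move=> i j _ /andP[].
apply: eq_bigr => i iJ; apply: eq_bigl => j; rewrite iJ //.
Qed.

Lemma Zop_rel2 x y x1 y1 x2 y2 (a b : C) g J :
  (forall i j, (i < j)%N -> mn x y i j = a *: mn x1 y1 i j + b *: mn x2 y2 i j) ->
  Zop x (Zop y g) J = a *: Zop x1 (Zop y1 g) J + b *: Zop x2 (Zop y2 g) J.
Proof.
move=> h; rewrite !ZopZop !scaler_sumr -big_split; apply: eq_bigr => i iJ /=.
rewrite !scaler_sumr -big_split; apply: eq_bigr => j /andP[jJ ij] /=.
rewrite h // mulrDl scalerDr !scalerA [a * _]mulrC [b * _]mulrC -!scalerAl.
by rewrite !scalerA.
Qed.

Lemma Zop_rel1 x y x1 y1 (a : C) g J :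
  (forall i j, (i < j)%N -> mn x y i j = a *: mn x1 y1 i j) ->
  Zop x (Zop y g) J = a *: Zop x1 (Zop y1 g) J.
Proof.
move=> h; rewrite (@Zop_rel2 x y x1 y1 x1 y1 a 0) ?scale0r ?addr0 // => i j ij.
by rewrite scale0r addr0 h.
Qed.

Lemma ZopD x x' g J : Zop (fun i => x i + x' i) g J = Zop x g J + Zop x' g J.
Proof.
by rewrite /Zop -big_split; apply: eq_bigr => i _; rewrite mulrDl scalerDr.
Qed.

Lemma ZopZ a x g J : Zop (fun i => a *: x i) g J = a *: Zop x g J.
Proof.
by rewrite /Zop scaler_sumr; apply: eq_bigr => i _; rewrite -scalerAl !scalerA mulrC.
Qed.

Lemma Zop_ext x g g' J : (forall K : {set 'I_n}, K \subset J -> g K = g' K) -> Zop x g J = Zop x g' J.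
Proof. by move=> h; apply: eq_bigr => i _; rewrite h // subsetDl. Qed.

Lemma Zop_gD x g g' J : Zop x (fun K => g K + g' K) J = Zop x g J + Zop x g' J.
Proof. by rewrite /Zop -big_split; apply: eq_bigr => i _; rewrite mulrDr scalerDr. Qed.

Lemma Zop_gZ a x g J : Zop x (fun K => a *: g K) J = a *: Zop x g J.
Proof.
by rewrite /Zop scaler_sumr; apply: eq_bigr => i _; rewrite -scalerAr !scalerA mulrC.
Qed.

Lemma Zop_gr x g (c : A) J : Zop x (fun K => g K * c) J = Zop x g J * c.
Proof. by rewrite /Zop mulr_suml; apply: eq_bigr => i _; rewrite mulrA scalerAl. Qed.

Lemma Zop_g0 x J : Zop x (fun=> 0) J = 0.
Proof. by rewrite /Zop big1 // => i _; rewrite mulr0 scaler0. Qed.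

Definition RLLe (l l' : 'I_n -> 'I_n -> A) : Prop := forall i j k r,
  q ^+ (i == j) *: (l i k * l' j r) + ((i < j)%N%:R * lam) *: (l j k * l' i r) =
  q ^+ (k == r) *: (l' j r * l i k) + ((r < k)%N%:R * lam) *: (l' j k * l i r).

Lemma mn_swap l l' i j k r : RLLe l l' -> (k < r)%N ->
  mn (l' j) (l i) k r =
  - q *: (q ^+ (i == j) *: mn (l i) (l' j) k r + ((i < j)%N%:R * lam) *: mn (l j) (l' i) k r).
Proof.
move=> h kr; have E1 := h i j k r; have E2 := h i j r k.
have krn : (k == r) = false by rewrite -val_eqE /= ltn_eqF.
have rk : (r < k)%N = false by rewrite ltnNge (ltnW kr).
move: E1 E2; rewrite [r == k]eq_sym krn expr0 kr rk /= mul0r scale0r addr0 mul1r !scale1r.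
rewrite /mn; set P1 := _ + _; set P2 := _ + _ => E1 E2.
rewrite (_ : _ + _ = P1 - q^-1 *: P2); last first.
  rewrite !scalerBr addrACA -opprD; congr (_ - _).
  by rewrite /P2 scalerDr !scalerA ![q^-1 * _]mulrC.
have Y2 : l' j k * l i r = P2 - lam *: P1 by rewrite E2 E1 addrK.
rewrite -E1 Y2 scalerBr scalerA mulNr mulfV // scaleN1r opprK -addrA -opprD -scalerDl subrK.
by rewrite scaleNr addrC.
Qed.

Lemma mnD x x' y i j : mn (fun i => x i + x' i) y i j = mn x y i j + mn x' y i j.
Proof. by rewrite /mn !mulrDl scalerDr opprD addrACA. Qed.
Lemma mnDr x y y' i j : mn x (fun i => y i + y' i) i j = mn x y i j + mn x y' i j.
Proof. by rewrite /mn !mulrDr scalerDr opprD addrACA. Qed.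
Lemma mnZ a x y i j : mn (fun i => a *: x i) y i j = a *: mn x y i j.
Proof. by rewrite /mn -!scalerAl scalerBr !scalerA mulrC. Qed.
Lemma mnZr a x y i j : mn x (fun i => a *: y i) i j = a *: mn x y i j.
Proof. by rewrite /mn -!scalerAr scalerBr !scalerA mulrC. Qed.

Section TwoL.
Variables (lp lm : 'I_n -> 'I_n -> A).
Hypotheses (Rpp : RLLe lp lp) (Rmm : RLLe lm lm) (Rpm : RLLe lp lm).

Lemma mn_same l i j k r : RLLe l l -> (i < j)%N -> (k < r)%N ->
  mn (l j) (l i) k r = - q^-1 *: mn (l i) (l j) k r.
Proof.
move=> h ij kr; have := mn_swap i j h kr.
rewrite -val_eqE /= ltn_eqF // ij expr0 scale1r mul1r => E.
have E2 : (1 + q * lam) *: mn (l j) (l i) k r = - q *: mn (l i) (l j) k r.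
  rewrite scalerDl scale1r {1}E scalerDr scalerA -addrA -scalerDl mulNr addNr scale0r addr0.
  by [].
have q2E : 1 + q * lam = q ^+ 2 by rewrite mulrBr mulfV // addrC subrK expr2.
rewrite -[LHS]scale1r -(@mulVf _ (q ^+ 2)) ?expf_neq0 // -scalerA -q2E E2 scalerA q2E.
by congr (_ *: _); field.
Qed.

Lemma mn_self l i k r : RLLe l l -> (k < r)%N -> mn (l i) (l i) k r = 0.
Proof.
move=> h kr; have := mn_swap i i h kr.
rewrite eqxx ltnn mul0r scale0r addr0 scalerA expr1 => E.
have : (1 + q ^+ 2) *: mn (l i) (l i) k r = 0.
  by rewrite scalerDl scale1r {1}E -scalerDl expr2 mulNr addNr scale0r.
by move/eqP; rewrite scaler_eq0 (negbTE q2N) /= => /eqP.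
Qed.

Definition Lsp (u : C) i j : A := lp i j + u *: lm i j.

Lemma mn_tt u w i j k r : mn (Lsp u i) (Lsp w j) k r =
  mn (lp i) (lp j) k r + w *: mn (lp i) (lm j) k r + u *: mn (lm i) (lp j) k r +
  (u * w) *: mn (lm i) (lm j) k r.
Proof.
rewrite /Lsp mnD !mnDr !mnZ !mnZr scalerDr !scalerA addrA; congr (_ + _).
Qed.

Lemma mn_pm i j k r : (k < r)%N -> mn (lm j) (lp i) k r =
  - q *: (q ^+ (i == j) *: mn (lp i) (lm j) k r + ((i < j)%N%:R * lam) *: mn (lp j) (lm i) k r).
Proof. exact: mn_swap. Qed.

Lemma mn_tt_lt u i j k r : (i < j)%N -> (k < r)%N ->
  mn (Lsp u j) (Lsp (q ^+ 2 * u) i) k r = - q^-1 *: mn (Lsp u i) (Lsp (q ^+ 2 * u) j) k r.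
Proof.
move=> ij kr; rewrite !mn_tt !(mn_same _ ij kr) // mn_pm // [mn (lm i) (lp j) k r]mn_pm //.
have ne : (i == j) = false by rewrite -val_eqE /= ltn_eqF.
have ji : (j < i)%N = false by rewrite ltnNge (ltnW ij).
rewrite [j == i]eq_sym ne ij ji mul0r mul1r scale0r addr0 !expr0 !scale1r.
move: (mn (lp i) (lp j) k r) (mn (lp i) (lm j) k r) (mn (lp j) (lm i) k r) (mn (lm i) (lm j) k r).
move=> P Q1 Q2 M; rewrite !scalerDr !scalerA -!addrA; congr (_ + _).
rewrite [LHS]addrCA; congr (_ + _); first by congr (_ *: _); field.
by rewrite addrA -scalerDl; congr (_ + _); congr (_ *: _); field.
Qed.

Lemma mn_tt_self u i k r : (k < r)%N -> mn (Lsp u i) (Lsp (q ^+ 2 * u) i) k r = 0.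
Proof.
move=> kr; rewrite mn_tt !mn_self // mn_pm // eqxx ltnn mul0r scale0r addr0 add0r !scalerA scaler0 addr0.
by rewrite -scalerDl expr1 (_ : _ + _ = 0) ?scale0r //; ring.
Qed.

Lemma Zop_lt u i j g J : (i < j)%N ->
  Zop (Lsp u j) (Zop (Lsp (q ^+ 2 * u) i) g) J = - q^-1 *: Zop (Lsp u i) (Zop (Lsp (q ^+ 2 * u) j) g) J.
Proof. by move=> ij; apply: Zop_rel1 => k r kr; apply: mn_tt_lt. Qed.

Lemma Zop_self u i g J : Zop (Lsp u i) (Zop (Lsp (q ^+ 2 * u) i) g) J = 0.
Proof.
rewrite (@Zop_rel1 _ _ (Lsp u i) (Lsp u i) 0) ?scale0r // => k r kr.
by rewrite scale0r mn_tt_self.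
Qed.

Definition vac J : A := (J == set0)%:R.

(* The product of the rows in [s] of L^+ + w L^-, for w = u, q^2 u, q^4 u, ...;
   its value at J is the quantum minor with rows s and columns J. *)
Fixpoint Zch (s : seq 'I_n) (u : C) : {set 'I_n} -> A :=
  if s is i :: s' then Zop (Lsp u i) (Zch s' (q ^+ 2 * u)) else vac.

Lemma Zch_in i s u J : sorted ltn [seq val k | k <- s] -> i \in s -> Zch (i :: s) u J = 0.
Proof.
elim: s u J => [|a s IH] u J //= hs; rewrite inE => /orP[/eqP <-|is_]; first exact: Zop_self.
have ai : (a < i)%N.
  by have /allP := order_path_min ltn_trans hs; apply; apply: map_f.
rewrite Zop_lt // (Zop_ext _ (g' := fun=> 0)) ?Zop_g0 ?scaler0 // => K _.
exact: (IH _ K (path_sorted hs) is_).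
Qed.

Lemma Zch_move i s1 s2 u J : (forall k, k \in s1 -> (k < i)%N) ->
  Zch (i :: s1 ++ s2) u J = (- q^-1) ^+ size s1 *: Zch (s1 ++ i :: s2) u J.
Proof.
elim: s1 u J => [|a s1 IH] u J h; first by rewrite scale1r.
rewrite [LHS]/= Zop_lt ?h ?mem_head // [size _]/= [(- q^-1) ^+ _.+1]exprS -scalerA; congr (_ *: _).
rewrite /= -Zop_gZ; apply: Zop_ext => K _; rewrite -IH // => k hk.
by apply: h; rewrite inE hk orbT.
Qed.

End TwoL.

Section Step.
Variables (X : C -> 'I_n -> 'I_n -> A) (p mu : C) (a b : 'I_n) (ee ka kb : A).
Hypothesis ab : a != b.
Hypothesis adj : forall k : 'I_n, k != a -> k != b -> (k < a)%N = (k < b)%N.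
Hypothesis adj_p : forall J, a \in J -> b \in J -> p * sg b J + sg a J = 0.
Hypothesis H1 : forall u i k, p ^+ (i == b) *: (X u i k * ee) + ((i == a)%:R * mu) *: (X u b k * ka) =
  p ^+ (k == a) *: (ee * X u i k) + ((k == b)%:R * mu) *: (kb * X u i a).
Hypothesis Ha : forall u i k, p ^+ (i == a) *: (X u i k * ka) = p ^+ (k == a) *: (ka * X u i k).
Hypothesis Hb : forall u i k, p ^+ (i == b) *: (X u i k * kb) = p ^+ (k == b) *: (kb * X u i k).

(* ee and ka extended to functions by their coproduct. *)
Definition Op g J : A := p ^+ (a \in J) *: (ee * g J) +
  (((a \notin J) && (b \in J))%:R * mu) *: (kb * g (a |: J :\ b)).
Definition Kop g J : A := p ^+ (a \in J) *: (ka * g J).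

Lemma Kop_Zop u i g J : Kop (Zop (X u i) g) J = p ^+ (i == a) *: Zop (X u i) (Kop g) J.
Proof.
rewrite /Kop /Zop mulr_sumr !scaler_sumr; apply: eq_bigr => k kJ.
have -> : sg k J *: (X u i k * (p ^+ (a \in J :\ k) *: (ka * g (J :\ k)))) =
    (sg k J * p ^+ (a \in J :\ k)) *: (X u i k * ka * g (J :\ k)).
  by rewrite -scalerAr scalerA mulrA.
have -> : ka * (sg k J *: (X u i k * g (J :\ k))) = sg k J *: (ka * X u i k * g (J :\ k)).
  by rewrite -scalerAr mulrA.
have -> : p ^+ (a \in J) = p ^+ (a \in J :\ k) * p ^+ (k == a).
  rewrite !inE eq_sym; case: (eqVneq k a) => [<-|_] /=; first by rewrite kJ mul1r.
  by rewrite mulr1.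
rewrite !scalerA [p ^+ (i == a) * _]mulrC -[RHS]scalerA [in RHS]scalerAl Ha -scalerAl scalerA.
by congr (_ *: _); ring.
Qed.

Lemma sg_move k J : a \notin J -> b \in J -> k != a -> k != b -> sg k (a |: J :\ b) = sg k J.
Proof.
move=> aJ bJ ka' kb'; rewrite /sg; congr (_ ^+ _).
have E (K : {set 'I_n}) (c : 'I_n) : c \in K -> #|[set l in K | (l < k)%N]| = ((c < k) + #|[set l in K :\ c | (l < k)%N]|)%N.
  move=> cK; rewrite (cardsD1 c) !inE cK /=; congr (_ + _)%N; apply: eq_card => l; rewrite !inE.
  by rewrite andbA.
rewrite (E _ a) ?setU11 // (E J b) //.
have -> : (a < k)%N = (b < k)%N.
  rewrite (ltnNge a) (ltnNge b) (leq_eqVlt k a) (leq_eqVlt k b) adj //.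
  by rewrite !(inj_eq val_inj) (negbTE ka') (negbTE kb').
congr (_ + _)%N; apply: eq_card => l; rewrite !inE.
by case: (eqVneq l a) => [->|] //=; rewrite (negbTE aJ) !andbF.
Qed.

Lemma sg_ab J : a \notin J -> b \in J -> sg a (a |: J :\ b) = sg b J.
Proof.
move=> aJ bJ; rewrite /sg; congr (_ ^+ _); apply: eq_card => k; rewrite !inE.
case: (eqVneq k a) => [->|ka']; first by rewrite ltnn (negbTE aJ) andbF.
case: (eqVneq k b) => [->|kb']; first by rewrite ltnn andbF.
by rewrite adj.
Qed.

Lemma Op_Zop u i g J : Op (Zop (X u i) g) J =
  p ^+ (i == b) *: Zop (X u i) (Op g) J + ((i == a)%:R * mu) *: Zop (X u b) (Kop g) J.
Proof.
rewrite {1}/Op /Zop mulr_sumr !scaler_sumr.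
pose U k := (sg k J * p ^+ (a \in J :\ k) * p ^+ (k == a)) *: (ee * X u i k * g (J :\ k)).
pose Y k := (sg k J * p ^+ (a \in J :\ k) * ((k == b)%:R * mu)) *: (kb * X u i a * g (J :\ k)).
pose Z k := (sg k J * ((a \notin J :\ k) && (b \in J :\ k))%:R * mu * p ^+ (k == b)) *: (kb * X u i k * g (a |: (J :\ k) :\ b)).
have -> : \sum_(k in J) p ^+ (a \in J) *: (ee * (sg k J *: (X u i k * g (J :\ k)))) = \sum_(k in J) U k.
  apply: eq_bigr => k kJ; rewrite /U -scalerAr scalerA mulrA; congr (_ *: _).
  rewrite mulrC -mulrA; congr (_ * _).
  rewrite !inE eq_sym; case: (eqVneq k a) => [<-|_] /=; first by rewrite kJ mul1r.
  by rewrite mulr1.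
have -> : \sum_(k in J) p ^+ (i == b) *: (sg k J *: (X u i k * Op g (J :\ k))) +
    \sum_(k in J) ((i == a)%:R * mu) *: (sg k J *: (X u b k * Kop g (J :\ k))) =
    \sum_(k in J) (U k + Y k + Z k).
  rewrite -big_split; apply: eq_bigr => k kJ /=.
  have h3 (c d : C) (x y z : A) : c *: (d *: (x * (y * z))) = d *: ((c *: (x * y)) * z).
    by rewrite -scalerAl !scalerA mulrA mulrC.
  rewrite /Op /Kop mulrDr !scalerDr -!scalerAr ![sg k J *: (_ *: _)]scalerA !h3.
  rewrite addrAC -scalerDr -mulrDl H1 Hb mulrDl scalerDr /U /Y /Z -!scalerAl !scalerA.
  by congr (_ *: _ + _ *: _ + _ *: _); ring.
rewrite !big_split /= -addrA; congr (_ + _).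
have setE k : k \in J -> k != a -> k != b -> (a |: (J :\ k) :\ b) = (a |: J :\ b) :\ k.
  move=> kJ ka' kb'; apply/setP => l; rewrite !inE.
  case: (eqVneq l a) => [->|la] /=; first by rewrite eq_sym ka'.
  by rewrite andbCA.
case: (boolP (b \in J)) => bJ; last first.
  rewrite andbF mul0r scale0r !big1 ?addr0 // => k kJ.
    by rewrite /Z !inE (negbTE bJ) !andbF mulr0 !mul0r scale0r.
  rewrite /Y; case: (eqVneq k b) => [kb'|_]; last by rewrite mul0r mulr0 scale0r.
  by move: bJ; rewrite -kb' kJ.
have YE : \sum_(k in J) Y k = (sg b J * p ^+ (a \in J) * mu) *: (kb * X u i a * g (J :\ b)).
  rewrite (bigD1 b) //= big1 ?addr0; last first.
    by move=> k /andP[_ /negbTE kb']; rewrite /Y kb' mul0r mulr0 scale0r.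
  by rewrite /Y eqxx mul1r !inE ab.
rewrite YE; case: (boolP (a \in J)) => aJ /=.
  rewrite mul0r scale0r (bigD1 a) //= big1 ?addr0; last first.
    by move=> k /andP[_ ka']; rewrite /Z !inE [a == k]eq_sym ka' aJ /= mulr0 !mul0r scale0r.
  rewrite /Z !inE eqxx /= [b == a]eq_sym ab bJ (negbTE ab) expr0 !mulr1.
  rewrite (_ : a |: (J :\ a) :\ b = J :\ b); last first.
    apply/setP => l; rewrite !inE; case: (eqVneq l a) => [->|] //=.
    by rewrite ab aJ.
  by rewrite -scalerDl expr1 -mulrDl [sg b J * p]mulrC adj_p // mul0r scale0r.
rewrite mul1r expr0 mulr1 /Zop mulr_sumr scaler_sumr (bigD1 a) ?setU11 //=.
congr (_ + _).
  rewrite sg_ab // -scalerAr scalerA mulrA; congr (_ *: (_ * g _)); first by rewrite mulrC.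
  by apply/setP => l; rewrite !inE; case: (eqVneq l a) => [->|] //=; rewrite (negbTE aJ) andbF.
rewrite [RHS](bigD1 b) //= /Z !inE eqxx andbF mulr0 !mul0r scale0r add0r.
apply: eq_big => [k|k].
  rewrite !inE; case: (eqVneq k a) => [->|_] /=; first by rewrite (negbTE aJ).
  by rewrite andbT andbC.
rewrite !inE => /andP[kJ' ka']; move: kJ'; rewrite (negbTE ka') /= => /andP[kb' kJ].
rewrite sg_move // -setE // (negbTE aJ) bJ [b == k]eq_sym kb' andbF (negbTE kb') /= expr0 !mulr1.
by rewrite -scalerAr scalerA mulrA mulrC.
Qed.
End Step.
End QuantumMinors.

Section Chains.
Variables (C : fieldType) (A : algType C) (n : nat) (q : C).
Hypotheses (q0 : q != 0) (q2N : 1 + q ^+ 2 != 0).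
Variables (lp lm : 'I_n -> 'I_n -> A).
Hypotheses (Rpp : RLLe q lp lp) (Rmm : RLLe q lm lm) (Rpm : RLLe q lp lm).
Local Notation Lsp := (Lsp lp lm).
Local Notation Zop := (Zop q).
Local Notation Zch := (Zch q lp lm).
Local Notation vac := (@vac C A n).
Implicit Types (i j k r : 'I_n) (J : {set 'I_n}) (s : seq 'I_n) (u : C).

Section OneStep.
Variables (p mu : C) (a b : 'I_n) (ee ka kb : A).
Hypothesis ab : a != b.
Hypothesis adj : forall k : 'I_n, k != a -> k != b -> (k < a)%N = (k < b)%N.
Hypothesis adj_p : forall J, a \in J -> b \in J -> p * sg q b J + sg q a J = 0.
Hypothesis H1 : forall u i k, p ^+ (i == b) *: (Lsp u i k * ee) + ((i == a)%:R * mu) *: (Lsp u b k * ka) =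
  p ^+ (k == a) *: (ee * Lsp u i k) + ((k == b)%:R * mu) *: (kb * Lsp u i a).
Hypothesis Ha : forall u i k, p ^+ (i == a) *: (Lsp u i k * ka) = p ^+ (k == a) *: (ka * Lsp u i k).
Hypothesis Hb : forall u i k, p ^+ (i == b) *: (Lsp u i k * kb) = p ^+ (k == b) *: (kb * Lsp u i k).
Local Notation Op := (Op p mu a b ee kb).
Local Notation Kop := (Kop p a ka).

Lemma Kop_Zch s u J : uniq s -> Kop (Zch s u) J = p ^+ (a \in s) *: (Zch s u J * ka).
Proof.
elim: s u J => [|i s IH] u J /=.
  move=> _; rewrite /Kop /vac; case: (eqVneq J set0) => [->|_]; last by rewrite mulr0 mul0r !scaler0.
  by rewrite inE mulr1 mul1r.
case/andP => is_ us; rewrite (Kop_Zop q Ha).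
rewrite (Zop_ext _ _ (g' := fun K => p ^+ (a \in s) *: (Zch s (q ^+ 2 * u) K * ka))); last by move=> K _; apply: IH.
rewrite Zop_gZ Zop_gr scalerA -exprD inE [a == i]eq_sym; congr (_ ^+ _ *: _).
by case: (eqVneq i a) is_ => [->|_] //= /negbTE ->.
Qed.

Lemma Op_nil u J : Op (Zch [::] u) J = Zch [::] u J * ee.
Proof.
rewrite /Op /= /vac; have -> : (a |: J :\ b == set0) = false.
  by apply/negbTE/set0Pn; exists a; rewrite setU11.
rewrite mulr0 scaler0 addr0; case: (eqVneq J set0) => [->|_]; last by rewrite mulr0 mul0r scaler0.
by rewrite inE mulr1 mul1r expr0 scale1r.
Qed.

Lemma Op_prefix (s1 s2 s3 : seq 'I_n) (c d : C) (x y : A) : a \notin s1 -> b \notin s1 ->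
  (forall u J, Op (Zch s2 u) J = c *: (Zch s2 u J * x) + d *: (Zch s3 u J * y)) ->
  forall u J, Op (Zch (s1 ++ s2) u) J = c *: (Zch (s1 ++ s2) u J * x) + d *: (Zch (s1 ++ s3) u J * y).
Proof.
move=> + + h; elim: s1 => [|i s1 IH] //; rewrite !inE !negb_or => /andP[ai as1] /andP[bi bs1] u J.
rewrite /= (Op_Zop ab adj adj_p H1 Hb) ![i == _]eq_sym (negbTE ai) (negbTE bi) mul0r scale0r addr0 expr0 scale1r.
rewrite (Zop_ext _ _ (g' := fun K => c *: (Zch (s1 ++ s2) (q ^+ 2 * u) K * x) +
   d *: (Zch (s1 ++ s3) (q ^+ 2 * u) K * y))); last by move=> K _; apply: IH.
by rewrite Zop_gD !Zop_gZ !Zop_gr.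
Qed.

Lemma Op_Zch0 s u J : a \notin s -> b \notin s -> Op (Zch s u) J = Zch s u J * ee.
Proof.
move=> as_ bs; have := @Op_prefix s [::] [::] 1 0 ee ee as_ bs.
rewrite !cats0 => h; rewrite h ?scale1r ?scale0r ?addr0 // => w K.
by rewrite Op_nil scale1r scale0r addr0.
Qed.

Lemma Op_a s2 u J : uniq s2 -> a \notin s2 -> b \notin s2 ->
  Op (Zch (a :: s2) u) J = 1 *: (Zch (a :: s2) u J * ee) + mu *: (Zch (b :: s2) u J * ka).
Proof.
move=> us as2 bs2; rewrite [Zch _]/= (Op_Zop ab adj adj_p H1 Hb) eqxx (negbTE ab) mul1r scale1r expr0 scale1r.
rewrite -!Zop_gr; congr (_ + _ *: _); apply: Zop_ext => K _; first exact: Op_Zch0.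
by rewrite Kop_Zch // (negbTE as2) expr0 scale1r.
Qed.

Lemma Op_b s2 u J : a \notin s2 -> b \notin s2 ->
  Op (Zch (b :: s2) u) J = p *: (Zch (b :: s2) u J * ee) + 0 *: (Zch (b :: s2) u J * ee).
Proof.
move=> as2 bs2; rewrite [Zch _]/= (Op_Zop ab adj adj_p H1 Hb) eqxx [b == a]eq_sym (negbTE ab).
rewrite mul0r !scale0r expr1; congr (_ *: _ + _); rewrite -Zop_gr; apply: Zop_ext => K _; exact: Op_Zch0.
Qed.

Lemma Op_ab s2 u J : uniq s2 -> a \notin s2 -> b \notin s2 ->
  Op (Zch (a :: b :: s2) u) J = p *: (Zch (a :: b :: s2) u J * ee) + 0 *: (Zch (a :: b :: s2) u J * ee).
Proof.
move=> us as2 bs2; have -> : Zch (a :: b :: s2) = fun u => Zop (Lsp u a) (Zch (b :: s2) (q ^+ 2 * u)) by [].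
rewrite (Op_Zop ab adj adj_p H1 Hb) eqxx (negbTE ab) expr0 scale1r scale0r addr0 mul1r.
rewrite [X in _ + mu *: X](_ : _ = 0) ?scaler0 ?addr0; last first.
  rewrite (Zop_ext _ _ (g' := fun K => p ^+ (a \in b :: s2) *: (Zch (b :: s2) (q ^+ 2 * u) K * ka))).
    by rewrite Zop_gZ Zop_gr /= Zop_self // mul0r scaler0.
  by move=> K _; apply: Kop_Zch; rewrite /= bs2.
rewrite -Zop_gr -Zop_gZ; apply: Zop_ext => K _.
by rewrite Op_b // scale0r addr0.
Qed.

Lemma Op_ba s2 u J : uniq s2 -> a \notin s2 -> b \notin s2 ->
  Op (Zch (b :: a :: s2) u) J = p *: (Zch (b :: a :: s2) u J * ee) + 0 *: (Zch (b :: a :: s2) u J * ee).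
Proof.
move=> us as2 bs2; have -> : Zch (b :: a :: s2) = fun u => Zop (Lsp u b) (Zch (a :: s2) (q ^+ 2 * u)) by [].
rewrite (Op_Zop ab adj adj_p H1 Hb) eqxx [b == a]eq_sym (negbTE ab) mul0r !scale0r !addr0 expr1.
congr (_ *: _).
rewrite (Zop_ext _ _ (g' := fun K => Zch (a :: s2) (q ^+ 2 * u) K * ee + mu *: (Zch (b :: s2) (q ^+ 2 * u) K * ka))).
  by rewrite Zop_gD Zop_gZ !Zop_gr /= Zop_self // mul0r scaler0 addr0.
by move=> K _; rewrite Op_a // scale1r.
Qed.

Lemma Op_eval g J : a \in J -> Op g J = p *: (ee * g J).
Proof. by move=> aJ; rewrite /Op aJ expr1 mul0r scale0r addr0. Qed.

Lemma Op_eval0 g J : a \notin J -> b \in J -> Op g J = ee * g J + mu *: (kb * g (a |: J :\ b)).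
Proof. by move=> aJ bJ; rewrite /Op aJ bJ (negbTE aJ) expr0 scale1r mul1r. Qed.

End OneStep.
End Chains.

Section Minors.
Variables (C : fieldType) (A : algType C) (n : nat) (q : C).
Hypotheses (q0 : q != 0) (q2N : 1 + q ^+ 2 != 0) (lam0 : q - q^-1 != 0).
Variables (lp lm : 'I_n -> 'I_n -> A).
Hypotheses (Rpp : RLLe q lp lp) (Rmm : RLLe q lm lm) (Rpm : RLLe q lp lm).
Hypotheses (lp0 : forall i k : 'I_n, (k < i)%N -> lp i k = 0).
Hypotheses (lm0 : forall i k : 'I_n, (i < k)%N -> lm i k = 0).
Hypotheses (lpm : forall i, lp i i * lm i i = 1) (lmp : forall i, lm i i * lp i i = 1).
Local Notation lam := (q - q^-1).
Local Notation Lsp := (Lsp lp lm).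
Local Notation Zop := (Zop q).
Local Notation Zch := (Zch q lp lm).
Implicit Types (i j k : 'I_n) (r : nat) (J : {set 'I_n}) (s : seq 'I_n) (u v : C).

Lemma lin_tt (c1 c2 c3 c4 : C) (x1 x1' x2 x2' x3 x3' x4 x4' : A) (f1 f2 f3 f4 : A -> A) u :
  (forall x y, f1 (x + u *: y) = f1 x + u *: f1 y) -> (forall x y, f2 (x + u *: y) = f2 x + u *: f2 y) ->
  (forall x y, f3 (x + u *: y) = f3 x + u *: f3 y) -> (forall x y, f4 (x + u *: y) = f4 x + u *: f4 y) ->
  c1 *: f1 x1 + c2 *: f2 x2 = c3 *: f3 x3 + c4 *: f4 x4 ->
  c1 *: f1 x1' + c2 *: f2 x2' = c3 *: f3 x3' + c4 *: f4 x4' ->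
  c1 *: f1 (x1 + u *: x1') + c2 *: f2 (x2 + u *: x2') = c3 *: f3 (x3 + u *: x3') + c4 *: f4 (x4 + u *: x4').
Proof.
move=> h1 h2 h3 h4 e1 e2; rewrite h1 h2 h3 h4 !scalerDr !scalerA ![_ * u]mulrC -!scalerA.
by rewrite addrACA -scalerDr e1 e2 scalerDr addrACA.
Qed.

Lemma linl (c x y : A) u : (x + u *: y) * c = x * c + u *: (y * c).
Proof. by rewrite mulrDl scalerAl. Qed.
Lemma linr (c x y : A) u : c * (x + u *: y) = c * x + u *: (c * y).
Proof. by rewrite mulrDr scalerAr. Qed.

Lemma diag_m l a i k : RLLe q l lm -> q ^+ (i == a) *: (l i k * lm a a) = q ^+ (k == a) *: (lm a a * l i k).
Proof.
move=> R; have := R i a k a; case: (ltnP i a) => ia; case: (ltnP a k) => ak;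
by rewrite ?(lm0 ia) ?(lm0 ak) ?mulr0 ?mul0r ?scaler0 ?mul0r ?scale0r ?addr0.
Qed.

Lemma diag_p l a i k : RLLe q lp l -> q ^+ (i == a) *: (lp a a * l i k) = q ^+ (k == a) *: (l i k * lp a a).
Proof.
move=> R; have := R a i a k; rewrite ![a == _]eq_sym; case: (ltnP a i) => ia; case: (ltnP k a) => ak;
by rewrite ?(lp0 ia) ?(lp0 ak) ?mulr0 ?mul0r ?scaler0 ?mul0r ?scale0r ?addr0.
Qed.

Lemma diag_pV l a i k : RLLe q lp l ->
  q^-1 ^+ (i == a) *: (l i k * lp a a) = q^-1 ^+ (k == a) *: (lp a a * l i k).
Proof.
move=> R; have := diag_p a i k R => /(congr1 (fun x => (q^-1 ^+ (i == a) * q^-1 ^+ (k == a)) *: x)).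
rewrite !scalerA => E.
have h (b : bool) : q^-1 ^+ b * q ^+ b = 1 by rewrite -exprMn mulVf // expr1n.
rewrite mulrAC h mul1r in E; rewrite E -mulrA h mulr1 //.
Qed.

Section Adjacent.
Variables (a b : 'I_n).
Hypothesis ab : b = a.+1 :> nat.

Lemma ab_neq : a != b. Proof. by rewrite -val_eqE /= ab; lia. Qed.

Lemma ab_adj (k : 'I_n) : k != a -> k != b -> (k < a)%N = (k < b)%N.
Proof. by rewrite -!val_eqE /= ab; lia. Qed.

Lemma sg_adj J : a \in J -> b \in J -> sg q b J = - q^-1 * sg q a J.
Proof.
move=> aJ bJ; have lab : (a < b)%N by rewrite ab.
rewrite (sgD1r _ lab aJ); congr (_ * _); rewrite /sg; congr (_ ^+ _); apply: eq_card => k; rewrite !inE.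
by rewrite -val_eqE /= ab; case: (k \in J); lia.
Qed.

Lemma E_l l i k : RLLe q l lm ->
  q ^+ (i == b) *: (l i k * lm b a) + ((i == a)%:R * lam) *: (l b k * lm a a) =
  q ^+ (k == a) *: (lm b a * l i k) + ((k == b)%:R * lam) *: (lm b b * l i a).
Proof.
move=> R; have := R i b k a.
have -> : ((i < b)%N%:R * lam) *: (l b k * lm i a) = ((i == a)%:R * lam) *: (l b k * lm a a).
  rewrite ab ltnS leq_eqVlt; case: (eqVneq i a) => [->|ia]; first by rewrite eqxx.
  rewrite (_ : (i == a :> nat) = false) ?orFb; last by rewrite val_eqE (negbTE ia).
  by case: ltnP => h; rewrite ?(lm0 h) ?mulr0 ?scaler0 // !mul0r !scale0r.
have -> : ((a < k)%N%:R * lam) *: (lm b k * l i a) = ((k == b)%:R * lam) *: (lm b b * l i a).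
  case: (eqVneq k b) => [->|kb]; first by rewrite ab ltnSn.
  case: (ltnP a k) => h; last by rewrite !mul0r !scale0r.
  have h' : (b < k)%N by move: kb h; rewrite -val_eqE /= ab; lia.
  by rewrite (lm0 h') !mul0r scaler0 scale0r.
done.
Qed.

Lemma F_l l j (r : 'I_n) : RLLe q lp l ->
  q^-1 ^+ (j == a) *: (l j r * lp a b) + ((j == b)%:R * (q^-1 - q)) *: (l a r * lp b b) =
  q^-1 ^+ (r == b) *: (lp a b * l j r) + ((r == a)%:R * (q^-1 - q)) *: (lp a a * l j b).
Proof.
move=> R; have := R a j b r.
have -> : ((a < j)%N%:R * lam) *: (lp j b * l a r) = ((j == b)%:R * lam) *: (lp b b * l a r).
  case: (eqVneq j b) => [->|kb]; first by rewrite ab ltnSn.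
  case: (ltnP a j) => h; last by rewrite !mul0r !scale0r.
  have h' : (b < j)%N by move: kb h; rewrite -val_eqE /= ab; lia.
  by rewrite (lp0 h') !mul0r scaler0 scale0r.
have -> : ((r < b)%N%:R * lam) *: (l j b * lp a r) = ((r == a)%:R * lam) *: (l j b * lp a a).
  rewrite ab ltnS leq_eqVlt; case: (eqVneq r a) => [->|ia]; first by rewrite eqxx.
  rewrite (_ : (r == a :> nat) = false) ?orFb; last by rewrite val_eqE (negbTE ia).
  by case: ltnP => h; rewrite ?(lp0 h) ?mulr0 ?scaler0 // !mul0r !scale0r.
move=> /(congr1 (fun x => (q^-1 ^+ (j == a) * q^-1 ^+ (r == b)) *: x)).
rewrite !scalerDr !scalerA [a == j]eq_sym [b == r]eq_sym.
have h (c : bool) : q^-1 ^+ c * q ^+ c = 1 by rewrite -exprMn mulVf // expr1n.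
have ba : (b == a) = false by rewrite eq_sym (negbTE ab_neq).
rewrite [q^-1 ^+ (j == a) * _ * q ^+ (j == a)]mulrAC h mul1r -[q^-1 ^+ (j == a) * _ * q ^+ (r == b)]mulrA h mulr1.
have -> : (q^-1 ^+ (j == a) * q^-1 ^+ (r == b) * ((j == b)%:R * lam)) *: (lp b b * l a r) =
   ((j == b)%:R * lam) *: (l a r * lp b b).
  case: (eqVneq j b) => [->|_]; last by rewrite !mul0r mulr0 !scale0r.
  have := diag_pV b a r R; rewrite ba (negbTE ab_neq) expr0 scale1r mul1r => ->.
  by rewrite scalerA mulrC mul1r.
have -> : (q^-1 ^+ (j == a) * q^-1 ^+ (r == b) * ((r == a)%:R * lam)) *: (l j b * lp a a) =
   ((r == a)%:R * lam) *: (lp a a * l j b).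
  case: (eqVneq r a) => [->|_]; last by rewrite !mul0r mulr0 !scale0r.
  rewrite (negbTE ab_neq) expr0 mulr1; have := diag_pV a j b R; rewrite ba expr0 scale1r => <-.
  by rewrite scalerA mulrC.
rewrite -[q^-1 - q]opprB !mulrN !scaleNr => E.
by apply/eqP; rewrite subr_eq addrAC eq_sym subr_eq E.
Qed.

Lemma E_tt u i k :
  q ^+ (i == b) *: (Lsp u i k * lm b a) + ((i == a)%:R * lam) *: (Lsp u b k * lm a a) =
  q ^+ (k == a) *: (lm b a * Lsp u i k) + ((k == b)%:R * lam) *: (lm b b * Lsp u i a).
Proof.
apply: (lin_tt (f1 := fun x => x * _) (f2 := fun x => x * _) (f3 := fun x => _ * x) (f4 := fun x => _ * x));
  by [move=> x y; apply: linl | move=> x y; apply: linr | apply: E_l].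
Qed.

Lemma F_tt u j (r : 'I_n) :
  q^-1 ^+ (j == a) *: (Lsp u j r * lp a b) + ((j == b)%:R * (q^-1 - q)) *: (Lsp u a r * lp b b) =
  q^-1 ^+ (r == b) *: (lp a b * Lsp u j r) + ((r == a)%:R * (q^-1 - q)) *: (lp a a * Lsp u j b).
Proof.
apply: (lin_tt (f1 := fun x => x * _) (f2 := fun x => x * _) (f3 := fun x => _ * x) (f4 := fun x => _ * x));
  by [move=> x y; apply: linl | move=> x y; apply: linr | apply: F_l].
Qed.

End Adjacent.

Lemma diag_m_tt a u i k : q ^+ (i == a) *: (Lsp u i k * lm a a) = q ^+ (k == a) *: (lm a a * Lsp u i k).
Proof.
by rewrite linl linr !scalerDr !scalerA ![_ * u]mulrC -!scalerA !diag_m.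
Qed.

Lemma diag_p_tt a u i k : q^-1 ^+ (i == a) *: (Lsp u i k * lp a a) = q^-1 ^+ (k == a) *: (lp a a * Lsp u i k).
Proof.
by rewrite linl linr !scalerDr !scalerA ![_ * u]mulrC -!scalerA !diag_pV.
Qed.

Definition rows (r : nat) : seq 'I_n := pmap insub (iota 0 r).
Definition cols (r : nat) : {set 'I_n} := [set i : 'I_n | (i < r)%N].

Lemma map_rows r : (r <= n)%N -> [seq val i | i <- rows r] = iota 0 r.
Proof.
move=> rn; rewrite /rows.
suff H m : (m + r <= n)%N -> [seq val i | i <- pmap insub (iota m r) : seq 'I_n] = iota m r by apply: (H 0%N).
move=> {rn}; elim: r m => [|r IH] m h //=; rewrite insubT /=; first by lia.
by move=> h'; rewrite IH //; lia.
Qed.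

Lemma mem_rows r i : (i \in rows r) = (i < r)%N.
Proof.
rewrite mem_pmap; apply/idP/idP => [h|ir].
  case: (elimT (seq.mapP) h) => k; rewrite mem_iota add0n => /andP[_ kr].
  by case: insubP => // x _ xk [->]; rewrite xk.
by apply: (introT (seq.mapP)); exists (val i); rewrite ?mem_iota // valK.
Qed.

Lemma rows_sorted r : (r <= n)%N -> sorted ltn [seq val i | i <- rows r].
Proof. by move=> rn; rewrite map_rows // iota_ltn_sorted. Qed.

Lemma rows_uniq r : (r <= n)%N -> uniq (rows r).
Proof. by move=> rn; rewrite -(map_inj_uniq val_inj) map_rows // iota_uniq. Qed.

Lemma rowsS r i : r = i :> nat -> rows r.+1 = rows r ++ [:: i].
Proof.
by move=> ->; rewrite /rows -addn1 iotaD pmap_cat add0n /= valK.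
Qed.

Lemma rows_split r i : (i < r)%N -> exists s2, rows r = rows i ++ i :: s2 /\ forall k, k \in s2 = (i < k < r)%N.
Proof.
move=> ir; exists (pmap insub (iota i.+1 (r - i.+1))); split.
  by rewrite /rows -{1}(subnKC ir) iotaD pmap_cat add0n -addn1 iotaD pmap_cat -catA add0n /= valK.
move=> k; rewrite mem_pmap; apply/idP/idP => [h|ikr].
  case: (elimT (seq.mapP) h) => l; rewrite mem_iota => hl.
  by case: insubP => // x _ xk [->]; rewrite xk; lia.
apply: (introT (seq.mapP)); exists (val k); rewrite ?valK // mem_iota /=; move: ikr ir => /andP[]; move: (val k) (nat_of_ord i) => /= x y; lia.
Qed.

Definition Am r u : A := Zch (rows r) u (cols r).

Lemma Am_diag r a u : (r <= n)%N -> lm a a * Am r u = Am r u * lm a a.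
Proof.
move=> rn; have := Kop_Zch q (diag_m_tt a) u (cols r) (rows_uniq rn).
rewrite /Kop mem_rows inE => /(congr1 (fun x => (q ^+ (a < r)%N)^-1 *: x)).
by rewrite !scalerA mulVf ?scale1r ?expf_neq0.
Qed.

Section Adj2.
Variables (a b : 'I_n).
Hypothesis ab : b = a.+1 :> nat.

Let nab := ab_neq ab.
Let adjab := ab_adj ab.
Let nba : b != a. Proof. by rewrite eq_sym. Qed.
Let adjba (k : 'I_n) : k != b -> k != a -> (k < b)%N = (k < a)%N.
Proof. by move=> h h'; rewrite adjab. Qed.
Let adjpE J : a \in J -> b \in J -> q * sg q b J + sg q a J = 0.
Proof. by move=> aJ bJ; rewrite (sg_adj ab aJ bJ) mulrA mulrN mulfV // mulN1r addNr. Qed.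
Let adjpF J : b \in J -> a \in J -> q^-1 * sg q a J + sg q b J = 0.
Proof. by move=> bJ aJ; rewrite (sg_adj ab aJ bJ) mulNr subrr. Qed.

Lemma rows_ab r : (b < r)%N -> (r <= n)%N -> exists s2, [/\ rows r = rows a ++ a :: b :: s2, uniq s2, a \notin s2 & b \notin s2].
Proof.
move=> br rn; have [s2 [h1 h2]] := rows_split br.
exists s2; rewrite h1 ab (rowsS (i := a)) // -catA; split=> //.
- by have := rows_uniq rn; rewrite h1 cat_uniq /= => /and3P[_ _ /andP[]].
- by rewrite h2 ab; lia.
- by rewrite h2 ltnn.
Qed.

Lemma Am_commE r u : (b < r)%N -> (r <= n)%N -> lm b a * Am r u = Am r u * lm b a.
Proof.
move=> br rn; have [s2 [hs us as2 bs2]] := rows_ab br rn.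
have ar : a \notin rows a by rewrite mem_rows ltnn.
have bra : b \notin rows a by rewrite mem_rows ab; lia.
have aJ : a \in cols r by rewrite inE; lia.
have := Op_prefix nab adjab adjpE (E_tt ab) (diag_m_tt b) ar bra
  (fun w K => Op_ab q0 q2N Rpp Rmm Rpm nab adjab adjpE (E_tt ab) (diag_m_tt a) (diag_m_tt b) w K us as2 bs2) u (cols r).
rewrite -hs scale0r addr0 (Op_eval _ _ _ _ _ _ aJ) -/(Am r u) => /(congr1 (fun x => q^-1 *: x)).
by rewrite !scalerA mulVf // !scale1r.
Qed.

Lemma Am_commF r u : (b < r)%N -> (r <= n)%N -> lp a b * Am r u = Am r u * lp a b.
Proof.
move=> br rn; have [s2 [hs us as2 bs2]] := rows_ab br rn.
have ar : a \notin rows a by rewrite mem_rows ltnn.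
have bra : b \notin rows a by rewrite mem_rows ab; lia.
have bJ : b \in cols r by rewrite inE; lia.
have := Op_prefix nba adjba adjpF (F_tt ab) (diag_p_tt a) bra ar
  (fun w K => Op_ba q0 q2N Rpp Rmm Rpm nba adjba adjpF (F_tt ab) (diag_p_tt b) (diag_p_tt a) w K us bs2 as2) u (cols r).
rewrite -hs scale0r addr0 (Op_eval _ _ _ _ _ _ bJ) -/(Am r u) => /(congr1 (fun x => q *: x)).
by rewrite !scalerA mulfV // !scale1r.
Qed.

(* The minors of [Am a.+1] with the last row, respectively the last column, replaced by the next one. *)
Definition Cm u : A := Zch (rows a ++ [:: b]) u (cols b).
Definition Bm u : A := Zch (rows b) u (b |: cols b :\ a).

Lemma Cm_E u : q *: (lm b a * Am b u) = Am b u * lm b a + lam *: (Cm u * lm a a).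
Proof.
have ar : a \notin rows a by rewrite mem_rows ltnn.
have bra : b \notin rows a by rewrite mem_rows ab; lia.
have aJ : a \in cols b by rewrite inE ab.
have := Op_prefix nab adjab adjpE (E_tt ab) (diag_m_tt b) ar bra
  (fun w K => Op_a nab adjab adjpE (E_tt ab) (diag_m_tt a) (diag_m_tt b) (s2 := [::]) w K isT isT isT) u (cols b).
by rewrite (Op_eval _ _ _ _ _ _ aJ) scale1r /Am [in rows b]ab (rowsS (i := a)).
Qed.

Lemma Bm_F u : lp a b * Am b u + (q^-1 - q) *: (lp a a * Bm u) = q^-1 *: (Am b u * lp a b).
Proof.
have ar : a \notin rows a by rewrite mem_rows ltnn.
have bra : b \notin rows a by rewrite mem_rows ab; lia.
have bJ : b \notin cols b by rewrite inE ltnn.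
have aJ : a \in cols b by rewrite inE ab.
have := Op_prefix nba adjba adjpF (F_tt ab) (diag_p_tt a) bra ar
  (fun w K => Op_b nba adjba adjpF (F_tt ab) (diag_p_tt a) (s2 := [::]) w K isT isT) u (cols b).
rewrite (Op_eval0 _ _ _ _ _ bJ aJ) scale0r addr0.
by rewrite /Am /Bm ![in rows b]ab (rowsS (i := a)).
Qed.

End Adj2.

Lemma commZ (c : C) (x y : A) : GRing.comm x y -> GRing.comm x (c *: y).
Proof. by rewrite /GRing.comm => h; rewrite -scalerAr -scalerAl h. Qed.

Lemma Am_commKm r u a : (r <= n)%N -> GRing.comm (Am r u) (lm a a).
Proof. by move=> rn; apply/commr_sym/Am_diag. Qed.

Lemma Am_commKp r u a : (r <= n)%N -> GRing.comm (Am r u) (lp a a).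
Proof.
move=> rn; have h := Am_diag a u rn.
by rewrite /GRing.comm -[LHS]mul1r -(lpm a) -mulrA [lm a a * _]mulrA h -!mulrA lmp mulr1.
Qed.

Lemma Am_commlm r u i k : (r <= n)%N -> (i < r)%N -> (k < r)%N -> GRing.comm (Am r u) (lm i k).
Proof.
move=> rn ir kr; case: (ltngtP i k) => [ik|ki|/val_inj ->]; last exact: Am_commKm.
  by rewrite lm0 //; apply: commr0.
move: {2}(i - k)%N (leqnn (i - k)) => d; elim: d i k ki ir kr => [|d IH] i k ki ir kr hd; first by lia.
have hb : (k.+1 < n)%N by lia.
pose b := Ordinal hb; have kb : b = k.+1 :> nat by [].
have cba : GRing.comm (Am r u) (lm b k).
  by apply: commr_sym; apply: Am_commE => //=; lia.
case: (eqVneq i b) => [-> //|nib].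
have bi : (b < i)%N by move: nib; rewrite -val_eqE /=; lia.
have := E_l kb i b Rmm; rewrite (negbTE nib) eqxx -!val_eqE /= mul1r.
rewrite (_ : (i == k :> nat) = false); last by lia.
rewrite (_ : (k.+1 == k) = false); last by lia.
rewrite expr0 !scale1r mul0r scale0r addr0 => E.
have -> : lm i k = lam^-1 *: (lp b b * (lm i b * lm b k - lm b k * lm i b)).
  by rewrite E addrAC subrr add0r -scalerAr scalerA mulVf // scale1r mulrA lpm mul1r.
have cib : GRing.comm (Am r u) (lm i b) by apply: IH => //=; lia.
by apply/commZ/commrM; [apply: Am_commKp | apply: commrB; apply: commrM].
Qed.

Lemma Am_commlp r u i k : (r <= n)%N -> (i < r)%N -> (k < r)%N -> GRing.comm (Am r u) (lp i k).
Proof.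
move=> rn ir kr; case: (ltngtP i k) => [ik|ki|/val_inj ->]; last exact: Am_commKp.
  2: by rewrite lp0 //; apply: commr0.
move: {2}(k - i)%N (leqnn (k - i)) => d; elim: d i k ik ir kr => [|d IH] i k ik ir kr hd; first by lia.
have ha : (k.-1 < n)%N by lia.
pose a := Ordinal ha; have ak : k = a.+1 :> nat by rewrite /=; lia.
have cba : GRing.comm (Am r u) (lp a k).
  by apply: commr_sym; apply: Am_commF.
case: (eqVneq i a) => [-> //|nia].
have ia : (i < a)%N by move: nia; rewrite -val_eqE /=; lia.
have := F_l ak i a Rpp; rewrite (negbTE nia) eqxx mul1r.
rewrite (_ : (i == k) = false); last by rewrite -val_eqE /=; lia.
rewrite (_ : (a == k) = false); last by rewrite -val_eqE /=; lia.
rewrite !expr0 !scale1r mul0r scale0r addr0 => E.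
have lam0' : q^-1 - q != 0 by rewrite -opprB oppr_eq0.
have -> : lp i k = (q^-1 - q)^-1 *: (lm a a * (lp i a * lp a k - lp a k * lp i a)).
  by rewrite E addrAC subrr add0r -scalerAr scalerA mulVf // scale1r mulrA lmp mul1r.
have cia : GRing.comm (Am r u) (lp i a) by apply: IH => //=; lia.
by apply/commZ/commrM; [apply: Am_commKm | apply: commrB; apply: commrM].
Qed.

Lemma Am_commtt r u v i k : (r <= n)%N -> (i < r)%N -> (k < r)%N -> GRing.comm (Am r u) (Lsp v i k).
Proof. by move=> rn ir kr; apply: commrD; [apply: Am_commlp | apply: commZ; apply: Am_commlm]. Qed.

(* The quantum adjugate of L^+ + v L^- restricted to the first r rows and columns. *)
Definition adjS r v j i : A := ((- q) ^+ i * sg q j (cols r)) *: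
  Zch (rows i ++ drop i.+1 (rows r)) (q ^+ 2 * v) (cols r :\ j).

Lemma rows_drop r i : (i < r)%N -> (r <= n)%N -> rows r = rows i ++ i :: drop i.+1 (rows r).
Proof.
move=> ir rn; have [s2 [h _]] := rows_split ir; rewrite {1}h; congr (_ ++ _ :: _).
have hs : size (rows i) = i by rewrite -(size_map val) map_rows ?size_iota //; lia.
by rewrite h drop_cat hs ltnNge leqnSn /= subSnn /= drop0.
Qed.

Lemma tt_adjS r v k i : (r <= n)%N -> (k < r)%N -> (i < r)%N ->
  \sum_(j in cols r) Lsp v k j * adjS r v j i = (k == i)%:R *: Am r v.
Proof.
move=> rn kr ir.
transitivity ((- q) ^+ i *: Zch (k :: rows i ++ drop i.+1 (rows r)) v (cols r)).
  rewrite /= /Zop scaler_sumr; apply: eq_bigr => j _.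
  by rewrite /adjS -scalerAr scalerA.
have hs : size (rows i) = i by rewrite -(size_map val) map_rows ?size_iota //; lia.
case: (eqVneq k i) => [->|ki].
  rewrite Zch_move //; last by move=> l; rewrite mem_rows.
  rewrite hs scalerA -exprMn mulrNN mulfV // expr1n !scale1r.
  by rewrite -rows_drop.
rewrite scale0r Zch_in ?scaler0 //.
  have := rows_sorted rn; rewrite {1}(rows_drop ir rn); apply: subseq_sorted; first exact: ltn_trans.
  by apply: map_subseq; rewrite cat_subseq // subseq_cons.
have : k \in rows r by rewrite mem_rows.
by rewrite {1}(rows_drop ir rn) !mem_cat inE (negbTE ki).
Qed.

Hypothesis infC : injective (fun k : nat => k%:R : C).

Lemma algC_comm (x : A) v : GRing.comm x v%:A.
Proof. by rewrite /GRing.comm mulr_algr mulr_algl. Qed.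

Lemma horner_algM (P Q : {poly A}) v : (P * Q).[v%:A] = P.[v%:A] * Q.[v%:A].
Proof. by rewrite hornerM_comm // /comm_poly algC_comm. Qed.

Lemma horner_alg0 (P : {poly A}) (vs : seq C) : uniq vs -> (size P <= size vs)%N ->
  (forall v, v \in vs -> P.[v%:A] = 0) -> P = 0.
Proof.
elim: vs P => [|v vs IH] P; first by rewrite leqn0 size_poly_eq0 => _ /eqP ->.
move=> /= /andP[vvs uvs] sP h.
have [Q PE] : exists Q, P = Q * ('X - (v%:A)%:P).
  by apply: (elimT (factor_theorem _ _)); rewrite rootE h ?mem_head.
case: (eqVneq P 0) => [-> //|P0]; have Q0 : Q != 0 by apply: contraNneq P0 => Q0; rewrite PE Q0 mul0r.
have {}sP : (size Q <= size vs)%N.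
  by move: sP; rewrite PE size_Mmonic ?monicXsubC // size_XsubC addn2.
rewrite PE (IH Q) ?mul0r // => w wvs.
have := h w; rewrite inE wvs orbT PE horner_algM hornerXsubC -scalerBl mulr_algr => /(_ isT) /eqP.
rewrite scaler_eq0 subr_eq0 => /orP[/eqP wv|/eqP //].
by move: vvs; rewrite -wv wvs.
Qed.

Definition polyfun (f : C -> A) : Prop := exists P : {poly A}, forall v, f v = P.[v%:A].

Lemma polyfun_ext f g : f =1 g -> polyfun f -> polyfun g.
Proof. by move=> fg [P hP]; exists P => v; rewrite -fg. Qed.

Lemma polyfun_cst (x : A) : polyfun (fun=> x).
Proof. by exists x%:P => v; rewrite hornerC. Qed.

Lemma polyfunM f g : polyfun f -> polyfun g -> polyfun (fun v => f v * g v).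
Proof. by move=> [P hP] [Q hQ]; exists (P * Q) => v; rewrite horner_algM hP hQ. Qed.

Lemma polyfunD f g : polyfun f -> polyfun g -> polyfun (fun v => f v + g v).
Proof. by move=> [P hP] [Q hQ]; exists (P + Q) => v; rewrite hornerD hP hQ. Qed.

Lemma polyfunZ (a : C) f : polyfun f -> polyfun (fun v => a *: f v).
Proof.
move=> pf; apply: (@polyfun_ext (fun v => a%:A * f v)); first by move=> v; rewrite mulr_algl.
by apply: polyfunM pf; apply: polyfun_cst.
Qed.

Lemma polyfunB f g : polyfun f -> polyfun g -> polyfun (fun v => f v - g v).
Proof.
move=> pf pg; apply: (@polyfun_ext (fun v => f v + (-1) *: g v)); first by move=> v; rewrite scaleN1r.
by apply/polyfunD/polyfunZ.
Qed.

Lemma polyfun_sum (I : Type) (t : seq I) (P : pred I) (F : I -> C -> A) :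
  (forall i : I, P i -> polyfun (F i)) -> polyfun (fun v => \sum_(i <- t | P i) F i v).
Proof.
move=> h; elim: t => [|i t IH].
  by apply: polyfun_ext (polyfun_cst 0) => v; rewrite big_nil.
have [Pi|Pi] := boolP (P i); last by apply: polyfun_ext IH => v; rewrite big_cons (negbTE Pi).
by apply: polyfun_ext (polyfunD (h _ Pi) IH) => v; rewrite big_cons Pi.
Qed.

Lemma polyfun_tt c i j : polyfun (fun v => Lsp (c * v) i j).
Proof.
exists ((lp i j)%:P + 'X * (c *: lm i j)%:P) => v.
by rewrite hornerD horner_algM !hornerC hornerX mulr_algl scalerA mulrC.
Qed.

Lemma polyfun_Zch s c J : polyfun (fun v => Zch s (c * v) J).
Proof.
elim: s c J => [|i s IH] c J /=; first exact: polyfun_cst.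
apply: polyfun_sum => j _; apply/polyfunZ/polyfunM; first exact: polyfun_tt.
by apply: polyfun_ext (IH (q ^+ 2 * c) _) => v; rewrite mulrA.
Qed.

Lemma lp_cancel r (x : 'I_n -> A) : (forall k, (k < r)%N -> \sum_(j in cols r) lp k j * x j = 0) ->
  forall k, (k < r)%N -> x k = 0.
Proof.
move=> h k; move: {2}(r - k)%N (leqnn (r - k)) => d; elim: d k => [|d IH] k hd kr; first by lia.
have := h k kr; rewrite (bigD1 k) ?inE //= big1 ?addr0 => [/(congr1 (fun y => lm k k * y))|j /andP[]].
  by rewrite mulr0 mulrA lmp mul1r.
rewrite inE => jr jk; case: (ltngtP j k) => [jk'|kj|/val_inj jk']; last by rewrite jk' eqxx in jk.
  by rewrite lp0 ?mul0r.
by rewrite IH ?mulr0 //; lia.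
Qed.

Lemma tt_cancel r (Z : 'I_n -> C -> A) : (forall j, polyfun (Z j)) ->
  (forall v k, (k < r)%N -> \sum_(j in cols r) Lsp v k j * Z j v = 0) ->
  forall v k, (k < r)%N -> Z k v = 0.
Proof.
move=> /(@fin_all_exists _ _ _)[P hP] h.
suff P0 t k : (k < r)%N -> (P k)`_t = 0.
  move=> v k kr; rewrite hP (_ : P k = 0) ?horner0 //.
  by apply/polyP => t; rewrite coef0 P0.
have E k' : (k' < r)%N -> \sum_(j in cols r) ((lp k' j)%:P + 'X * (lm k' j)%:P) * P j = 0.
  move=> kr; set S := \sum_(_ in _) _.
  apply: (@horner_alg0 _ [seq (x%:R : C) | x <- iota 0 (size S)]) => [||_ /(elimT (seq.mapP))[x _ ->]].
  - by rewrite (map_inj_uniq infC) iota_uniq.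
  - by rewrite size_map size_iota.
  rewrite -(h x%:R k' kr) /S horner_sum; apply: eq_bigr => j _.
  by rewrite horner_algM hornerD horner_algM !hornerC hornerX mulr_algl hP.
elim: t k => [|t IH] k; [apply: (@lp_cancel r (fun j => (P j)`_0)) | apply: (@lp_cancel r (fun j => (P j)`_t.+1))].
all: move=> k' kr; have := E k' kr.
  move/(congr1 (fun p : {poly A} => p`_0)); rewrite coef0 coef_sum => E0; rewrite -[RHS]E0; apply: eq_bigr => j _.
  by rewrite mulrDl coefD -mulrA coefXM coefCM addr0.
move/(congr1 (fun p : {poly A} => p`_t.+1)); rewrite coef0 coef_sum => E0; rewrite -[RHS]E0; apply: eq_bigr => j jr.
rewrite mulrDl coefD -mulrA coefXM !coefCM IH ?mulr0 ?addr0 //.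
by move: jr; rewrite inE.
Qed.

Lemma polyfun_adjS r j i : polyfun (fun v => adjS r v j i).
Proof. exact/polyfunZ/polyfun_Zch. Qed.

Lemma adjS_tt r v j (l : 'I_n) : (r <= n)%N -> (j < r)%N -> (l < r)%N ->
  \sum_(i in cols r) adjS r v j i * Lsp v i l = (j == l)%:R *: Am r v.
Proof.
move=> rn jr lr.
pose Z j v := \sum_(i in cols r) adjS r v j i * Lsp v i l - (j == l)%:R *: Am r v.
suff : Z j v = 0 by move/eqP; rewrite subr_eq0 => /eqP.
have pA : polyfun (Am r) by apply: polyfun_ext (polyfun_Zch (rows r) 1 (cols r)) => w; rewrite mul1r.
have pT i l' : polyfun (fun v => Lsp v i l').
  by apply: polyfun_ext (polyfun_tt 1 i l') => w; rewrite mul1r.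
apply: (@tt_cancel r) jr => [k|w k kr].
  by apply/polyfunB/polyfunZ => //; apply: polyfun_sum => i _; apply/polyfunM/pT/polyfun_adjS.
rewrite /Z; under eq_bigr do rewrite mulrBr mulr_sumr; rewrite sumrB exchange_big /=.
apply/eqP; rewrite subr_eq0; apply/eqP.
transitivity (\sum_(i in cols r) (k == i)%:R *: (Lsp w i l * Am r w)).
  apply: eq_bigr => i; rewrite inE => ir.
  under eq_bigr do rewrite mulrA; rewrite -mulr_suml tt_adjS // -scalerAl; congr (_ *: _).
  exact: Am_commtt.
rewrite (bigD1 k) ?inE //= eqxx scale1r big1 ?addr0 => [|i /andP[_ /negbTE ik]]; last first.
  by rewrite eq_sym ik scale0r.
rewrite (bigD1 l) ?inE //= eqxx scale1r big1 ?addr0 // => i /andP[_ /negbTE il].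
by rewrite il scale0r mulr0.
Qed.

Lemma sg_cols r j : (j <= r)%N -> sg q j (cols r) = (- q^-1) ^+ j.
Proof.
move=> jr; rewrite /sg; congr (_ ^+ _).
rewrite -[RHS](card_ord j) -(card_image (f := widen_ord (ltnW (ltn_ord j)))); last first.
  by move=> x y /(congr1 val) /= /val_inj.
apply: eq_card => k; rewrite !inE; apply/idP/idP => [/andP[_ kj]|/imageP[x _ ->]].
  by apply/imageP; exists (Ordinal kj) => //; apply: val_inj.
by rewrite /= (ltn_ord x) andbT (leq_trans (ltn_ord x)).
Qed.

Lemma Sylvester (a b : 'I_n) v : b = a.+1 :> nat ->
  Am b.+1 v * Am a (q ^+ 2 * v) = adjS b.+1 v a a * Am b v - q *: (Bm a b (q ^+ 2 * v) * Cm a b v).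
Proof.
move=> ab; have bn := ltn_ord b.
have [hab nab] : (a < b)%N /\ a != b by rewrite ab; split=> //; apply: ab_neq.
have [W WE] : exists W : 'I_n -> A, forall i, W i = Zch (i :: rows a) v (cols b) by eexists.
pose X := \sum_(i in cols b.+1) adjS b.+1 v a i * W i.
have sga : sg q a (cols b) = (- q^-1) ^+ a by apply: sg_cols; lia.
have s0 : (- q^-1) ^+ a != 0 :> C by rewrite expf_neq0 // oppr_eq0 invr_eq0.
have cE : cols b :\ a = cols a.
  by apply/setP => k; rewrite !inE -val_eqE /= ab; lia.
have X1 : X = (- q^-1) ^+ a *: (Am b.+1 v * Am a (q ^+ 2 * v)).
  rewrite /X; under eq_bigr do rewrite WE /= /Zop mulr_sumr; rewrite exchange_big /=.
  transitivity (\sum_(l in cols b) sg q l (cols b) *: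
     ((a == l)%:R *: Am b.+1 v * Zch (rows a) (q ^+ 2 * v) (cols b :\ l))).
    apply: eq_bigr => l; rewrite inE => lb.
    under eq_bigr do rewrite -scalerAr mulrA; rewrite -scaler_sumr -mulr_suml adjS_tt //; lia.
  rewrite (bigD1 a) ?inE //= eqxx scale1r cE big1 ?addr0 ?sga // => i /andP[_ /negbTE ia].
  by rewrite eq_sym ia scale0r mul0r scaler0.
have mv i : i \notin rows a -> W i = (- q^-1) ^+ a *: Zch (rows a ++ [:: i]) v (cols b).
  move=> ir; rewrite WE -{1}[rows a]cats0 Zch_move //.
    by rewrite -{1}(size_map val (rows a)) map_rows ?size_iota //; lia.
  by move=> k; rewrite mem_rows; move: ir; rewrite mem_rows; lia.
have X2 : X = (- q^-1) ^+ a *: (adjS b.+1 v a a * Am b v + adjS b.+1 v a b * Cm a b v).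
  rewrite /X (bigD1 a) ?inE ?ltnS 1?ltnW //= (bigD1 b) ?inE ?ltnSn 1?eq_sym //= big1 ?addr0.
    rewrite !mv ?mem_rows ?ltnn -?leqNgt 1?ltnW // /Am [in RHS]ab (rowsS (i := a)) // -!scalerAr -scalerDr.
    by rewrite -ab.
  move=> i /andP[/andP[]]; rewrite inE => ib ia ib'.
  rewrite WE Zch_in ?mulr0 // ?rows_sorted // ?mem_rows; first by lia.
  by move: ia ib' ib; rewrite -!val_eqE /=; lia.
have := X1; rewrite X2 => /(congr1 (fun x => ((- q^-1) ^+ a)^-1 *: x)).
rewrite !scalerA mulVf // !scale1r => <-; congr (_ + _).
rewrite /adjS sg_cols; last by lia.
rewrite ab exprS -!mulrA -exprMn mulrNN mulfV // expr1n mulr1 -ab scaleNr mulNr -scalerAl.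
congr (- (_ *: (_ * _))); rewrite /Bm drop_oversize ?cats0.
  congr (Zch _ _ _); apply/setP => k; rewrite !inE -!val_eqE /=; lia.
by rewrite -(size_map val) map_rows ?size_iota //.
Qed.

Fixpoint Ych (s : seq 'I_n) (d : nat) : {set 'I_n} -> A :=
  if s is i :: s' then fun J =>
    (if d is d'.+1 then Zop (lp i) (Ych s' d') J else 0) + q^-1 ^+ (2 * d) *: Zop (lm i) (Ych s' d) J
  else fun J => (d == 0%N)%:R * vac A J.

Lemma Ych_over s d J : (size s < d)%N -> Ych s d J = 0.
Proof.
elim: s d J => [|i s IH] [|d] J //= h; first by rewrite mul0r.
rewrite !(Zop_ext _ _ (g' := fun=> 0)) ?Zop_g0 ?scaler0 ?addr0 // => K _; apply: IH => //.
exact: ltnW.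
Qed.

Lemma Zop_gsum (I : Type) (t : seq I) x (F : I -> {set 'I_n} -> A) J :
  Zop x (fun K => \sum_(e <- t) F e K) J = \sum_(e <- t) Zop x (F e) J.
Proof.
elim: t => [|e t IH].
  by rewrite (Zop_ext _ _ (g' := fun=> 0)) ?Zop_g0 ?big_nil // => K _; rewrite big_nil.
by rewrite big_cons -IH -Zop_gD; apply: Zop_ext => K _; rewrite big_cons.
Qed.

Definition kap (k d : nat) : C := q ^+ (d * d.-1 + 2 * d * (k - d)).

Lemma Zch_Ych s v J : Zch s v J = \sum_(d < (size s).+1) (v ^+ d * kap (size s) d) *: Ych s (size s - d) J.
Proof.
elim: s v J => [|i s IH] v J.
  by rewrite big_ord_recl big_ord0 /kap /= addr0 expr0 !mul1r expr0 scale1r.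
set k := size s.
have E (l : 'I_n -> A) : Zop l (Zch s (q ^+ 2 * v)) J =
    \sum_(d < k.+1) ((q ^+ 2 * v) ^+ d * kap k d) *: Zop l (Ych s (k - d)) J.
  rewrite (Zop_ext _ _ (g' := fun K => \sum_(d < k.+1) ((q ^+ 2 * v) ^+ d * kap k d) *: Ych s (k - d) K)).
    by rewrite Zop_gsum; apply: eq_bigr => d _; rewrite Zop_gZ.
  by move=> K _; apply: IH.
rewrite [LHS]/= ZopD ZopZ !E.
have -> : \sum_(d < (size (i :: s)).+1) (v ^+ d * kap (size (i :: s)) d) *: Ych (i :: s) (size (i :: s) - d) J =
   \sum_(d < k.+2) (v ^+ d * kap k.+1 d) *: (if (k.+1 - d)%N is d'.+1 then Zop (lp i) (Ych s d') J else 0) +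
   \sum_(d < k.+2) (v ^+ d * kap k.+1 d * q^-1 ^+ (2 * (k.+1 - d))) *: Zop (lm i) (Ych s (k.+1 - d)) J.
  by rewrite -big_split; apply: eq_bigr => d _; rewrite /= scalerDr scalerA.
congr (_ + _).
  rewrite [RHS]big_ord_recr /= subnn scaler0 addr0; apply: eq_bigr => d _ /=.
  have dk : (d <= k)%N by rewrite -ltnS.
  rewrite subSn //; congr (_ *: _); rewrite exprMn -exprM [q ^+ _ * _]mulrC -mulrA; congr (_ * _).
  by rewrite /kap -exprD; congr (_ ^+ _); rewrite subSn //; lia.
rewrite [RHS]big_ord_recl (Zop_ext _ _ (g' := fun=> 0)); last first.
  by move=> K _; apply: Ych_over; rewrite subn0.
rewrite Zop_g0 scaler0 add0r scaler_sumr; apply: eq_bigr => d _ /=.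
have dk : (d <= k)%N by rewrite -ltnS.
rewrite /bump leq0n add1n subSS scalerA; congr (_ *: _).
rewrite exprMn -exprM exprS [q ^+ _ * _]mulrC -!mulrA; congr (_ * (_ * _)).
rewrite /kap -exprD exprVn; apply: (@mulIf _ (q ^+ (2 * (k - d)))); first by rewrite expf_neq0.
rewrite mulfVK ?expf_neq0 // subSS -exprD; congr (_ ^+ _).
by rewrite /=; case: (nat_of_ord d) dk => [|e] /=; nia.
Qed.

Fixpoint chF r : ('I_r -> 'I_n -> A) -> {set 'I_n} -> A :=
  match r with
  | 0 => fun _ => @vac C A n
  | r1.+1 => fun x => Zop (x ord0) (chF (fun e : 'I_r1 => x (lift ord0 e)))
  end.

Lemma chF_move r (x : 'I_r.+1 -> 'I_n -> A) (p : 'I_r.+1) J :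
  (forall e : 'I_r.+1, (e < p)%N -> forall g K, Zop (x e) (Zop (x p) g) K = - q^-1 *: Zop (x p) (Zop (x e) g) K) ->
  chF x J = (- q^-1) ^+ p *: Zop (x p) (chF (fun e => x (lift p e))) J.
Proof.
elim: r x p J => [|r IH] x p J h; case: (unliftP ord0 p) h => [p' ->|->] h; rewrite ?scale1r //; first by case: p' h.
rewrite [LHS]/= (Zop_ext _ _ (g' := fun K => (- q^-1) ^+ p' *: Zop (x (lift ord0 p'))
   (chF (fun e => x (lift ord0 (lift p' e)))) K)); last first.
  by move=> K _; apply: (IH (fun e => x (lift ord0 e)) p' K) => e ep g K'; apply: h; rewrite ltn_lift.
rewrite Zop_gZ h // scalerA mulrC -exprS; congr (_ *: _); apply: Zop_ext => K _ /=.
have -> : x (lift (lift ord0 p') ord0) = x ord0 by congr x; apply: val_inj.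
congr (Zop _ (chF _) _); apply/funext => e; congr x; apply: val_inj => /=.
by rewrite /bump !leq0n !add1n ltnS; case: leqP; lia.
Qed.

Definition increasing r (c : 'I_r -> 'I_n) := forall a b : 'I_r, (a < b)%N -> (c a < c b)%N.

Lemma incr_lift r (c : 'I_r.+1 -> 'I_n) p : increasing c -> increasing (fun e => c (lift p e)).
Proof. by move=> h a b ab; apply: h; rewrite ltn_lift. Qed.

Lemma incr_mono r (c : 'I_r -> 'I_n) a b : increasing c -> (c a < c b)%N = (a < b)%N.
Proof.
move=> h; case: (ltngtP a b) => [/h -> //|/h ba|/val_inj ->]; last by rewrite ltnn.
by apply/negbTE; rewrite -leqNgt ltnW.
Qed.

Lemma incr_inj r (c : 'I_r -> 'I_n) : increasing c -> injective c.
Proof.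
move=> h a b ab; apply: val_inj; case: (ltngtP a b) => [/h|/h|//]; by rewrite ab ltnn.
Qed.

Lemma sum_perm0 (M : nmodType) (F : 'S_0 -> M) : \sum_s F s = F 1%g.
Proof.
by rewrite (bigD1 1%g) //= big1 ?addr0 // => s /eqP []; apply/permP => -[].
Qed.

Lemma perm_length0 (s : 'S_0) : perm_length s = 0%N.
Proof. by rewrite perm_length_sum big_ord0. Qed.

Lemma chF_perm r (x : 'I_r -> 'I_n -> A) (c : 'I_r -> 'I_n) : increasing c ->
  \sum_(s : 'S_r) (- q^-1) ^+ perm_length s *: \prod_(e < r) x e (c (s e)) = chF x [set c e | e : 'I_r].
Proof.
elim: r x c => [|r IH] x c h.
  rewrite sum_perm0 perm_length0 big_ord0 scale1r /= /vac (_ : [set _ | _ in _] = set0) ?eqxx //.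
  by apply/setP => k; rewrite inE; apply/imsetP => -[[]].
rewrite (sum_lift_perm ord0) /= /Zop big_imset /=; last by move=> a b _ _; apply: incr_inj.
apply: eq_bigr => j _.
have -> : sg q (c j) [set c e | e : 'I_r.+1] = (- q^-1) ^+ j.
  rewrite /sg; congr (_ ^+ _).
  rewrite -[RHS]count_lt_ord.
  have -> : [set k in [set c e | e : 'I_r.+1] | (k < c j)%N] = [set c (lift j e) | e : 'I_r & (e < j)%N].
    apply/setP => k; rewrite !inE; apply/andP/imsetP => [[/imsetP[e _ ->]]|[e]].
      rewrite incr_mono //; case: (unliftP j e) => [e' ->|->]; last by rewrite ltnn.
      rewrite /= /bump => hh; exists e' => //; rewrite inE.
      by move: hh; case: leqP; lia.
    rewrite inE => ej ->; split; first by apply: imset_f.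
    by rewrite incr_mono //= /bump; move: ej; case: leqP; lia.
  rewrite card_imset; last by apply/incr_inj/incr_lift.
  by rewrite -sum1dep_card big_mkcond; apply: eq_bigr => e _; case: ifP.
rewrite (_ : _ :\ c j = [set c (lift j e) | e : 'I_r]); last first.
  apply/setP => k; rewrite !inE; apply/andP/imsetP => [[kj /imsetP[e _ ke]]|[e _ ->]].
    move: kj; rewrite ke (inj_eq (incr_inj h)); case: (unliftP j e) => [e' ->|->]; last by rewrite eqxx.
    by exists e'.
  by split; [rewrite (inj_eq (incr_inj h)) eq_sym neq_lift | apply: imset_f].
rewrite -(IH _ _ (@incr_lift _ c j h)) mulr_sumr scaler_sumr; apply: eq_bigr => s _.
rewrite perm_length_lift ?eqxx // add0n exprD -scalerA -scalerAr big_ord_recl lift_perm_id; congr (_ *: (_ *: (_ * _))).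
by apply: eq_bigr => e _; rewrite lift_perm_lift.
Qed.

Definition Nq (d : nat) : C := \prod_(x < d) \sum_(y < x.+1) q^-1 ^+ (2 * y).

Lemma NqS (d : nat) : Nq d.+1 = Nq d * \sum_(y < d.+1) q^-1 ^+ (2 * y).
Proof. by rewrite /Nq big_ord_recr. Qed.

Definition lsel (d : nat) (e : nat) := if (e < d)%N then lp else lm.

Lemma lsel_swap d e e' i j g J : (e <= e')%N -> (j < i)%N ->
  Zop (lsel d e i) (Zop (lsel d e' j) g) J = - q^-1 *: Zop (lsel d e' j) (Zop (lsel d e i) g) J.
Proof.
move=> ee ji; apply: Zop_rel1 => k l kl; rewrite /lsel.
case: (ltnP e' d) => h'; first by rewrite (leq_ltn_trans ee h') (mn_same q0 Rpp).
case: ltnP => h; last by rewrite (mn_same q0 Rmm).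
rewrite (mn_pm q0 Rpm) // ltnNge (ltnW ji) mul0r scale0r addr0.
rewrite (_ : (i == j) = false); last by rewrite -val_eqE /=; lia.
by rewrite expr0 scale1r scalerA mulrNN mulVf // scale1r.
Qed.

Definition Wsum r d (c : 'I_r -> 'I_n) J : A :=
  \sum_(s : 'S_r) (- q^-1) ^+ perm_length s *: chF (fun e => lsel d e (c (s e))) J.

Lemma Wsum_rec r d (c : 'I_r.+1 -> 'I_n) J : increasing c ->
  Wsum d c J = \sum_(p < r.+1) q^-1 ^+ (2 * p) *:
    Zop (lsel d p (c ord0)) (Wsum (d - (p < d)) (fun e => c (lift ord0 e))) J.
Proof.
move=> h; rewrite /Wsum sum_lift_perm0; apply: eq_bigr => p _.
rewrite Zop_gsum scaler_sumr; apply: eq_bigr => s _.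
rewrite perm_length_lift ?eqxx ?orbT // addn0 Zop_gZ scalerA.
rewrite (chF_move (p := p)) /=; last first.
  move=> e ep g K; rewrite lift_perm_id; apply: lsel_swap; first exact: ltnW.
  by apply: h; case: (unliftP p e) ep => [e' ->|->]; rewrite ?ltnn // lift_perm_lift.
rewrite scalerA lift_perm_id; congr (_ *: _).
  by rewrite exprD mulrAC -exprD addnn -mul2n [in LHS]exprM sqrrN -exprM.
congr (Zop _ (chF _) _); apply/funext => e; rewrite lift_perm_lift.
rewrite /lsel (_ : (lift p e < d)%N = (e < d - (p < d))%N) //.
by rewrite /= /bump; case: (leqP p e) => pe; case: (ltnP p d) => pd; lia.
Qed.

Lemma Wsum_Ych r d (c : 'I_r -> 'I_n) J : increasing c -> (d <= r)%N ->
  Wsum d c J = (Nq d * Nq (r - d)) *: Ych [seq c e | e <- enum 'I_r] d J.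
Proof.
elim: r d c J => [|r IH] d c J h dr.
  move: dr; rewrite leqn0 => /eqP ->.
  rewrite /Wsum sum_perm0 perm_length0 /Nq big_ord0 mulr1 !scale1r /=.
  by rewrite (size0nil (size_enum_ord 0)) /= mul1r.
rewrite Wsum_rec // enum_ordSl [map _ (_ :: _)]/= -map_comp.
set c' := fun e : 'I_r => c (lift ord0 e).
have h' : increasing c' by apply: incr_lift.
set S := [seq _ | _ <- _]; have SE : S = [seq c' e | e <- enum 'I_r] by [].
have zs : size S = r by rewrite SE size_map size_enum_ord.
rewrite (bigID (fun p : 'I_r.+1 => (p < d)%N)) /=.
have -> : \sum_(p < r.+1 | (p < d)%N) q^-1 ^+ (2 * p) *:
    Zop (lsel d p (c ord0)) (Wsum (d - (p < d)) (fun e => c (lift ord0 e))) J =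
  (Nq d * Nq (r.+1 - d)) *: (if d is d'.+1 then Zop (lp (c ord0)) (Ych S d') J else 0).
  case: d dr => [|d] dr; first by rewrite big_pred0 // scaler0.
  rewrite (big_ord_narrow dr).
  under eq_bigr => p _ do rewrite /lsel /= ltn_ord.
  rewrite -scaler_suml subSS (Zop_ext _ _ (g' := fun K => (Nq d * Nq (r - d)) *: Ych S d K)).
    by rewrite Zop_gZ scalerA NqS; congr (_ *: _); ring.
  by move=> K _; rewrite subn1 SE -IH.
have -> : \sum_(p < r.+1 | ~~ (p < d)%N) q^-1 ^+ (2 * p) *:
    Zop (lsel d p (c ord0)) (Wsum (d - (p < d)) (fun e => c (lift ord0 e))) J =
  (Nq d * Nq (r.+1 - d)) *: (q^-1 ^+ (2 * d) *: Zop (lm (c ord0)) (Ych S d) J).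
  case: (ltnP r d) => dr'.
    rewrite (Zop_ext _ _ (g' := fun=> 0)) ?Zop_g0 ?scaler0; last first.
      by move=> K _; rewrite Ych_over // zs.
    by rewrite big_pred0 // => p; apply/negbTE; rewrite negbK (leq_trans (ltn_ord p)).
  transitivity (\sum_(p < r.+1 | ~~ (p < d)%N) q^-1 ^+ (2 * p) *:
     ((Nq d * Nq (r - d)) *: Zop (lm (c ord0)) (Ych S d) J)).
    apply: eq_bigr => p /negbTE pd; rewrite /lsel pd subn0 -[in RHS]Zop_gZ; congr (_ *: _).
    by apply: Zop_ext => K _; rewrite SE -IH.
  rewrite -scaler_suml !scalerA; congr (_ *: _).
  rewrite subSn // NqS.
  have -> : \sum_(p < r.+1 | ~~ (p < d)%N) q^-1 ^+ (2 * p) = q^-1 ^+ (2 * d) * \sum_(y < (r - d).+1) q^-1 ^+ (2 * y).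
    rewrite -(big_mkord (fun p => ~~ (p < d)%N) (fun p => q^-1 ^+ (2 * p))) mulr_sumr.
    rewrite (@big_cat_nat _ _ _ d) //=.
    rewrite big_nat_cond big_pred0 ?add0r => [|p]; last by rewrite leq0n /= andbN.
    rewrite -{1}[d]add0n big_addn subSn // big_mkord; apply: eq_big => p.
      by rewrite -leqNgt leq_addl.
    by move=> _; rewrite -exprD; congr (_ ^+ _); lia.
  by ring.
by rewrite -scalerDr.
Qed.

Lemma rows_widen r (rn : (r <= n)%N) : rows r = [seq widen_ord rn e | e <- enum 'I_r].
Proof.
apply: (inj_map val_inj); rewrite map_rows // -map_comp -val_enum_ord.
by apply: eq_map.
Qed.

Lemma central_Ych r d (rn : (r <= n)%N) : (d <= r)%N ->
  \sum_(s : 'S_r) \sum_(s' : 'S_r) (- q) ^- (perm_length s + perm_length s') *: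
    \prod_(e < r) (if (e < d)%N then lp else lm) (widen_ord rn (s e)) (widen_ord rn (s' e)) =
  (Nq d * Nq (r - d)) *: Ych (rows r) d (cols r).
Proof.
move=> dr.
have h : increasing (widen_ord rn) by [].
rewrite rows_widen -(Wsum_Ych _ h dr); apply: eq_bigr => s _.
have -> : cols r = [set widen_ord rn e | e : 'I_r].
  apply/setP => k; rewrite inE; apply/idP/imsetP => [kr|[e _ ->]]; last exact: (ltn_ord e).
  by exists (Ordinal kr) => //; apply: val_inj.
rewrite -chF_perm // scaler_sumr; apply: eq_bigr => s' _.
by rewrite scalerA -exprD -exprVn invrN.
Qed.

Lemma Ych_lp0 s k J : k \in J -> all (fun i => (k < i)%N) s -> Ych s (size s) J = 0.
Proof.
elim: s J => [|i s IH] J kJ /=.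
  by move=> _; rewrite /vac (_ : (J == set0) = false) ?mulr0 //; apply/negbTE/set0Pn; exists k.
case/andP => ki hs; rewrite [X in _ + _ *: X](_ : _ = 0) ?scaler0 ?addr0; last first.
  rewrite (Zop_ext _ _ (g' := fun=> 0)) ?Zop_g0 // => K _; exact: Ych_over.
rewrite /Zop big1 // => j jJ; case: (eqVneq j k) => [->|jk]; first by rewrite lp0 // mul0r scaler0.
by rewrite IH ?mulr0 ?scaler0 // !inE eq_sym jk.
Qed.

Lemma sg_min i J : {in J, forall k, (i <= k)%N} -> sg q i J = 1.
Proof.
move=> h; rewrite /sg (_ : [set k in J | (k < i)%N] = set0) ?cards0 //.
by apply/setP => k; rewrite !inE; apply/andP => -[/h]; rewrite leqNgt => /negP.
Qed.

Lemma setD1_cons i s : i \notin s -> [set x in i :: s] :\ i = [set x in s].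
Proof.
by move=> is_; apply/setP => x; rewrite !inE; case: eqVneq => [->|] //=; rewrite (negbTE is_).
Qed.

Lemma sorted_min i s : sorted ltn [seq val x | x <- i :: s] ->
  [/\ sorted ltn [seq val x | x <- s], all (fun k : 'I_n => (i < k)%N) s, i \notin s &
      {in [set x in i :: s], forall k, (i <= k)%N}].
Proof.
move=> h; have hs : all (fun k : 'I_n => (i < k)%N) s.
  by have := order_path_min ltn_trans h; rewrite all_map.
split => //; first exact: path_sorted h.
  by apply/negP => /(allP hs); rewrite ltnn.
by move=> k; rewrite !inE => /orP[/eqP -> //|/(allP hs) /ltnW].
Qed.

Lemma Ych_lp s : sorted ltn [seq val x | x <- s] ->
  Ych s (size s) [set x in s] = \prod_(i <- s) lp i i.
Proof.
elim: s => [|i s IH] h.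
  by rewrite big_nil /= mul1r /vac (_ : [set _ in _] = set0) ?eqxx //; apply/setP => x; rewrite !inE.
have [h1 h2 h3 h4] := sorted_min h; rewrite big_cons -IH // [LHS]/=.
rewrite [X in _ + _ *: X](_ : _ = 0) ?scaler0 ?addr0; last first.
  rewrite (Zop_ext _ _ (g' := fun=> 0)) ?Zop_g0 // => K _; exact: Ych_over.
rewrite /Zop (bigD1 i) ?inE ?eqxx //= sg_min // scale1r setD1_cons // big1 ?addr0 // => j /andP[jJ ji].
by rewrite (Ych_lp0 (k := i)) ?mulr0 ?scaler0 // !inE eqxx eq_sym ji.
Qed.

Lemma Ych_lm s : sorted ltn [seq val x | x <- s] -> Ych s 0 [set x in s] = \prod_(i <- s) lm i i.
Proof.
elim: s => [|i s IH] h.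
  by rewrite big_nil /= mul1r /vac (_ : [set _ in _] = set0) ?eqxx //; apply/setP => x; rewrite !inE.
have [h1 h2 h3 h4] := sorted_min h; rewrite big_cons -IH // [LHS]/= add0r expr0 scale1r.
rewrite /Zop (bigD1 i) ?inE ?eqxx //= sg_min // scale1r setD1_cons // big1 ?addr0 // => j /andP[jJ ji].
by rewrite lm0 ?mul0r ?scaler0 // ltn_neqAle h4 // eq_sym ji.
Qed.

Lemma cols_rows r : cols r = [set x in rows r].
Proof. by apply/setP => k; rewrite !inE mem_rows. Qed.

Definition Dt r d : A := kap r d *: Ych (rows r) (r - d) (cols r).

Lemma Am_Dt r v : (r <= n)%N -> Am r v = \sum_(d < r.+1) v ^+ d *: Dt r d.
Proof.
move=> rn; rewrite /Am Zch_Ych (_ : size (rows r) = r); last first.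
  by rewrite -(size_map val) map_rows ?size_iota.
by apply: eq_bigr => d _; rewrite /Dt scalerA.
Qed.

Lemma Dt0 r : (r <= n)%N -> Dt r 0 = \prod_(i <- rows r) lp i i.
Proof.
move=> rn; rewrite /Dt subn0 cols_rows -Ych_lp ?rows_sorted // /kap muln0 mul0n expr0 scale1r.
by rewrite -{1}(size_map val (rows r)) map_rows ?size_iota.
Qed.

Lemma Dtr r : (r <= n)%N -> Dt r r = q ^+ (r * r.-1) *: \prod_(i <- rows r) lm i i.
Proof. by move=> rn; rewrite /Dt subnn cols_rows Ych_lm ?rows_sorted // /kap subnn muln0 addn0. Qed.

Lemma central_Dt r d (rn : (r <= n)%N) : (d <= r)%N ->
  \sum_(s : 'S_r) \sum_(s' : 'S_r) (- q) ^- (perm_length s + perm_length s') *: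
    \prod_(e < r) (if (e < d)%N then lp else lm) (widen_ord rn (s e)) (widen_ord rn (s' e)) =
  (Nq d * Nq (r - d) / kap r (r - d)) *: Dt r (r - d).
Proof.
move=> dr; rewrite central_Ych // /Dt subKn // scalerA mulfVK // /kap expf_neq0 //.
Qed.
End Minors.

Section RmatEntries.
Variables (R : realType) (n m : nat).
Local Notation C := R[i].
Local Notation U := (Uq R n m).
Local Notation q := (qpar R m).
Implicit Types (i j a b k r : 'I_n).

Lemma RmatE i j a b : Rmat R n m (mxtens_index (i, j)) (mxtens_index (a, b)) =
  q ^+ (i == j) * ((a == i) && (b == j))%:R + ((i < j)%N%:R * (q - q^-1)) * ((a == j) && (b == i))%:R.
Proof.
rewrite /Rmat !mxE !summxE; congr (_ + _).
  under eq_bigr do rewrite tensmxE !mxE.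
  under [X in _ + X]eq_bigr do rewrite summxE.
  have -> : \sum_(k < n) ((i == k) && (a == k))%:R * ((j == k) && (b == k))%:R =
      ((i == j) && (a == i) && (b == i))%:R :> C.
    rewrite (bigD1 i) //= eqxx big1 ?addr0 /= => [|k /negbTE ki]; last by rewrite eq_sym ki mul0r.
    by rewrite -natrM mulnb andbCA andbA eq_sym.
  have -> : \sum_(k < n) \sum_(l < n | k != l) (delta_mx k k *t delta_mx l l : 'M[C]_(n * n)) (mxtens_index (i, j)) (mxtens_index (a, b)) =
      ((i != j) && (a == i) && (b == j))%:R :> C.
    rewrite (bigD1 i) //= [X in _ + X]big1 ?addr0 => [|k /negbTE ki]; last first.
      by rewrite big1 // => l _; rewrite tensmxE !mxE eq_sym ki mul0r.
    case: (eqVneq i j) => [->|ij] /=.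
      by rewrite big1 // => l /negbTE jl; rewrite tensmxE !mxE jl mulr0.
    rewrite (bigD1 j) //= [X in _ + X]big1 ?addr0 => [|l /andP[_ /negbTE lj]].
      by rewrite tensmxE !mxE !eqxx /= -natrM mulnb.
    by rewrite tensmxE !mxE [j == l]eq_sym lj mulr0.
  case: (eqVneq i j) => [->|ij] /=; first by rewrite expr1 addr0.
  by rewrite mulr0 add0r expr0 mul1r.
rewrite [RHS]mulrAC mulrC; congr (_ * _).
under eq_bigr do rewrite summxE.
rewrite (bigD1 i) //= [X in _ + X]big1 ?addr0 => [|k /negbTE ki]; last first.
  by rewrite big1 // => l _; rewrite tensmxE !mxE eq_sym ki mul0r.
case: (ltnP i j) => ij; last first.
  rewrite mul0r big1 // => l il; rewrite tensmxE !mxE.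
  case: (eqVneq j l) il => [<-|_ _] /=; first by rewrite ltnNge ij.
  by rewrite mulr0.
rewrite (bigD1 j) //= [X in _ + X]big1 ?addr0 => [|l /andP[_ /negbTE lj]].
  by rewrite tensmxE !mxE !eqxx /= -natrM mulnb mul1r.
by rewrite tensmxE !mxE [j == l]eq_sym lj mulr0.
Qed.

Lemma sum_tens (M : nmodType) (F : 'I_(n * n) -> M) :
  \sum_k F k = \sum_(a < n) \sum_(b < n) F (mxtens_index (a, b)).
Proof.
rewrite pair_bigA (reindex (fun p : 'I_n * 'I_n => mxtens_index p)) /=; last first.
  by exists (@mxtens_unindex n n) => x _; rewrite ?mxtens_indexK ?mxtens_unindexK.
by apply: eq_bigr => -[].
Qed.

Lemma sum_delta2 (M : lmodType C) (F : 'I_n -> 'I_n -> M) (c : 'I_n -> 'I_n -> C) i j :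
  \sum_(a < n) \sum_(b < n) (c a b * ((a == i) && (b == j))%:R) *: F a b = c i j *: F i j.
Proof.
rewrite (bigD1 i) //= (bigD1 j) //= !eqxx mulr1 !big1 ?addr0 // => [a /negbTE ai|b /negbTE bj]; last by rewrite bj mulr0 scale0r.
by rewrite big1 // => b _; rewrite ai mulr0 scale0r.
Qed.

Lemma RLL_RLLe (A B : 'M[U]_n) : RLL A B -> RLLe q (fun i j => A i j) (fun i j => B i j).
Proof.
move=> h i j k r.
have h1 a b c d : (A *t (1%:M : 'M_n) *m (1%:M *t B)) (mxtens_index (a, b)) (mxtens_index (c, d)) = A a c * B b d.
  rewrite mxE sum_tens (bigD1 c) //= (bigD1 b) //= !big1 ?addr0 => [|x xc|y yb].
  - by rewrite !tensmxE !mxE !eqxx mulr1 mul1r.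
  - by rewrite big1 // => y _; rewrite !tensmxE !mxE (negbTE xc) mul0r mulr0.
  - by rewrite !tensmxE !mxE [b == y]eq_sym (negbTE yb) mulr0 mul0r.
have h2 a b c d : (((1%:M : 'M_n) *t B) *m (A *t (1%:M : 'M_n))) (mxtens_index (a, b)) (mxtens_index (c, d)) = B b d * A a c.
  rewrite mxE sum_tens (bigD1 a) //= (bigD1 d) //= !big1 ?addr0 => [|x xc|y yb].
  - by rewrite !tensmxE !mxE !eqxx mulr1 mul1r.
  - by rewrite big1 // => y _; rewrite !tensmxE !mxE [a == x]eq_sym (negbTE xc) !mul0r.
  - by rewrite !tensmxE !mxE (negbTE yb) !mulr0.
move: h; rewrite /RLL /= -mulmxA => /matrixP /(_ (mxtens_index (i, j)) (mxtens_index (k, r))).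
rewrite mxE [in RHS]mxE !sum_tens.
under eq_bigr => a _ do under eq_bigr => b _ do
  rewrite mxE h1 RmatE mulr_algl scalerDl.
under [RHS]eq_bigr => a _ do under eq_bigr => b _ do
  rewrite h2 mxE RmatE mulr_algr scalerDl ![k == _]eq_sym ![r == _]eq_sym.
under eq_bigr do rewrite big_split /=; under [RHS]eq_bigr do rewrite big_split /=.
rewrite !big_split /= !(sum_delta2 (fun a b => A a k * B b r) (fun _ _ => _)) => ->.
rewrite (sum_delta2 (fun a b => B j b * A i a) (fun a b => q ^+ (a == b))).
rewrite -(sum_delta2 (fun a b => B j b * A i a) (fun a b => (a < b)%N%:R * (q - q^-1))); congr (_ + _).
by apply: eq_bigr => a _; apply: eq_bigr => b _; rewrite andbC.
Qed.

End RmatEntries.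

(** * The Gelfand-Tsetlin module *)

Section Main.
Variables (R : realType) (n m : nat).
Hypotheses (n_ge2 : (2 <= n)%N) (m_ge3 : (3 <= m)%N) (m_odd : odd m).
Variable (v : tableau n R[i]).
Hypotheses (v_generic : generic v) (v_A : conventionA v) (v_B : conventionB v).
Variables (V : lmodType (Uq R n m)) (T : tableau n R[i] -> V).
Hypothesis V_gt : is_gt_module v T.
Local Notation C := R[i].
Local Notation U := (Uq R n m).
Local Notation Q := (@qpow R m).
Local Notation qn := (@qnum R m).
Local Notation q := (qpar R m).
Local Notation L := (lattice n).
Local Notation t z := (T (shift v z)).
Implicit Types (z : L) (k j : nat).

Definition cE k j z : C := gt_coefE m (shift v z) k j.
Definition cF k j z : C := gt_coefF m (shift v z) k j.

Lemma t_basis : ground_basis (fun z : L => t z). Proof. exact: V_gt.1. Qed.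

Lemma actK k z : (1 <= k <= n)%N -> uqK R n m k *: t z = Q (gt_a (shift v z) k) *' t z.
Proof. by case: (V_gt.2 z) => h _ _ _ /h. Qed.

Lemma actKi k z : (1 <= k <= n)%N -> uqKi R n m k *: t z = Q (- gt_a (shift v z) k) *' t z.
Proof. by case: (V_gt.2 z) => _ h _ _ /h. Qed.

Lemma actE k z : (1 <= k < n)%N ->
  uqE R n m k *: t z = - \sum_(1 <= j < k.+1) cE k j z *' t (z + dl n k j).
Proof.
case: (V_gt.2 z) => _ _ h _ hk; rewrite h //; congr (- _); apply: eq_bigr => j _.
by rewrite shiftD_dl //; case/andP: hk.
Qed.

Lemma actF k z : (1 <= k < n)%N ->
  uqF R n m k *: t z = \sum_(1 <= j < k.+1) cF k j z *' t (z - dl n k j).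
Proof.
case: (V_gt.2 z) => _ _ _ h hk; rewrite h //; apply: eq_bigr => j _.
by rewrite shiftB_dl //; case/andP: hk.
Qed.

Definition wt z k j : C := ent (shift v z) k j.

Lemma wtE z k j : wt z k j = ent v k j + (e z k j)%:~R.
Proof. exact: ent_shift. Qed.

Definition cong z z' k j : bool := (m %| e z k j - e z' k j)%Z.

Lemma cong_sym z z' k j : cong z z' k j = cong z' z k j.
Proof. by rewrite /cong -opprB rpredN. Qed.
Lemma wt_cong z z' k j : cong z z' k j -> exists a : int, wt z' k j = wt z k j + m%:R *~ a.
Proof.
rewrite cong_sym => /dvdzP [a ha]; exists a; rewrite !wtE -addrA; congr (_ + _).
by rewrite -[e z' k j](subrK (e z k j)) ha addrC intrD intrM mulrzl.
Qed.

Lemma Qwt_cong z z' k j : cong z z' k j -> Q (wt z' k j) = Q (wt z k j).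
Proof. by move=> /wt_cong [a ->]; rewrite qpowDm. Qed.

Lemma qn_cong z z' k j k' j' x : cong z z' k j -> cong z z' k' j' ->
  qn (wt z' k j - wt z' k' j' + x) = qn (wt z k j - wt z k' j' + x).
Proof.
move=> /wt_cong [a ->] /wt_cong [b ->]; rewrite -[RHS](qnumDm m_ge3 _ (a - b)).
by rewrite mulrzBr; congr qnum; ring.
Qed.

Lemma qn_cong0 z z' k j k' j' : cong z z' k j -> cong z z' k' j' ->
  qn (wt z' k j - wt z' k' j') = qn (wt z k j - wt z k' j').
Proof. by move=> h h'; have := qn_cong 0 h h'; rewrite !addr0. Qed.

Definition rowcong k z z' := forall j, (1 <= j <= k)%N -> cong z z' k j.

Lemma denom_cong k j z z' : (1 <= j <= k)%N -> rowcong k z z' ->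
  gt_denom m (shift v z') k j = gt_denom m (shift v z) k j.
Proof.
move=> hj h; rewrite /gt_denom big_nat_cond [RHS]big_nat_cond; apply: eq_bigr => i.
by rewrite ltnS => /andP[hi _]; apply: qn_cong0; apply: h.
Qed.

Lemma cE_cong k j z z' : (1 <= j <= k)%N -> rowcong k z z' -> rowcong k.+1 z z' ->
  cE k j z' = cE k j z.
Proof.
move=> hj h h'; rewrite /cE /gt_coefE (denom_cong hj h); congr (_ / _).
rewrite big_nat_cond [RHS]big_nat_cond; apply: eq_bigr => i.
by rewrite ltnS => /andP[hi _]; apply: qn_cong0; [apply: h|apply: h'].
Qed.

Lemma cF_cong k j z z' : (1 <= j <= k)%N -> rowcong k z z' -> rowcong k.-1 z z' ->
  cF k j z' = cF k j z.
Proof.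
move=> hj h h'; rewrite /cF /gt_coefF (denom_cong hj h); congr (_ / _).
rewrite big_nat_cond [RHS]big_nat_cond; apply: eq_bigr => i /andP[hi _].
by apply: qn_cong0; [apply: h|apply: h'; lia].
Qed.

Lemma Qgt_a_cong k z z' : rowcong k z z' -> rowcong k.-1 z z' ->
  Q (gt_a (shift v z') k) = Q (gt_a (shift v z) k).
Proof.
have Qsum K w (a b : nat) : Q (\sum_(a <= i < b) wt w K i) = \prod_(a <= i < b) Q (wt w K i).
  by elim/big_ind2: _ => //; [exact: qpow0|move=> x y x' y' <- <-; rewrite qpowD].
move=> h h'; rewrite /gt_a !qpowD !qpowN -!/(wt _ _ _) !Qsum; congr (_ / _ * _).
  rewrite big_nat_cond [RHS]big_nat_cond; apply: eq_bigr => i.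
  by rewrite ltnS => /andP[hi _]; apply: Qwt_cong; apply: h.
rewrite big_nat_cond [RHS]big_nat_cond; apply: eq_bigr => i /andP[hi _].
by apply: Qwt_cong; apply: h'; lia.
Qed.

Lemma wt_diff_inZ z a b i j (c : int) : (1 <= b <= a)%N -> (a <= n)%N ->
  (1 <= j <= i)%N -> (i <= n)%N -> qn (wt z a b - wt z i j + c%:~R) = 0 ->
  in_Z (ent v a b - ent v i j).
Proof.
move=> h1 h2 h3 h4 /(qnum_half m_ge3 m_odd) [x hx].
case: (v_A h1 h2 h3 h4) => // hh; case: hh.
exists (x + 2 * (e z i j - e z a b - c)).
move: hx; rewrite !wtE => hx.
have -> : ent v a b - ent v i j = ent v a b + (e z a b)%:~R - (ent v i j + (e z i j)%:~R) + c%:~R +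
  (e z i j - e z a b - c)%:~R.
  by rewrite !intrD !rmorphN /=; ring.
rewrite hx [in RHS]intrD intrM mulrDl; congr (_ + _).
by rewrite mulrAC mulfV ?mul1r // pnatr_eq0.
Qed.

Lemma generic_neq0 z k i j (c : int) : (1 <= k < n)%N -> (1 <= i <= k)%N -> (1 <= j <= k)%N ->
  i != j -> qn (wt z k i - wt z k j + c%:~R) != 0.
Proof.
move=> hk hi hj ij; apply/eqP => /wt_diff_inZ h; have hkn : (k <= n)%N by case/andP: hk => _ /ltnW.
have [a ha] := h hi hkn hj hkn; apply: (v_generic hk hi hj ij); exists (2 * a).
by rewrite ha intrM mulrAC mulfV ?mul1r // pnatr_eq0.
Qed.

Lemma denom_neq0 k j z : (1 <= k < n)%N -> (1 <= j <= k)%N -> gt_denom m (shift v z) k j != 0.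
Proof.
move=> hk hj; rewrite /gt_denom big_seq_cond prodf_seq_neq0; apply/allP => i.
rewrite mem_index_iota ltnS => hi; apply/implyP => /andP[_ ij].
by have := generic_neq0 z 0 hk hj hi; rewrite addr0 eq_sym; apply.
Qed.

Definition lk k j : bool := (1 <= j < k)%N && (ent v k j == ent v k.-1 j).

Lemma inZ_lk k i j : (2 <= k <= n)%N -> (1 <= i < k)%N -> (1 <= j <= k)%N ->
  in_Z (ent v k j - ent v k.-1 i) -> lk k i /\ ((k < n)%N -> j = i).
Proof.
move=> /andP[k2 kn] hi hj hZ; have hi' : (1 <= i <= k.-1)%N by case: k k2 {kn hj hZ} hi.
have ex : exists j, integral_cols v k i j by exists j.
case: v_B => B1 B2; move: kn; rewrite leq_eqVlt => /orP[/eqP kn|kn].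
  subst k; rewrite ltnn; split=> //; rewrite /lk hi; apply/eqP; exact: (B2 _ hi' ex).
have kk : (2 <= k < n)%N by rewrite k2.
have [h1 h2] := B1 k i kk hi' ex; split; first by rewrite /lk hi h2 eqxx.
by move=> _; apply/h1.
Qed.

Lemma lk_dvd k j z (c : int) : lk k j -> (qn (wt z k j - wt z k.-1 j + c%:~R) == 0) =
  (m %| e z k j - e z k.-1 j + c)%Z.
Proof.
move=> /andP[_ /eqP h]; rewrite !wtE h -(qnum_int_eq0 R m_ge3 m_odd).
by congr (qnum _ _ == 0); rewrite !rmorphD rmorphN /=; ring.
Qed.

Lemma lk_dvdN k j z (c : int) : lk k j -> (qn (wt z k.-1 j - wt z k j + c%:~R) == 0) =
  (m %| e z k.-1 j - e z k j + c)%Z.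
Proof.
move=> /andP[_ /eqP h]; rewrite !wtE h -(qnum_int_eq0 R m_ge3 m_odd).
by congr (qnum _ _ == 0); rewrite !rmorphD rmorphN /=; ring.
Qed.

Lemma cF_eq0 k j z : (1 <= k < n)%N -> (1 <= j <= k)%N ->
  (cF k j z == 0) = lk k j && (m %| e z k j - e z k.-1 j)%Z.
Proof.
move=> hk hj; rewrite /cF /gt_coefF mulf_eq0 invr_eq0 (negbTE (denom_neq0 z hk hj)) orbF.
apply/idP/idP => [|/andP[h1 h2]].
  rewrite prodf_seq_eq0 => hh; case: (elimT (seq.hasP) hh) => i; rewrite mem_index_iota /= => hi /eqP h0.
  have k2 : (2 <= k <= n)%N by lia.
  have hZ : in_Z (ent v k j - ent v k.-1 i).
    by apply: (@wt_diff_inZ z _ _ _ _ 0); rewrite ?addr0 //; lia.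
  have [h1 h2] := inZ_lk k2 hi hj hZ; have ji : j = i by apply: h2; case/andP: hk.
  by subst i; rewrite h1; have := lk_dvd z 0 h1; rewrite !addr0 => <-; apply/eqP.
rewrite prodf_seq_eq0; apply/seq.hasP; exists j.
  by rewrite mem_index_iota; case/andP: h1.
by have := lk_dvd z 0 h1; rewrite !addr0 h2.
Qed.

Lemma cE_eq0 k j z : (1 <= k < n)%N -> (1 <= j <= k)%N ->
  lk k.+1 j -> (m %| e z k j - e z k.+1 j)%Z -> cE k j z = 0.
Proof.
move=> hk hj h1 h2; apply/eqP; rewrite /cE /gt_coefE mulf_eq0; apply/orP; left.
rewrite prodf_seq_eq0; apply/seq.hasP; exists j; first by rewrite mem_index_iota; lia.
by have := lk_dvdN z 0 h1; rewrite !addr0 h2.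
Qed.

Lemma cE_neq0 k j z : (1 <= k < n)%N -> (1 <= j <= k)%N ->
  (lk k.+1 j -> (k.+1 < n)%N && ~~ (m %| e z k j - e z k.+1 j)%Z) -> cE k j z != 0.
Proof.
move=> hk hj h; rewrite /cE /gt_coefE mulf_eq0 invr_eq0 (negbTE (denom_neq0 z hk hj)) orbF.
apply/negP; rewrite prodf_seq_eq0 => hh; case: (elimT (seq.hasP) hh) => i; rewrite mem_index_iota /= => hi /eqP h0.
have [x hx] : in_Z (ent v k j - ent v k.+1 i).
  by apply: (@wt_diff_inZ z _ _ _ _ 0); rewrite ?addr0 //; lia.
have hZ : in_Z (ent v k.+1 i - ent v k.+1.-1 j).
  by exists (- x); rewrite rmorphN /= -hx opprB.
have h2 : (2 <= k.+1 <= n)%N by lia.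
have hj' : (1 <= j < k.+1)%N by lia.
have hi' : (1 <= i <= k.+1)%N by lia.
have [h1 h3] := inZ_lk h2 hj' hi' hZ.
have /andP[h4 h5] := h h1; have ij := h3 h4; subst i.
by move: h5; have := lk_dvdN z 0 h1; rewrite !addr0 => <-; rewrite /= /wt h0 eqxx.
Qed.

Definition gen_by K (u : U) : Prop := forall d : U,
  (forall i, (1 <= i < K)%N -> GRing.comm d (uqE R n m i) /\ GRing.comm d (uqF R n m i)) ->
  (forall i, (1 <= i <= K)%N -> GRing.comm d (uqK R n m i)) -> GRing.comm d u.

Lemma gen_byD K x y : gen_by K x -> gen_by K y -> gen_by K (x + y).
Proof. by move=> hx hy d h1 h2; apply: commrD; [apply: hx|apply: hy]. Qed.
Lemma gen_byM K x y : gen_by K x -> gen_by K y -> gen_by K (x * y).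
Proof. by move=> hx hy d h1 h2; apply: commrM; [apply: hx|apply: hy]. Qed.
Lemma gen_byA K c : gen_by K c%:A.
Proof. by move=> d _ _; rewrite /GRing.comm mulr_algr mulr_algl. Qed.
Lemma gen_byE K i : (1 <= i < K)%N -> gen_by K (uqE R n m i).
Proof. by move=> hi d h _; case: (h i hi). Qed.
Lemma gen_byF K i : (1 <= i < K)%N -> gen_by K (uqF R n m i).
Proof. by move=> hi d h _; case: (h i hi). Qed.
Lemma gen_byK K i : (1 <= i <= K)%N -> gen_by K (uqK R n m i).
Proof. by move=> hi d _ h; exact: (h i hi). Qed.
Lemma gen_byW K K' u : (K <= K')%N -> gen_by K u -> gen_by K' u.
Proof.
move=> hK hu d h1 h2; apply: hu => i hi; first by apply: h1; lia.
by apply: h2; lia.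
Qed.

Definition mm := m.-1.
Lemma mmE : mm.+1 = m. Proof. by rewrite /mm; case: m m_ge3. Qed.

Definition cl K z : {ffun position n -> 'I_mm.+1} :=
  [ffun p : position n => if ((val p).1 <= K)%N
     then inord `|(e z (val p).1 (val p).2 %% m)%Z|%N else ord0].

Lemma clP K z z' : (K < n)%N ->
  reflect (forall k j, (1 <= j <= k)%N -> (k <= K)%N -> cong z z' k j) (cl K z == cl K z').
Proof.
move=> hK; have m0 : (m%:Z != 0) by case: m m_ge3.
have ltm x : (`|(x %% m)%Z|%N < mm.+1)%N.
  by rewrite mmE -ltz_nat gez0_abs ?modz_ge0 // ltz_pmod //; case: m m_ge3.
apply: (iffP eqP) => [h k j hj hk|h].
  have hkn : (k <= n)%N by lia.
  move/ffunP/(_ (posn hj hkn)): h; rewrite !ffunE /= !inordK ?ltnS //; last first.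
    by case/andP: hj => _ hj; apply: leq_trans hj hkn.
  rewrite hk => /(congr1 val); rewrite /= !inordK // => h.
  rewrite /cong -eqz_mod_dvd; apply/eqP.
  by rewrite -[LHS]gez0_abs ?modz_ge0 // -[RHS]gez0_abs ?modz_ge0 // h.
apply/ffunP => p; have [k [j [h1 [h2 ->]]]] := posnP p; rewrite !ffunE /=.
have hjn : (j <= n)%N by lia.
rewrite !inordK ?ltnS //; case: ifP => // hk; congr (inord `|_|%N).
by apply/eqP; rewrite eqz_mod_dvd; apply: h.
Qed.

Lemma cl_row K z z' k : (K < n)%N -> cl K z = cl K z' -> (k <= K)%N -> rowcong k z z'.
Proof. by move=> hK /eqP /(clP _ _ hK) h hk j hj; apply: h. Qed.

Lemma cl_le K K' z z' : (K' <= K < n)%N -> cl K z = cl K z' -> cl K' z = cl K' z'.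
Proof.
move=> /andP[h1 h2] /eqP /(clP _ _ h2) h; apply/eqP/clP; first by lia.
by move=> k j hj hk; apply: h => //; lia.
Qed.

Lemma rowcong_top z z' : rowcong n z z'.
Proof. by move=> j /andP[_ hj]; rewrite /cong !etop // subrr dvdz0. Qed.

Lemma clD K z z' d : (K < n)%N -> (cl K (z + d) == cl K (z' + d)) = (cl K z == cl K z').
Proof.
move=> hK; apply/clP/clP => // h k j hj hk; have := h k j hj hk; rewrite /cong !eD.
  by rewrite opprD addrACA subrr addr0.
by rewrite opprD addrACA subrr addr0.
Qed.

Lemma cl_dl K z k j j' : (1 <= k <= K)%N -> (K < n)%N -> (1 <= j <= k)%N -> (1 <= j' <= k)%N ->
  (cl K (z - dl n k j') == cl K (z - dl n k j)) = (j' == j).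
Proof.
move=> hk hK hj hj'; apply/idP/eqP => [/clP h|->]; last exact: eqxx.
have kn : (k < n)%N by lia.
have hkK : (k <= K)%N by lia.
have := h hK k j hj hkK; rewrite /cong !eD !eN !e_dl // !eqxx /=.
case: (eqVneq j' j) => // jj'; rewrite /= opprD opprK.
have -> : e z k j - 0%:R + (- e z k j + 1%:R) = 1 :> int by ring.
by rewrite dvdz1 => /eqP; lia.
Qed.

Lemma cl_dlD K z k j j' : (1 <= k <= K)%N -> (K < n)%N -> (1 <= j <= k)%N -> (1 <= j' <= k)%N ->
  (cl K (z + dl n k j') == cl K (z + dl n k j)) = (j' == j).
Proof.
move=> hk hK hj hj'; rewrite -(clD _ _ (- dl n k j - dl n k j')) //.
have -> : z + dl n k j' + (- dl n k j - dl n k j') = z - dl n k j.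
  by rewrite [- dl n k j - _]addrC addrA addrK.
rewrite addrA addrK.
by rewrite cl_dl // eq_sym.
Qed.

Definition diag (u : U) (chi : L -> C) := forall z, u *: t z = chi z *' t z.

Definition clinv K (chi : L -> C) := forall z z', cl K z = cl K z' -> chi z = chi z'.

Definition sepd K z0 z1 := exists u chi,
  [/\ gen_by K u, diag u chi, clinv K chi & chi z0 != chi z1].

Lemma diagM u u' chi chi' : diag u chi -> diag u' chi' -> diag (u * u') (fun z => chi z * chi' z).
Proof. by move=> h h' z; rewrite -scalerA h' scC h scA mulrC. Qed.

Definition isproj K z0 u := gen_by K u /\
  forall z, u *: t z = (cl K z == cl K z0)%:R *' t z.

Lemma proj_of_sep K z0 : (forall z1, cl K z1 != cl K z0 -> sepd K z0 z1) ->
  exists u, isproj K z0 u.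
Proof.
move=> h.
have h1 (ka : {ffun position n -> 'I_mm.+1}) : exists u, gen_by K u /\ exists chi,
    [/\ diag u chi, (forall z, cl K z = cl K z0 -> chi z = 1) &
     (forall z, cl K z = ka -> ka != cl K z0 -> chi z = 0)].
  case: (pselect (exists z1, cl K z1 = ka /\ ka != cl K z0)) => [[z1 [zk ne]]|no].
    have [u [chi [g d ci ne2]]] := h z1 (etrans (congr1 (fun x => x != _) zk) ne).
    have s0 : chi z0 - chi z1 != 0 by rewrite subr_eq0.
    exists ((chi z0 - chi z1)^-1%:A * (u + (- chi z1)%:A)); split.
      by apply: gen_byM; [apply: gen_byA|apply: gen_byD => //; apply: gen_byA].
    exists (fun z => (chi z0 - chi z1)^-1 * (chi z - chi z1)); split.
    - by move=> z; rewrite -scalerA scalerDl d -scDl scA.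
    - by move=> z hz; rewrite (ci _ _ hz) mulVf.
    - by move=> z hz _; rewrite (ci z z1) ?hz // subrr mulr0.
  exists 1%:A; split; first exact: gen_byA.
  exists (fun=> 1); split=> // z hz ne; case: no; by exists z.
have h2 (s : seq {ffun position n -> 'I_mm.+1}) : exists u, gen_by K u /\ exists chi,
    [/\ diag u chi, (forall z, cl K z = cl K z0 -> chi z = 1) &
     (forall z, cl K z \in s -> cl K z != cl K z0 -> chi z = 0)].
  elim: s => [|ka s [u [g [chi [d d1 d0]]]]].
    exists 1%:A; split; first exact: gen_byA.
    by exists (fun=> 1).
  have [u' [g' [chi' [d' d1' d0']]]] := h1 ka; exists (u' * u); split; first exact: gen_byM.
  exists (fun z => chi' z * chi z); split; first exact: diagM.
    by move=> z hz; rewrite d1 // d1' // mulr1.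
  move=> z; rewrite inE => /orP[/eqP hz ne|hz ne]; last by rewrite d0 ?mulr0.
  by rewrite (d0' z) ?mul0r // -hz.
have [u [g [chi [d d1 d0]]]] := h2 (enum {ffun position n -> 'I_mm.+1}).
exists u; split=> // z; rewrite d; case: eqP => [/d1 -> //|/eqP ne].
by rewrite d0 // mem_enum.
Qed.

Lemma big_pick (A : nmodType) (F : nat -> A) j k : (1 <= j <= k)%N ->
  (forall i, (1 <= i <= k)%N -> i != j -> F i = 0) -> \sum_(1 <= i < k.+1) F i = F j.
Proof.
move=> hj h; rewrite (bigD1_seq j) /= ?mem_index_iota ?iota_uniq ?ltnS //.
rewrite big_seq_cond big1 ?addr0 // => i; rewrite mem_index_iota ltnS => /andP[hi ne].
exact: h.
Qed.

Lemma act3 (x y w : U) (s : V) : (x * y * w) *: s = x *: (y *: (w *: s)).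
Proof. by rewrite -!scalerA. Qed.

Lemma stepF_op K k j z0 : (1 <= k <= K)%N -> (K < n)%N -> (1 <= j <= k)%N ->
  (forall z, exists u, isproj K z u) ->
  exists u, gen_by K.+1 u /\
  forall z, u *: t z = ((cl K z == cl K z0)%:R * cF k j z) *' t (z - dl n k j).
Proof.
move=> hk hK hj hp; have [u [g hu]] := hp z0; have [u' [g' hu']] := hp (z0 - dl n k j).
have kn : (1 <= k < n)%N by lia.
exists (u' * uqF R n m k * u); split.
  apply: gen_byM; last by apply: gen_byW g.
  by apply: gen_byM; [apply: gen_byW g'|apply: gen_byF].
move=> z; rewrite act3 hu scC (actF z kn); case: eqP => hz; last by rewrite mul0r !sc0 scaler0.
rewrite mul1r sc1 scaler_sumr (@big_pick _ _ j k) //.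
  by rewrite scC hu' clD // hz eqxx sc1.
move=> i hi ij; rewrite scC hu'.
have -> : cl K (z - dl n k i) = cl K (z0 - dl n k i) by apply/eqP; rewrite clD // hz.
by rewrite cl_dl // (negbTE ij) sc0 scx0.
Qed.

Lemma stepE_op K k j z0 : (1 <= k <= K)%N -> (K < n)%N -> (1 <= j <= k)%N ->
  (forall z, exists u, isproj K z u) ->
  exists u, gen_by K.+1 u /\
  forall z, u *: t z = ((cl K z == cl K z0)%:R * cE k j z) *' t (z + dl n k j).
Proof.
move=> hk hK hj hp; have [u [g hu]] := hp z0; have [u' [g' hu']] := hp (z0 + dl n k j).
have kn : (1 <= k < n)%N by lia.
exists ((-1)%:A * (u' * uqE R n m k * u)); split.
  apply: gen_byM; first exact: gen_byA.
  apply: gen_byM; last by apply: gen_byW g.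
  by apply: gen_byM; [apply: gen_byW g'|apply: gen_byE].
move=> z; rewrite -[LHS]scalerA act3 hu scC (actE z kn); case: eqP => hz; last by rewrite mul0r !sc0 !scaler0.
rewrite mul1r sc1 scalerN scaler_sumr (@big_pick _ _ j k) //.
  by rewrite scC hu' clD // hz eqxx sc1 scN sc1 opprK.
move=> i hi ij; rewrite scC hu'.
have -> : cl K (z + dl n k i) = cl K (z0 + dl n k i) by apply/eqP; rewrite clD // hz.
by rewrite cl_dlD // (negbTE ij) sc0 scx0.
Qed.

Lemma Qsum (K : nat) z (a b : nat) :
  Q (\sum_(a <= i < b) wt z K i) = \prod_(a <= i < b) Q (wt z K i).
Proof.
by elim/big_ind2: _ => //; [exact: qpow0|move=> x y x' y' <- <-; rewrite qpowD].
Qed.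

Lemma qnQ (a a' b : C) : Q a = Q a' -> qn (a - b) = qn (a' - b).
Proof. by move=> h; rewrite !qnumE !opprB !qpowB h. Qed.

Definition rowpoly k z : {poly C} := \prod_(1 <= i < k.+1) ('X - (Q (wt z k i *+ 2))%:P).

Lemma rowpoly_monic k z : rowpoly k z \is monic.
Proof. by apply: monic_prod => i _; apply: monicXsubC. Qed.

Lemma size_rowpoly k z : size (rowpoly k z) = k.+1.
Proof. by rewrite /rowpoly size_prod_XsubC size_iota subn1. Qed.

Lemma rowpolyE k z (y : C) : (rowpoly k z).[Q (y *+ 2)] =
  (\prod_(1 <= i < k.+1) Q (wt z k i)) * (\prod_(1 <= i < k.+1) ((q - q^-1) * Q y)) *
  \prod_(1 <= i < k.+1) qn (y - wt z k i).
Proof.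
rewrite /rowpoly horner_prod -!big_split /=; apply: eq_bigr => i _.
rewrite /= hornerXsubC qnumE opprB !qpowB !mulr2n !qpowD.
have := qlam_neq0 R m_ge3 m_odd; set lam := q - q^-1.
move: (Q y) (Q (wt z k i)) (qpow_neq0 m y) (qpow_neq0 m (wt z k i)).
by move=> A B A0 B0 l0; field; rewrite A0 B0 l0.
Qed.

Lemma rowpoly0 k z : (rowpoly k z).[0] =
  \prod_(1 <= i < k.+1) (- 1) * (\prod_(1 <= i < k.+1) Q (wt z k i)) ^+ 2.
Proof.
rewrite /rowpoly horner_prod expr2 -!big_split /=; apply: eq_bigr => i _.
by rewrite /= hornerXsubC mulr2n qpowD; ring.
Qed.

Lemma size_monicB (p p' : {poly C}) k : p \is monic -> p' \is monic ->
  size p = k.+1 -> size p' = k.+1 -> (size (p - p')%R <= k)%N.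
Proof.
move=> /monicP m1 /monicP m2 s1 s2; apply/leq_sizeP => i; rewrite leq_eqVlt coefB.
case/orP => [/eqP <-|hi]; last by rewrite !nth_default ?s1 ?s2 // subrr.
by move: m1 m2; rewrite !lead_coefE s1 s2 /= => -> ->; rewrite subrr.
Qed.

Lemma wtB_dl z k j i a : (k < n)%N -> (1 <= i <= a)%N -> (a <= n)%N ->
  wt (z - dl n k j) a i = wt z a i - ((a == k) && (i == j))%:R.
Proof.
move=> hk hi ha; rewrite !wtE eD eN e_dl_le // intrD addrA.
by case: (_ && _); rewrite ?rmorphN /= ?oppr0 ?addr0.
Qed.

Lemma rowcong_dl k a j z z' : rowcong a z z' -> rowcong a (z + dl n k j) (z' + dl n k j).
Proof. by move=> h i hi; have := h i hi; rewrite /cong !eD opprD addrACA subrr addr0. Qed.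

Lemma rowcongB_dl k a j z z' : rowcong a z z' -> rowcong a (z - dl n k j) (z' - dl n k j).
Proof. by move=> h i hi; have := h i hi; rewrite /cong !eD !eN opprD addrACA subrr addr0. Qed.

Lemma sep_succ K z0 z1 : (K.+1 < n)%N -> (forall z, exists u, isproj K z u) ->
  cl K.+1 z1 != cl K.+1 z0 -> sepd K.+1 z0 z1.
Proof.
move=> hK hp ne; apply: contrapT => nsep.
have hK' : (K < n)%N by lia.
have eqs u chi : gen_by K.+1 u -> diag u chi -> clinv K.+1 chi -> chi z0 = chi z1.
  by move=> h1 h2 h3; apply/eqP/negPn/negP => h4; apply: nsep; exists u, chi.
have cK : cl K z0 = cl K z1.
  have [u [g hu]] := hp z0.
  have := eqs u (fun z => (cl K z == cl K z0)%:R) (gen_byW (leqnSn K) g) hu.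
  rewrite eqxx; case: eqP => // _ h; have /eqP : 1 = 0 :> C; last by rewrite oner_eq0.
  by apply: h => x y hxy; rewrite (@cl_le K.+1 K x y _ hxy) // leqnSn.
have rc k : (k <= K)%N -> rowcong k z0 z1 by move=> hk; apply: (cl_row hK' cK).
have prodQ : \prod_(1 <= i < K.+2) Q (wt z0 K.+1 i) = \prod_(1 <= i < K.+2) Q (wt z1 K.+1 i).
  have := eqs (uqK R n m K.+1) (fun z => Q (gt_a (shift v z) K.+1)).
  rewrite /diag => /(_ (@gen_byK K.+1 K.+1 _)) h.
  have {}h : Q (gt_a (shift v z0) K.+1) = Q (gt_a (shift v z1) K.+1).
    apply: h; first by lia.
      by move=> z; apply: actK; lia.
    by move=> x y hxy; apply: Qgt_a_cong; apply: (cl_row hK (esym hxy)).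
  move: h; rewrite /gt_a !qpowD !qpowN -!/(wt _ _ _) !Qsum => /mulIf.
  have -> : \prod_(1 <= i < K.+1) Q (ent (shift v z1) K.+1.-1 i) =
            \prod_(1 <= i < K.+1) Q (ent (shift v z0) K.+1.-1 i).
    rewrite big_nat_cond [RHS]big_nat_cond; apply: eq_bigr => i /andP[hi _].
    by apply: Qwt_cong; apply: rc.
  move=> /(_ (qpow_neq0 m _)) /mulIf; apply; rewrite invr_eq0 prodf_seq_neq0.
  by apply/allP => i _; rewrite qpow_neq0.
pose eps j : C := if cF K j z0 != 0 then 1 else 0.
pose node j : C := Q ((wt z0 K j - eps j) *+ 2).
have eqnode j : (1 <= j <= K)%N -> (rowpoly K.+1 z0).[node j] = (rowpoly K.+1 z1).[node j].
  move=> hj; rewrite !rowpolyE prodQ; congr (_ * _).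
  have hk : (1 <= K <= K)%N by lia.
  have hkn : (1 <= K < n)%N by lia.
  rewrite /eps; case: (eqVneq (cF K j z0) 0) => f0 /=.
    have f1 : cF K j (z0 + dl n K j) != 0.
      move/eqP: f0; rewrite !cF_eq0 // => /andP[l d].
      have /andP[jK _] := l; rewrite l /= !eD !e_dl_le ?eqxx; try by lia.
      have -> : (K.-1 == K) = false by lia.
      apply/negP => d'; move: (rpredB d' d) => /=; rewrite addr0.
      have -> : e z0 K j + true%:R - e z0 K.-1 j - (e z0 K j - e z0 K.-1 j) = 1 :> int by rewrite /=; ring.
      by rewrite dvdz1 => /eqP; lia.
    have [u [g hu]] := stepE_op z0 hk hK' hj hp.
    have [u' [g' hu']] := stepF_op (z0 + dl n K j) hk hK' hj hp.
    have := eqs (u' * u) (fun z => ((cl K z == cl K z0)%:R * cE K j z) *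
      ((cl K (z + dl n K j) == cl K (z0 + dl n K j))%:R * cF K j (z + dl n K j))) (gen_byM g' g).
    rewrite !eqxx !mul1r cK eqxx (_ : cl K (z1 + dl n K j) == cl K (z0 + dl n K j)); last first.
      by rewrite clD // cK.
    rewrite !mul1r => h.
    have {}h : cE K j z0 * cF K j (z0 + dl n K j) = cE K j z1 * cF K j (z1 + dl n K j).
      apply: h => [z|x y hxy]; first by rewrite -[LHS]scalerA hu scC hu' scA addrK cK.
      have cxy : cl K x = cl K y by apply: (@cl_le K.+1 K x y _ hxy); rewrite leqnSn.
      have rxy a : (a <= K.+1)%N -> rowcong a y x by move=> ha; apply: (cl_row hK (esym hxy)).
      rewrite cxy (@cE_cong K j y x) //; try by apply: rxy; lia.
      rewrite (@cF_cong K j (y + dl n K j) (x + dl n K j)) //; try by apply: rowcong_dl; apply: rxy; lia.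
      by rewrite (eqP (_ : cl K (x + dl n K j) == cl K (y + dl n K j))) // clD // cxy.
    have F1 : cF K j (z1 + dl n K j) = cF K j (z0 + dl n K j).
      by apply: cF_cong => //; apply: rowcong_dl; apply: rc; lia.
    move: h; rewrite F1 => /(mulIf f1); rewrite /cE /gt_coefE.
    rewrite (denom_cong (z := z0) (z' := z1)) //; last by apply: rc.
    rewrite !subr0 => /mulIf; rewrite invr_eq0 denom_neq0 // => /(_ isT) ->.
    rewrite big_nat_cond [RHS]big_nat_cond; apply: eq_bigr => i /andP[hi _].
    by apply: qnQ; apply: Qwt_cong; apply: rc.
  have [u [g hu]] := stepF_op z0 hk hK' hj hp.
  have [u' [g' hu']] := stepE_op (z0 - dl n K j) hk hK' hj hp.
  have := eqs (u' * u) (fun z => ((cl K z == cl K z0)%:R * cF K j z) *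
    ((cl K (z - dl n K j) == cl K (z0 - dl n K j))%:R * cE K j (z - dl n K j))) (gen_byM g' g).
  rewrite !eqxx !mul1r cK eqxx (_ : cl K (z1 - dl n K j) == cl K (z0 - dl n K j)); last first.
    by rewrite clD // cK.
  rewrite !mul1r => h.
  have {}h : cF K j z0 * cE K j (z0 - dl n K j) = cF K j z1 * cE K j (z1 - dl n K j).
    apply: h => [z|x y hxy]; first by rewrite -[LHS]scalerA hu scC hu' scA subrK cK.
    have cxy : cl K x = cl K y by apply: (@cl_le K.+1 K x y _ hxy); rewrite leqnSn.
    have rxy a : (a <= K.+1)%N -> rowcong a y x by move=> ha; apply: (cl_row hK (esym hxy)).
    rewrite cxy (@cF_cong K j y x) //; try by apply: rxy; lia.
    rewrite (@cE_cong K j (y - dl n K j) (x - dl n K j)) //; try by apply: rowcongB_dl; apply: rxy; lia.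
    by rewrite (eqP (_ : cl K (x - dl n K j) == cl K (y - dl n K j))) // clD // cxy.
  have F1 : cF K j z1 = cF K j z0 by apply: cF_cong => //; apply: rc; lia.
  move: h; rewrite F1 => /(mulfI f0); rewrite /cE /gt_coefE.
  rewrite (@denom_cong K j (z0 - dl n K j) (z1 - dl n K j)) //; last by apply: rowcongB_dl; apply: rc.
  move=> /mulIf; rewrite invr_eq0 denom_neq0 // => /(_ isT).
  have num z : \prod_(1 <= i < K.+2) qn (ent (shift v (z - dl n K j)) K j - ent (shift v (z - dl n K j)) K.+1 i)
      = \prod_(1 <= i < K.+2) qn (wt z K j - 1 - wt z K.+1 i).
    apply: eq_big_nat => i hi; rewrite -!/(wt _ _ _) !wtB_dl ?eqxx; try lia.
    have -> : (K.+1 == K) = false by lia.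
    by rewrite subr0.
  rewrite (num z0) (num z1).
  move=> ->; apply: eq_big_nat => i hi; apply: qnQ; rewrite !qpowB; congr (_ / _).
  by apply: Qwt_cong; apply: rc.
have nodeI i j : (1 <= i <= K)%N -> (1 <= j <= K)%N -> node i = node j -> i = j.
  move=> hi hj hij; apply/eqP/negPn/negP => ij.
  have hkn : (1 <= K < n)%N by lia.
  have [c hc] : exists c : int, eps j - eps i = c%:~R.
    by rewrite /eps; do 2!case: ifP => _; [exists 0|exists 1|exists (-1)|exists 0]; rewrite ?subrr ?sub0r ?subr0 ?rmorphN.
  have := generic_neq0 z0 c hkn hi hj ij; rewrite qnum_eq0 //; case/eqP.
  have -> : (wt z0 K i - wt z0 K j + c%:~R) = (wt z0 K i - eps i) - (wt z0 K j - eps j).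
    by rewrite -hc; ring.
  by rewrite mulrnBl qpowB -/(node i) -/(node j) hij divff // /node qpow_neq0.
have eqP0 : rowpoly K.+1 z0 = rowpoly K.+1 z1.
  apply/eqP; rewrite -subr_eq0; apply/eqP.
  apply: (@roots_geq_poly_eq0 _ _ (0 :: [seq node j | j <- iota 1 K])).
  - rewrite /= {1}/root hornerD hornerN !rowpoly0 prodQ subrr eqxx /=.
    apply/allP => x /mapP [j]; rewrite mem_iota => hj ->.
    by rewrite /root hornerD hornerN eqnode ?subrr //; lia.
  - rewrite /= map_inj_in_uniq ?iota_uniq ?andbT.
      by apply/negP => /mapP [j _ /esym/eqP]; rewrite /node (negbTE (qpow_neq0 m _)).
    by move=> i j; rewrite !mem_iota => hi hj; apply: nodeI; lia.
  - by rewrite /= size_map size_iota; apply: size_monicB; rewrite ?rowpoly_monic ?size_rowpoly.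
case/negP: ne; apply/clP => // k j hj; rewrite leq_eqVlt => /orP[/eqP kK|hk]; last first.
  by rewrite cong_sym; apply: rc; rewrite // -ltnS.
subst k; have : root (rowpoly K.+1 z1) (Q (wt z0 K.+1 j *+ 2)).
  rewrite -eqP0 /rowpoly (bigD1_seq j) ?mem_index_iota ?ltnS ?iota_uniq //=.
  by rewrite rootM root_XsubC eqxx.
rewrite rootE /rowpoly horner_prod prodf_seq_eq0 => hh; case: (elimT (seq.hasP) hh) => i.
rewrite mem_index_iota ltnS /= hornerXsubC subr_eq0 => hi /eqP hij.
have w1 : wt z1 K.+1 i = wt z0 K.+1 i + (e z1 K.+1 i - e z0 K.+1 i)%:~R.
  by rewrite !wtE intrD rmorphN /=; ring.
have q0 : qn (wt z0 K.+1 j - wt z0 K.+1 i + (e z0 K.+1 i - e z1 K.+1 i)%:~R) = 0.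
  apply/eqP; rewrite qnum_eq0 //.
  have -> : wt z0 K.+1 j - wt z0 K.+1 i + (e z0 K.+1 i - e z1 K.+1 i)%:~R = wt z0 K.+1 j - wt z1 K.+1 i.
    by rewrite w1 !intrD !rmorphN /=; ring.
  by rewrite mulrnBl qpowB hij divff ?qpow_neq0.
have hkn : (1 <= K.+1 < n)%N by lia.
case: (eqVneq j i) => [ji|ji]; last by move/eqP: q0; rewrite (negbTE (generic_neq0 _ _ hkn hj hi ji)).
subst i; rewrite cong_sym /cong -(qnum_int_eq0 R m_ge3 m_odd); apply/eqP.
by rewrite -q0 subrr add0r.
Qed.

Lemma proj_exists K z0 : (K < n)%N -> exists u, isproj K z0 u.
Proof.
elim: K z0 => [|K IH] z0 hK.
  exists 1%:A; split; first exact: gen_byA.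
  move=> z; rewrite (_ : cl 0 z == cl 0 z0) //; apply/clP => // k j hj hk.
  by move: hj; rewrite (eqP (_ : k == 0%N)) //; lia.
apply: proj_of_sep => z1 ne; apply: sep_succ => // z; apply: IH; lia.
Qed.

Local Notation top := n.-1.

Lemma ltn_top : (top < n)%N. Proof. by rewrite prednK //; lia. Qed.

Definition tr z0 (d : L) : Prop := exists u : U, forall z,
  u *: t z = (cl top z == cl top z0)%:R *' t (z + d).

Lemma tr0 z0 : tr z0 0.
Proof. by have [u [_ h]] := proj_exists z0 ltn_top; exists u => z; rewrite h addr0. Qed.

Lemma tr_comp z0 d d' : tr z0 d -> tr (z0 + d) d' -> tr z0 (d + d').
Proof.
move=> [u h] [u' h']; exists (u' * u) => z; rewrite -[LHS]scalerA h scC h' scA addrA.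
by rewrite clD ?ltn_top //; case: (_ == _); rewrite ?mul0r ?mul1r.
Qed.

Lemma cl_top z z' k : cl top z = cl top z' -> (k <= n)%N -> rowcong k z z'.
Proof.
move=> h; rewrite leq_eqVlt => /orP[/eqP->|hk]; first exact: rowcong_top.
by apply: (cl_row ltn_top h); lia.
Qed.

Lemma tr_F z0 k j : (1 <= k < n)%N -> (1 <= j <= k)%N -> cF k j z0 != 0 -> tr z0 (- dl n k j).
Proof.
move=> hk hj f0; have hk' : (1 <= k <= top)%N by lia.
have [u [_ h]] := stepF_op z0 hk' ltn_top hj (fun z => proj_exists z ltn_top).
exists ((cF k j z0)^-1%:A * u) => z; rewrite -[LHS]scalerA h scA; case: eqP => hz.
  rewrite !mul1r (@cF_cong k j z0 z) //; try by apply: (cl_top (esym hz)); lia.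
  by rewrite mulVf.
by rewrite mul0r mulr0.
Qed.

Lemma tr_E z0 k j : (1 <= k < n)%N -> (1 <= j <= k)%N -> cE k j z0 != 0 -> tr z0 (dl n k j).
Proof.
move=> hk hj f0; have hk' : (1 <= k <= top)%N by lia.
have [u [_ h]] := stepE_op z0 hk' ltn_top hj (fun z => proj_exists z ltn_top).
exists ((cE k j z0)^-1%:A * u) => z; rewrite -[LHS]scalerA h scA; case: eqP => hz.
  rewrite !mul1r (@cE_cong k j z0 z) //; try by apply: (cl_top (esym hz)); lia.
  by rewrite mulVf.
by rewrite mul0r mulr0.
Qed.

Fixpoint rho k j : L :=
  if k is k'.+1 then dl n k j + (if lk k j then rho k' j else 0) else 0.

(* The coordinates of z on the basis formed by the - rho k j. *)
Definition cc z k j : int := (if lk k.+1 j then e z k.+1 j else 0) - e z k j.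

Lemma ccD z z' k j : cc (z + z') k j = cc z k j + cc z' k j.
Proof. by rewrite /cc !eD; case: ifP => _; ring. Qed.

Lemma ccN z k j : cc (- z) k j = - cc z k j.
Proof. by rewrite /cc !eN; case: ifP => _; ring. Qed.

Lemma cc0 k j : cc 0 k j = 0.
Proof. by rewrite /cc !e0; case: ifP. Qed.

Lemma cc_dl k j k' j' : (1 <= j <= k)%N -> (k < n)%N -> (1 <= j' <= k')%N -> (k' < n)%N ->
  cc (dl n k' j') k j = ((k.+1 == k') && (j == j') && lk k' j')%:R - ((k == k') && (j == j'))%:R.
Proof.
move=> hj hk hj' hk'; rewrite /cc !e_dl_le //; try by lia.
case: (eqVneq k.+1 k') => [<-|_] /=; last by rewrite if_same.
by case: (eqVneq j j') => [->|_] /=; case: (lk _ _).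
Qed.

Lemma cc_rho k' j' k j : (1 <= j <= k)%N -> (k < n)%N -> (1 <= j' <= k')%N -> (k' < n)%N ->
  cc (rho k' j') k j = - ((k == k') && (j == j'))%:R.
Proof.
move=> hj hk; elim: k' => [|k' IH] hj' hk' /=; first by lia.
rewrite ccD cc_dl // eqSS; case: ifP => [l|_]; last first.
  by rewrite cc0 andbF addr0 sub0r.
rewrite IH; try by move: l => /andP[]; lia.
Qed.

Lemma cc_inj z z' : (forall k j, (1 <= j <= k)%N -> (k < n)%N -> cc z k j = cc z' k j) -> z = z'.
Proof.
move=> h; apply: lat_eqP => k j hj hk.
have [d hd] : exists d, (k + d = n)%N by exists (n - k)%N; lia.
elim: d k hd hj {hk} => [|d IH] k hd hj.
  by rewrite (_ : k = n) ?etop //; lia.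
have hk : (k < n)%N by lia.
have := h k j hj hk; rewrite /cc IH; try by lia.
Qed.

Definition Omega z : Prop := forall k j, (1 <= j <= k)%N -> (k < n)%N -> lk k.+1 j -> 0 <= cc z k j.

Lemma Omega0 : Omega 0.
Proof. by move=> k j _ _ _; rewrite cc0. Qed.

Lemma tr_rho z k j : (1 <= j <= k)%N -> (k < n)%N ->
  (forall k', (j <= k' < k)%N -> (m %| cc z k' j)%Z) -> tr z (- rho k j).
Proof.
elim: k => [|k IH] hj hk h; first by lia.
rewrite /= opprD addrC; case: (boolP (lk k.+1 j)) => l; last first.
  by rewrite oppr0 add0r; apply: tr_F => //; rewrite cF_eq0 // (negbTE l).
have hjk : (1 <= j <= k)%N by case/andP: l; lia.
have hk' : (k < n)%N by lia.
apply: tr_comp; first by apply: IH => // k' hk2; apply: h; lia.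
apply: tr_F => //; rewrite cF_eq0 // l /=.
have -> : e (z - rho k j) k.+1 j - e (z - rho k j) k j = cc (z - rho k j) k j by rewrite /cc l.
rewrite ccD ccN cc_rho // !eqxx opprK; apply/negP => d.
have : (m %| cc z k j)%Z by apply: h; lia.
by move/(rpredB d); rewrite /= addrAC subrr add0r dvdz1 => /eqP; lia.
Qed.

Lemma tr_rho_up z k j : (1 <= j <= k)%N -> (k < n)%N -> cE k j z != 0 ->
  (forall k', (j <= k' < k)%N -> (m %| cc z k' j)%Z) -> tr z (rho k j).
Proof.
elim: k z => [|k IH] z hj hk hE h; first by lia.
rewrite /=; have step : tr z (dl n k.+1 j) by apply: tr_E.
case: (boolP (lk k.+1 j)) => l; last by rewrite (addr0 (dl n k.+1 j)).
have hjk : (1 <= j <= k)%N by case/andP: l; lia.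
have hk' : (k < n)%N by lia.
apply: tr_comp => //; apply: IH => //; last first.
  move=> k' hk2; rewrite ccD cc_dl //; try by lia.
  have -> : (k'.+1 == k.+1) = false by lia.
  have -> : (k' == k.+1) = false by lia.
  by rewrite /= subrr addr0; apply: h; lia.
apply: cE_neq0 => //; first by lia.
move=> _; rewrite hk /=.
have -> : e (z + dl n k.+1 j) k j - e (z + dl n k.+1 j) k.+1 j = - cc (z + dl n k.+1 j) k j.
  by rewrite /cc l; ring.
rewrite rpredN ccD cc_dl // !eqxx l (_ : (k == k.+1) = false) ?subr0; last by lia.
apply/negP => d; have : (m %| cc z k j)%Z by apply: h; lia.
by move/(rpredB d); rewrite /= addrAC subrr add0r dvdz1 => /eqP; lia.
Qed.

Lemma reach z : Omega z -> tr 0 z.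
Proof.
move=> hz.
suff H d : forall K, (K + d = n)%N -> forall z, Omega z ->
    (forall k j, (1 <= j <= k)%N -> (k < K)%N -> cc z k j = 0) -> tr 0 z.
  by apply: (H n 0%N) => //; lia.
elim: d {z hz} => [|d IH] K hK z hz h0.
  rewrite (_ : z = 0); first exact: tr0.
  by apply: cc_inj => k j hj hk; rewrite cc0 h0 //; lia.
have [N hN] : exists N, (\sum_(1 <= j < K.+1) `|cc z K j|%N <= N)%N by exists (\sum_(1 <= j < K.+1) `|cc z K j|%N)%N.
elim: N z hz h0 hN => [|N IHN] z hz h0 hN.
  apply: (IH K.+1) => //; first by lia.
  move=> k j hj; rewrite ltnS leq_eqVlt => /orP[/eqP kK|hk]; last exact: h0.
  move: hN; rewrite leqn0 (bigD1_seq j) ?mem_index_iota ?iota_uniq /=; try by lia.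
  by subst k; rewrite addn_eq0 => /andP[/eqP]; lia.
have Kn : (K < n)%N by lia.
case: (pselect (exists j, (1 <= j <= K)%N /\ cc z K j != 0)) => [[j [hj cj]]|no]; last first.
  apply: (IH K.+1) => //; first by lia.
  move=> k j hj; rewrite ltnS leq_eqVlt => /orP[/eqP kK|hk]; last exact: h0.
  by apply/eqP/negPn/negP => c; apply: no; exists j; subst k.
have sumlt (s : int) : (`|(cc z K j + s)%R| < `|cc z K j|)%N ->
    (\sum_(1 <= i < K.+1) `|(cc z K i + s *+ ((i == j) : nat))%R|%N <= N)%N.
  move=> hs; rewrite -ltnS; apply: leq_trans hN.
  rewrite (bigD1_seq j) ?mem_index_iota ?iota_uniq //=; try by lia.
  rewrite [X in (_ < X)%N](bigD1_seq j) ?mem_index_iota ?iota_uniq //=; try by lia.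
  rewrite eqxx mulr1n; set A := (\sum_(_ <- _ | _) _)%N; set B := (\sum_(_ <- _ | _) _)%N.
  have -> : A = B by apply: eq_bigr => i /negbTE ->; rewrite mulr0n addr0.
  by lia.
have ccr k j' : (1 <= j' <= k)%N -> (k < n)%N -> cc (rho K j) k j' = - ((k == K) && (j' == j))%:R.
  by move=> h1 h2; apply: cc_rho.
case: (ltrP 0 (cc z K j)) => [pos|neg].
  have -> : z = (z + rho K j) - rho K j by rewrite addrK.
  apply: tr_comp; last first.
    apply: tr_rho => // k' hk'; clear sumlt hN IHN IH.
    have hj' : (1 <= j <= k')%N by lia.
    rewrite add0r ccD ccr //; last by lia.
    rewrite h0 //; last by lia.
    have -> : (k' == K) = false by lia.
    by rewrite /= oppr0 dvdz0.
  apply: IHN.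
  - move=> k j' hj' hk' l; rewrite ccD ccr //; have := hz k j' hj' hk' l.
    clear sumlt hN IH.
    by case: (eqVneq k K) => [->|] /=; case: (eqVneq j' j) => [->|] /=; lia.
  - move=> k j' hj' hk'; rewrite ccD ccr //; last by lia.
    rewrite h0 //; have -> : (k == K) = false by lia.
    by rewrite /= oppr0.
  - apply: leq_trans (sumlt (-1) _); last by lia.
    apply: eq_leq; apply: eq_big_nat => i hi; rewrite ccD ccr ?eqxx //=; try lia.
have nl : ~~ lk K.+1 j.
  by apply/negP => l; have := hz K j hj Kn l; move/negP: cj; lia.
have -> : z = (z - rho K j) + rho K j by rewrite subrK.
apply: tr_comp; last first.
  apply: tr_rho_up => //; first by apply: cE_neq0 => //; [lia|rewrite (negbTE nl)].
  move=> k' hk'; clear sumlt hN IHN IH.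
  have hj' : (1 <= j <= k')%N by lia.
  rewrite add0r ccD ccN ccr //; last by lia.
  rewrite h0 //; last by lia.
  have -> : (k' == K) = false by lia.
  by rewrite /= !oppr0 dvdz0.
apply: IHN.
- move=> k j' hj' hk' l; rewrite ccD ccN ccr //; have := hz k j' hj' hk' l.
  by clear sumlt hN IH; case: (_ && _) => /=; lia.
- move=> k j' hj' hk'; rewrite ccD ccN ccr //; last by lia.
  rewrite h0 //; have -> : (k == K) = false by lia.
  by rewrite /= !oppr0.
- apply: leq_trans (sumlt 1 _); last by lia.
  apply: eq_leq; apply: eq_big_nat => i hi; rewrite ccD ccN ccr ?eqxx //=; try lia.
Qed.

Lemma Omega_E z k j : (1 <= k < n)%N -> (1 <= j <= k)%N -> Omega z -> cE k j z != 0 ->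
  Omega (z + dl n k j).
Proof.
move=> hk hj hz hE k' j' hj' hk' l; rewrite ccD cc_dl //; last by lia.
have := hz k' j' hj' hk' l.
case: (eqVneq k' k) => [kk|]; case: (eqVneq j' j) => [jj|] /=; rewrite ?andbF /=; try lia.
subst k' j'; have -> : (k.+1 == k) = false by lia.
move=> h; have : cc z k j != 0; last by move=> /=; lia.
apply/eqP => c0; move/eqP: hE; apply; apply: cE_eq0 => //.
have -> : e z k j - e z k.+1 j = - cc z k j by rewrite /cc l; ring.
by rewrite c0 oppr0 dvdz0.
Qed.

Lemma Omega_F z k j : (1 <= k < n)%N -> (1 <= j <= k)%N -> Omega z -> cF k j z != 0 ->
  Omega (z - dl n k j).
Proof.
move=> hk hj hz hF k' j' hj' hk' l; rewrite ccD ccN cc_dl //; last by lia.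
have := hz k' j' hj' hk' l.
case: (eqVneq k'.+1 k) => [kk|]; case: (eqVneq j' j) => [jj|] /=; rewrite ?andbF /=; try lia.
subst k j'; have -> : (k' == k'.+1) = false by lia.
rewrite l /= => h; have : cc z k' j != 0; last by move=> /=; lia.
apply/eqP => c0; move: hF; rewrite cF_eq0 // l /=.
have -> : e z k'.+1 j - e z k' j = cc z k' j by rewrite /cc l.
by rewrite c0 dvdz0.
Qed.

Local Notation com := (co t_basis).

Lemma mem_span (M : lmodType U) (S : M -> Prop) x : S x -> x \in spanmod S.
Proof. by move=> h; apply/asboolP => P _; apply. Qed.

Lemma span_ind (M : lmodType U) (S P : M -> Prop) : P 0 -> (forall x y, P x -> P y -> P (x + y)) ->
  (forall u x, P x -> P (u *: x)) -> (forall x, S x -> P x) -> forall x, x \in spanmod S -> P x.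
Proof.
move=> P0 PD PZ PS x /asboolP h; apply/asboolP.
have := h [pred y | `[< P y >]]; rewrite inE; apply.
  split; first by rewrite inE; apply/asboolP.
  by move=> a y y'; rewrite !inE => /asboolP hy /asboolP hy'; apply/asboolP/PD => //; apply: PZ.
by move=> y /PS hy; rewrite inE; apply/asboolP.
Qed.

Lemma U_stable (P : V -> Prop) : (forall c x, P x -> P (c *' x)) ->
  (forall x y, P x -> P y -> P (x + y)) ->
  (forall i x, (1 <= i < n)%N -> P x -> P (uqE R n m i *: x)) ->
  (forall i x, (1 <= i < n)%N -> P x -> P (uqF R n m i *: x)) ->
  (forall i x, (1 <= i <= n)%N -> P x -> P (uqK R n m i *: x)) ->
  (forall i x, (1 <= i <= n)%N -> P x -> P (uqKi R n m i *: x)) ->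
  forall u x, P x -> P (u *: x).
Proof.
move=> Pc PD PE PF PK PKi; elim/quotW => [c|u u' h h'|u u' h h'|i hi|i hi|i hi|i hi] x hx; auto.
  by rewrite scalerDl; apply: PD; auto.
by rewrite -scalerA; auto.
Qed.

Definition inM (x : V) : Prop := forall z, com x z != 0 -> Omega z.

Lemma inM_t z : Omega z -> inM (t z).
Proof. by move=> h z'; rewrite cob; case: (eqVneq z' z) => [->|]; rewrite ?eqxx. Qed.

Lemma inM0 : inM 0.
Proof. by move=> z; rewrite co0 eqxx. Qed.

Lemma inMD x y : inM x -> inM y -> inM (x + y).
Proof.
move=> hx hy z; rewrite coD; case: (eqVneq (com x z) 0) => [->|/hx //].
by rewrite add0r; apply: hy.
Qed.

Lemma inMZ c x : inM x -> inM (c *' x).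
Proof. by move=> hx z; rewrite coZ mulf_eq0 negb_or => /andP[_]; apply: hx. Qed.

Lemma inM_sum (I : Type) (s : seq I) (Pr : pred I) (F : I -> V) :
  (forall i, Pr i -> inM (F i)) -> inM (\sum_(i <- s | Pr i) F i).
Proof. by move=> h; apply: big_ind => //; [exact: inM0|exact: inMD]. Qed.

Lemma inM_ind (P : V -> Prop) : P 0 -> (forall x y, P x -> P y -> P (x + y)) ->
  (forall c z, Omega z -> P (c *' t z)) -> forall x, inM x -> P x.
Proof.
move=> P0 PD Pb x hx; rewrite [x](coE t_basis) big_seq; apply: big_ind => // z.
by rewrite mem_finsupp => /hx; apply: Pb.
Qed.

Lemma inM_gen (u : U) : (forall z, Omega z -> inM (u *: t z)) -> forall x, inM x -> inM (u *: x).
Proof.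
move=> h; apply: inM_ind => [|x y hx hy|c z hz]; first by rewrite scaler0; apply: inM0.
  by rewrite scalerDr; apply: inMD.
by rewrite scC; apply/inMZ/h.
Qed.

Lemma inM_U u x : inM x -> inM (u *: x).
Proof.
move: u x; apply: U_stable => [c x|x y|i x hi|i x hi|i x hi|i x hi]; first exact: inMZ.
- exact: inMD.
- apply: inM_gen => z hz; rewrite actE // -scaleN1r -(scaleN1r (1 : U)) -/((-1) *' _).
  apply: inMZ; rewrite big_seq; apply: inM_sum => j; rewrite mem_index_iota ltnS => hj.
  case: (eqVneq (cE i j z) 0) => [->|hc]; first by rewrite sc0; apply: inM0.
  by apply: inMZ; apply: inM_t; apply: Omega_E.
- apply: inM_gen => z hz; rewrite actF //.
  rewrite big_seq; apply: inM_sum => j; rewrite mem_index_iota ltnS => hj.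
  case: (eqVneq (cF i j z) 0) => [->|hc]; first by rewrite sc0; apply: inM0.
  by apply: inMZ; apply: inM_t; apply: Omega_F.
- by apply: inM_gen => z hz; rewrite actK //; apply/inMZ/inM_t.
- by apply: inM_gen => z hz; rewrite actKi //; apply/inMZ/inM_t.
Qed.

Lemma UqT_t z : Omega z -> t z \in UqT v T.
Proof.
move=> /reach [u hu]; have := hu 0; rewrite eqxx sc1 shift0 add0r => <-.
by apply: rpredZ; apply: mem_span.
Qed.

Lemma UqTP x : x \in UqT v T <-> inM x.
Proof.
split; first apply: span_ind => [|y y'|u y|y ->].
- exact: inM0.
- exact: inMD.
- exact: inM_U.
- have -> : T v = t 0 by rewrite shift0.
  by apply: inM_t; apply: Omega0.
move: x; apply: inM_ind => [|x y hx hy|c z hz]; first exact: rpred0.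
  exact: rpredD.
by apply: rpredZ; apply: UqT_t.
Qed.

Lemma UqT_tP z : t z \in UqT v T <-> Omega z.
Proof.
split; last exact: UqT_t.
by move=> /UqTP /(_ z); rewrite cob eqxx oner_eq0; apply.
Qed.

Definition Sh (d : L) (x : V) : V := lmap t_basis (fun z => t (z + d)) x.

Lemma Sh_t d z : Sh d (t z) = t (z + d). Proof. exact: lmapb. Qed.
Lemma ShD d x y : Sh d (x + y) = Sh d x + Sh d y. Proof. exact: lmapD. Qed.
Lemma ShZ d c x : Sh d (c *' x) = c *' Sh d x. Proof. exact: lmapZ. Qed.
Lemma Sh0 d : Sh d 0 = 0. Proof. by rewrite -(sc0 0) ShZ !sc0. Qed.
Lemma ShN d x : Sh d (- x) = - Sh d x.
Proof.
have h y : - y = (-1) *' (y : V) by rewrite scN sc1.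
by rewrite !h ShZ.
Qed.
Lemma Sh_sum d (I : Type) (s : seq I) (F : I -> V) :
  Sh d (\sum_(i <- s) F i) = \sum_(i <- s) Sh d (F i).
Proof. by elim/big_rec2: _ => [|i x y _ <-]; [exact: Sh0|exact: ShD]. Qed.

Lemma t_ind (P : V -> Prop) : P 0 -> (forall x y, P x -> P y -> P (x + y)) ->
  (forall c z, P (c *' t z)) -> forall x, P x.
Proof. exact: (V_ind t_basis). Qed.

Definition md (d : L) := forall k j, (1 <= j <= k)%N -> (k <= n)%N -> (m %| e d k j)%Z.

Lemma md_row d z k : md d -> (k <= n)%N -> rowcong k z (z + d).
Proof. by move=> h hk j hj; rewrite /cong eD opprD addrA subrr sub0r rpredN h. Qed.

Lemma Sh_U d u x : md d -> u *: Sh d x = Sh d (u *: x).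
Proof.
move=> hd.
have lin (w : U) : (forall z, w *: t (z + d) = Sh d (w *: t z)) -> forall x, w *: Sh d x = Sh d (w *: x).
  move=> h; apply: t_ind => [|y y' hy hy'|c z]; first by rewrite Sh0 scaler0 Sh0.
    by rewrite ShD !scalerDr ShD hy hy'.
  by rewrite ShZ !scC ShZ Sh_t h.
move: u x; elim/quotW => [c|u u' h h'|u u' h h'|i hi|i hi|i hi|i hi] x.
- by rewrite ShZ.
- by rewrite !scalerDl ShD h h'.
- by rewrite -!scalerA h' h.
- move: x; apply: lin => z; rewrite !actE // ShN Sh_sum; congr (- _).
  apply: eq_big_nat => j; rewrite ltnS => hj; rewrite ShZ Sh_t (@cE_cong i j z (z + d)) //; try by apply: md_row => //; lia.
  by rewrite addrAC.
- move: x; apply: lin => z; rewrite !actF // Sh_sum.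
  apply: eq_big_nat => j; rewrite ltnS => hj; rewrite ShZ Sh_t (@cF_cong i j z (z + d)) //; try by apply: md_row => //; lia.
  by rewrite addrAC.
- move: x; apply: lin => z; rewrite !actK // ShZ Sh_t (@Qgt_a_cong i z (z + d)) //; apply: md_row => //; lia.
- move: x; apply: lin => z; rewrite !actKi // ShZ Sh_t !qpowN (@Qgt_a_cong i z (z + d)) //; apply: md_row => //; lia.
Qed.

Lemma column_run_rho k j r : (1 <= j)%N -> column_run v k j r ->
  rho k j = \sum_(r <= l < k.+1) dl n l j.
Proof.
elim: k => [|k IH] hj [h1 h2 h3]; first by lia.
rewrite /=; case: (boolP (lk k.+1 j)) => l.
  have hjk : (1 <= j < k.+1)%N by case/andP: l.
  have rk : (r <= k)%N.
    case: (ltngtP r k.+1) => // rk; first by lia.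
    by have := h3; rewrite rk; case/andP: l => _ /eqP -> h; case: (h _) => //; lia.
  rewrite IH //; last split.
  - rewrite [RHS]big_nat_recr /=; [by rewrite addrC|by lia].
  - by lia.
  - move=> l' hl; rewrite (h2 l'); last by lia.
    by rewrite -(h2 k) //; lia.
  - exact: h3.
have rk : r = k.+1.
  case: (ltngtP r k.+1) => // rk; last by lia.
  case/negP: l; rewrite /lk; apply/andP; split; first by lia.
  by rewrite /= (h2 k) //; lia.
by rewrite rk big_nat1 addr0.
Qed.

Lemma column_run_ex k j : (1 <= j <= k)%N -> exists r, column_run v k j r.
Proof.
elim: k => [|k IH] hj; first by lia.
case: (boolP (lk k.+1 j)) => l.
  have /andP[hjk /eqP hv] := l; have [|r [h1 h2 h3]] := IH; first by lia.
  exists r; split=> //; first by lia.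
  move=> l' /andP[h4]; rewrite leq_eqVlt => /orP[/eqP -> //|h5].
  by rewrite hv; apply: h2; lia.
exists k.+1; split; first by lia.
  by move=> l' hl; rewrite (_ : l' = k.+1) //; lia.
by move=> jk h; case/negP: l; rewrite /lk h eqxx andbT; lia.
Qed.

Definition emb z : tableau n C := [ffun p : position n => (val z p)%:~R].

Lemma ent_emb z k j : ent (emb z) k j = (e z k j)%:~R.
Proof. by rewrite /emb /e /ent; case: insub => //= p; rewrite ffunE. Qed.

Lemma embD z z' : emb (z + z') = emb z + emb z'.
Proof. by apply: tableau_eqP => k j _ _; rewrite entD !ent_emb eD intrD. Qed.

Lemma embN z : emb (- z) = - emb z.
Proof. by apply: tableau_eqP => k j _ _; rewrite entN !ent_emb eN rmorphN. Qed.

Lemma emb0 : emb 0 = 0.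
Proof. by apply: tableau_eqP => k j _ _; rewrite ent0 !ent_emb e0. Qed.

Lemma emb_mulrn z k : emb (z *+ k) = emb z *+ k.
Proof. by elim: k => [|k IH]; rewrite ?mulr0n ?emb0 // !mulrS embD IH. Qed.

Lemma emb_sum (s : seq nat) (F : nat -> L) : emb (\sum_(i <- s) F i) = \sum_(i <- s) emb (F i).
Proof. by elim/big_rec2: _ => [|i x y _ <-]; [exact: emb0|exact: embD]. Qed.

Lemma emb_dl k j : (k < n)%N -> emb (dl n k j) = delta_tab n C k j.
Proof.
move=> hk; have := shiftD_dl v 0 j hk; rewrite shift0 add0r => h.
by apply: (addrI v); rewrite h.
Qed.

(* d_p: the shift of the relation defining W_p. *)
Definition shp k j : L := - (rho k j *+ m).

Lemma lower_shift k j r : (1 <= j <= k)%N -> (k < n)%N -> column_run v k j r ->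
  lower m v k j r = shift v (shp k j).
Proof.
move=> hj hk hr; have hj1 : (1 <= j)%N by lia.
rewrite /lower /shift -/(emb _) embN emb_mulrn (column_run_rho hj1 hr) emb_sum -sumrMnl.
congr (_ - _); apply: eq_big_nat => l hl; rewrite emb_dl //; lia.
Qed.

Lemma e_mulrn z k j (a : nat) : e (z *+ a) k j = e z k j *+ a.
Proof. by elim: a => [|a IH]; rewrite ?mulr0n ?e0 // !mulrS eD IH. Qed.

Lemma cc_mulrn z k j (a : nat) : cc (z *+ a) k j = cc z k j *+ a.
Proof. by elim: a => [|a IH]; rewrite ?mulr0n ?cc0 // !mulrS ccD IH. Qed.

Lemma md_shp k j : md (shp k j).
Proof.
by move=> a b _ _; rewrite eN e_mulrn rpredN -mulr_natr natz dvdz_mull ?dvdzz.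
Qed.

Lemma cc_shp k j k' j' : (1 <= j' <= k')%N -> (k' < n)%N -> (1 <= j <= k)%N -> (k < n)%N ->
  cc (shp k j) k' j' = m%:Z *+ ((k' == k) && (j' == j)).
Proof.
move=> h1 h2 h3 h4; rewrite ccN cc_mulrn cc_rho // mulNrn opprK.
by case: (_ && _); rewrite /= ?mul0rn // mulr1n natz.
Qed.

Lemma Omega_shp z k j : (1 <= j <= k)%N -> (k < n)%N -> Omega z -> Omega (z + shp k j).
Proof.
move=> hj hk h k' j' hj' hk' l; rewrite ccD cc_shp //.
by apply: addr_ge0; [exact: h|case: (_ && _)].
Qed.

Lemma inM_Sh k j x : (1 <= j <= k)%N -> (k < n)%N -> inM x -> inM (Sh (shp k j) x).
Proof.
move=> hj hk; move: x; apply: inM_ind => [|x y hx hy|c z hz]; first by rewrite Sh0; exact: inM0.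
  by rewrite ShD; exact: inMD.
by rewrite ShZ Sh_t; apply/inMZ/inM_t/Omega_shp.
Qed.

Definition pos' := {p : position n | ((val p).1 < n)%N}.
HB.instance Definition _ := SubFinite.on pos'.
Definition pk (p : pos') : nat := (val (val p)).1.
Definition pj (p : pos') : nat := (val (val p)).2.

Lemma pjP p : (1 <= pj p <= pk p)%N. Proof. exact: (valP (val p)). Qed.
Lemma pkP p : (pk p < n)%N. Proof. exact: (valP p). Qed.

Lemma posE k j : (1 <= j <= k)%N -> (k < n)%N -> exists p : pos', pk p = k /\ pj p = j.
Proof.
move=> hj hk; have hk' : (k <= n)%N by lia.
have h : ((val (posn hj hk')).1 < n)%N by rewrite /= inordK.
by exists (Sub (posn hj hk') h); rewrite /pk /pj /= !inordK //; lia.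
Qed.

Lemma pos_eqE (p p' : pos') : (pk p == pk p') && (pj p == pj p') = (p == p').
Proof.
apply/andP/eqP => [[/eqP h1 /eqP h2]|-> //]; apply: val_inj; apply: val_inj.
by move: h1 h2; rewrite /pk /pj; case: (val (val p)) => a b; case: (val (val p')) => a' b' /= /val_inj -> /val_inj ->.
Qed.

Lemma count_iota_le (i a : nat) : (i <= a)%N -> count (fun j => (1 <= j <= i)%N) (iota 0 a.+1) = i.
Proof.
move=> hi /=; rewrite -{1}(subnKC hi) iotaD count_cat add1n.
have -> : count (fun j => (1 <= j <= i)%N) (iota 1 i) = i.
  rewrite -[RHS](size_iota 1 i); apply/eqP; rewrite -all_count; apply/allP => j.
  by rewrite mem_iota; lia.
rewrite (_ : count _ (iota i.+1 _) = 0%N) ?addn0 //; apply/eqP.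
rewrite -leqn0 leqNgt -has_count; apply/negP => h; case: (elimT (seq.hasP) h) => j.
by rewrite mem_iota; lia.
Qed.

Lemma card_pos' : #|{: pos'}| = (n * n.-1)./2.
Proof.
have inj : injective (fun p : pos' => val (val p)) by move=> p p' /val_inj /val_inj.
rewrite -bin2 -bin2_sum big_mkord -(card_image inj).
pose P (x : 'I_n.+1 * 'I_n.+1) : bool := (1 <= x.2 <= x.1)%N && (x.1 < n)%N.
rewrite (eq_card (B := P)); last first.
  move=> x; apply/imageP/idP => [[p _ ->]|h].
    by rewrite unfold_in /P (valP (val p)) (valP p).
  have : (1 <= x.2 <= x.1)%N && (x.1 < n)%N := h.
  case/andP => h1 h2.
  by exists (Sub (Sub x h1 : position n) h2).
rewrite -sum1_card (eq_bigl P) // /P -(pair_big_dep predT (fun i j : 'I_n.+1 => (1 <= j <= i)%N && (i < n)%N) (fun _ _ => 1%N)) /=.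
rewrite big_ord_recr /= [X in (_ + X)%N]big1 ?addn0; last by move=> j; rewrite ltnn andbF.
apply: eq_bigr => i _; rewrite -[RHS](@count_iota_le i n); last exact/ltnW.
rewrite -sum1_count -[iota 0 n.+1]/(index_iota 0 n.+1) big_mkord; apply: eq_bigl => j.
by rewrite ltn_ord andbT.
Qed.

Definition shp' (p : pos') : L := shp (pk p) (pj p).
Definition ccp z (p : pos') : int := cc z (pk p) (pj p).

Lemma ccp_shp z p p' : ccp (z + shp' p) p' = ccp z p' + m%:Z *+ (p' == p).
Proof. by rewrite /ccp ccD cc_shp ?pos_eqE ?pjP ?pkP. Qed.

Lemma ccp_inj z z' : (forall p, ccp z p = ccp z' p) -> z = z'.
Proof. by move=> h; apply: cc_inj => k j hj hk; have [p [<- <-]] := posE hj hk; apply: h. Qed.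

Lemma OmegaP z : Omega z <-> forall p, lk (pk p).+1 (pj p) -> 0 <= ccp z p.
Proof.
split=> [h p l|h k j hj hk]; first by apply: h; rewrite ?pjP ?pkP.
by have [p [<- <-]] := posE hj hk; apply: h.
Qed.

Notation box := {ffun pos' -> 'I_mm.+1}.

Definition zc (c : box) : L := - \sum_(p : pos') rho (pk p) (pj p) *+ (c p).

Lemma ccp_zc c p : ccp (zc c) p = Posz (c p).
Proof.
rewrite /ccp /zc ccN.
have cs (s : seq pos') (F : pos' -> L) k j : cc (\sum_(i <- s) F i) k j = \sum_(i <- s) cc (F i) k j.
  by elim/big_rec2: _ => [|i x y _ <-]; [exact: cc0|exact: ccD].
rewrite cs (bigD1 p) //= big1 ?addr0; last first.
  move=> p' hp; rewrite cc_mulrn cc_rho ?pjP ?pkP // pos_eqE.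
  by rewrite eq_sym (negbTE hp) oppr0 mul0rn.
by rewrite cc_mulrn cc_rho ?pjP ?pkP // !eqxx mulNrn opprK natz.
Qed.

Lemma Omega_zc c : Omega (zc c).
Proof. by apply/OmegaP => p _; rewrite ccp_zc. Qed.

Section Choice.
Variable W : nat -> nat -> {pred V}.
Hypothesis Wch : is_choice v T W.

Definition eps k j : C :=
  if lk k.+1 j && `[< forall r, column_run v k j r -> W k j =i W2 v T k j r >] then 0 else 1.

Definition rel (p : pos') (x : V) : V := Sh (shp' p) x - eps (pk p) (pj p) *' x.

Lemma W_span p x : (x \in W (pk p) (pj p)) = (x \in spanmod (fun y => y = rel p (t 0))).
Proof.
have [r hr] := column_run_ex (pjP p).
have [h1 h2] := Wch (pjP p) (pkP p) hr.
have Tl : T (lower m v (pk p) (pj p) r) = Sh (shp' p) (t 0).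
  by rewrite (lower_shift (pjP p) (pkP p) hr) Sh_t add0r.
rewrite /rel /eps; case: ifP => [/andP[l /asboolP h]|hn].
  by rewrite (h r hr) sc0 subr0 -Tl.
have W1E : W (pk p) (pj p) =i W1 v T (pk p) (pj p) r.
  case: (pselect (ent v (pk p).+1 (pj p) = ent v (pk p) (pj p))) => [hv|/h1 //].
  have [//|h3] := h2 hv.
  have l : lk (pk p).+1 (pj p).
    by rewrite /lk /= hv eqxx andbT; have := pjP p; lia.
  move: hn; rewrite l /= => /asboolP; case=> r' hr' => y; rewrite h3.
  suff -> : W2 v T (pk p) (pj p) r = W2 v T (pk p) (pj p) r' by [].
  rewrite /W2; congr spanmod; apply/funext => y'; congr (y' = T _).
  by rewrite !(lower_shift (pjP p) (pkP p)).
by rewrite W1E /W1 Tl sc1 shift0.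
Qed.

Lemma relD p x y : rel p (x + y) = rel p x + rel p y.
Proof. by rewrite /rel ShD scDr opprD addrACA. Qed.

Lemma rel_U p u x : u *: rel p x = rel p (u *: x).
Proof. by rewrite /rel scalerBr Sh_U ?scC //; apply: md_shp. Qed.

Lemma rel0 p : rel p 0 = 0.
Proof. by rewrite /rel Sh0 scx0 subr0. Qed.

Lemma inM_rel p x : inM x -> inM (rel p x).
Proof.
move=> h; apply: inMD; first by apply: inM_Sh; rewrite ?pjP ?pkP.
by rewrite -scN; apply: inMZ.
Qed.

Definition inN (x : V) := exists X : pos' -> V, (forall p, inM (X p)) /\ x = \sum_p rel p (X p).

Lemma inN0 : inN 0.
Proof.
exists (fun=> 0); split; first by move=> _; apply: inM0.
by rewrite big1 // => p _; rewrite rel0.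
Qed.

Lemma inND x y : inN x -> inN y -> inN (x + y).
Proof.
move=> [X [hX ->]] [Y [hY ->]]; exists (fun p => X p + Y p); split; first by move=> p; apply: inMD.
by rewrite -big_split; apply: eq_bigr => p _; rewrite relD.
Qed.

Lemma inNU u x : inN x -> inN (u *: x).
Proof.
move=> [X [hX ->]]; exists (fun p => u *: X p); split; first by move=> p; apply: inM_U.
by rewrite scaler_sumr; apply: eq_bigr => p _; rewrite rel_U.
Qed.

Lemma inNN x : inN x -> inN (- x).
Proof. by move=> h; rewrite -scaleN1r; apply: inNU. Qed.

Lemma inN_rel p x : inM x -> inN (rel p x).
Proof.
move=> h; exists (fun p' => if p' == p then x else 0); split.
  by move=> p'; case: ifP => // _; apply: inM0.
by rewrite (bigD1 p) //= eqxx big1 ?addr0 // => p' /negbTE ->; rewrite rel0.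
Qed.

Lemma W_inN p x : x \in W (pk p) (pj p) -> inN x.
Proof.
rewrite W_span; apply: span_ind => [|||y ->]; [exact: inN0|exact: inND|exact: inNU|].
by apply: inN_rel; apply: inM_t; apply: Omega0.
Qed.

Lemma rel_W p x : inM x -> rel p x \in W (pk p) (pj p).
Proof.
move=> /UqTP; rewrite W_span; apply: (span_ind (P := fun x => rel p x \in spanmod (fun y => y = rel p (t 0)))) => [|y y' h h'|u y h|y ->].
- by rewrite rel0 rpred0.
- by rewrite relD rpredD.
- by rewrite -rel_U rpredZ.
- by apply: mem_span; rewrite shift0.
Qed.

Local Notation Vb := (Vbar v T W).
Local Notation MT := (UqT_type v T).

Lemma UqT_val (y : MT) : inM (val y).
Proof. by apply/UqTP; apply: (valP y). Qed.

Definition toM (x : V) : MT := insubd (0 : MT) x.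

Lemma toMK x : inM x -> val (toM x) = x.
Proof. by move=> /UqTP h; rewrite /toM insubdK. Qed.

Lemma toMV (y : MT) : toM (val y) = y.
Proof. by apply: val_inj; rewrite toMK //; apply: UqT_val. Qed.

Lemma quot_inN (y : MT) :
  y \in spanmod (fun y : MT => exists k j, [/\ (1 <= j <= k)%N, (k < n)%N & val y \in W k j]) <-> inN (val y).
Proof.
split.
  apply: (span_ind (P := fun y : MT => inN (val y))) => [|x x' h h'|u x h|x [k [j [hj hk hx]]]].
  - exact: inN0.
  - exact: inND.
  - exact: inNU.
  - by have [p [kp jp]] := posE hj hk; apply: (@W_inN p); rewrite kp jp.
move=> [X [hX hy]].
have -> : y = \sum_p toM (rel p (X p)).
  apply: val_inj; rewrite hy; elim/big_rec2: _ => // p x x' _ ->.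
  by rewrite -[RHS]/(val _ + val _) toMK //; apply: inM_rel.
apply: rpred_sum => p _; apply: mem_span; exists (pk p), (pj p).
rewrite pjP pkP; split=> //; rewrite toMK; first by apply: rel_W.
exact: inM_rel.
Qed.

Definition piM (x : V) : Vb := \pi_Vb (toM x).

Lemma piM_eq x y : inM x -> inM y -> piM x = piM y <-> inN (x - y).
Proof.
move=> hx hy; rewrite -[x in inN (x - _)](toMK hx) -[y in inN (_ - y)](toMK hy).
rewrite -[val _ - val _]/(val (toM x - toM y)) -quot_inN.
split; first by move=> h; rewrite Quotient.idealrBE; apply/eqP.
exact: quotmod_pi.
Qed.

Lemma piMD x y : inM x -> inM y -> piM (x + y) = piM x + piM y.
Proof.
move=> hx hy; rewrite /piM -quotmod_piD; congr (\pi_Vb _); apply: val_inj.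
by rewrite -[RHS]/(val _ + val _) !toMK //; apply: inMD.
Qed.

Lemma piMZ u x : inM x -> piM (u *: x) = u *: piM x.
Proof.
move=> hx; rewrite /piM [RHS]/(GRing.scale _ _) /= quotmod_scale_pi; congr (\pi_Vb _); apply: val_inj.
by rewrite -[RHS]/(u *: val _) !toMK //; apply: inM_U.
Qed.

Lemma piM0 : piM 0 = 0.
Proof. by rewrite -(scale0r (0 : V)) piMZ ?scale0r //; apply: inM0. Qed.

Lemma piM_surj (y : Vb) : exists2 x, inM x & y = piM x.
Proof.
elim/quotmodW: y => y; exists (val y); first exact: UqT_val.
by rewrite /piM toMV.
Qed.

Lemma piM_sum (s : seq nat) (F : nat -> V) (Pr : pred nat) : (forall i, Pr i -> inM (F i)) ->
  piM (\sum_(i <- s | Pr i) F i) = \sum_(i <- s | Pr i) piM (F i).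
Proof.
move=> h; elim: s => [|i s IH]; rewrite ?big_nil ?piM0 // !big_cons; case: ifP => // hi.
by rewrite piMD ?IH //; [apply: h|apply: inM_sum].
Qed.

Lemma TbarE z : Tbar v T W (shift v z) = piM (t z).
Proof. by []. Qed.

(* The coordinate of T(v + z) at the box representative [zc c] in the quotient. *)
Definition hc (c : box) z : C :=
  ([forall p : pos', (m %| ccp z p - Posz (c p))%Z] &&
   [forall p : pos', (eps (pk p) (pj p) == 0) ==> (ccp z p < m%:Z)])%:R.

Definition phi c (x : V) : C := lfun t_basis (hc c) x.

Lemma eps01 k j : eps k j = 0 \/ eps k j = 1.
Proof. by rewrite /eps; case: ifP; [left|right]. Qed.

Lemma eps0_lk k j : eps k j = 0 -> lk k.+1 j.
Proof. by rewrite /eps; case: ifP => [/andP[]|] // _ /eqP; rewrite oner_eq0. Qed.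

Lemma phi_rel c p x : inM x -> phi c (rel p x) = 0.
Proof.
move: x; apply: inM_ind => [|x y hx hy|a z hz].
- by rewrite rel0 -(sc0 0) /phi lfunZ mul0r.
- by rewrite relD /phi lfunD -!/(phi _ _) hx hy addr0.
rewrite /rel ShZ Sh_t -scN scC -scDr /phi lfunZ lfunD lfunZ !lfunb.
suff -> : hc c (z + shp' p) = eps (pk p) (pj p) * hc c z by rewrite mulNr subrr mulr0.
rewrite /hc; under eq_forallb => p'.
  rewrite ccp_shp addrAC rpredDr; last by rewrite /=; case: (_ == _); rewrite ?dvdz0 ?dvdzz.
  over.
case: (eps01 (pk p) (pj p)) => ep; rewrite ep ?mul0r ?mul1r.
  have -> : [forall p', (eps (pk p') (pj p') == 0) ==> (ccp (z + shp' p) p' < m%:Z)] = false.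
    apply/negP => /forallP /(_ p); rewrite ep eqxx /= ccp_shp eqxx.
    have := (OmegaP z).1 hz p (eps0_lk ep); lia.
  by rewrite andbF.
congr ((_ && _)%:R); apply: eq_forallb => p'; rewrite ccp_shp.
case: (eqVneq p' p) => [->|_]; first by rewrite ep oner_eq0.
by rewrite mulr0n addr0.
Qed.

Lemma phiD c x y : phi c (x + y) = phi c x + phi c y. Proof. exact: lfunD. Qed.
Lemma phiZ c a x : phi c (a *' x) = a * phi c x. Proof. exact: lfunZ. Qed.

Lemma phi_inN c x : inN x -> phi c x = 0.
Proof.
move=> [X [hX ->]]; elim/big_rec: _ => [|p y _ h]; first by rewrite -(sc0 0) phiZ mul0r.
by rewrite phiD phi_rel // h addr0.
Qed.

Lemma phi_zc c c' : phi c (t (zc c')) = (c == c')%:R.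
Proof.
rewrite /phi lfunb /hc; congr (_%:R); apply: congr1.
have lm (p : pos') (b : box) : (b p < m)%N by rewrite -[X in (_ < X)%N]mmE ltn_ord.
apply/andP/eqP => [[/forallP h _]|->]; last first.
  by split; apply/forallP => p; rewrite ccp_zc; [rewrite subrr dvdz0|rewrite ltz_nat lm implybT].
apply/ffunP => p; apply: val_inj; have := h p; rewrite ccp_zc -eqz_mod_dvd !modz_nat eqz_nat.
by rewrite !modn_small ?lm // => /eqP.
Qed.

Lemma reduce z : Omega z -> exists a : box -> C, inN (t z - \sum_c a c *' t (zc c)).
Proof.
have [N hN] : exists N, (\sum_p `|(ccp z p %/ m)%Z| <= N)%N by exists (\sum_p `|(ccp z p %/ m)%Z|)%N.
elim: N z hN => [|N IH] z hN hz.
  have hb p : (ccp z p %/ m)%Z = 0.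
    by move: hN; rewrite leqn0 (bigD1 p) //= addn_eq0 => /andP[/eqP]; lia.
  have lt p : 0 <= ccp z p < m%:Z by have := divz_eq (ccp z p) m; rewrite hb; lia.
  have lt' p : (`|ccp z p| < mm.+1)%N by have := lt p; rewrite mmE; lia.
  pose c : box := [ffun p => Ordinal (lt' p)].
  exists (fun c' => (c' == c)%:R).
  rewrite (bigD1 c) //= big1 ?addr0; last by move=> c' /negbTE ->; rewrite sc0.
  rewrite eqxx sc1 (_ : zc c = z) ?subrr; first exact: inN0.
  by apply: ccp_inj => p; rewrite ccp_zc ffunE /=; have := lt p; lia.
have m0 : m%:Z != 0 by case: m m_ge3.
case: (pselect (exists p, (ccp z p %/ m)%Z != 0)) => [[p hp]|no]; last first.
  by apply: IH => //; rewrite big1 // => p _; case: (eqVneq (ccp z p %/ m)%Z 0) => [->|h] //; case: no; exists p.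
have bound z' (s : int) : (forall p', ccp z' p' = ccp z p' + m%:Z * (s *+ (p' == p))) ->
    (`|((ccp z p %/ m)%Z + s)%R| < `|(ccp z p %/ m)%Z|)%N -> (\sum_p `|(ccp z' p %/ m)%Z| <= N)%N.
  move=> h hs; rewrite -ltnS; apply: leq_trans hN.
  rewrite (bigD1 p) //= [X in (_ < X)%N](bigD1 p) //= h eqxx mulr1n.
  rewrite [m%:Z * s]mulrC [_ + s * _]addrC divzMDl // [s + _]addrC -addSn; apply: leq_add => //.
  by apply: eq_leq; apply: eq_bigr => p' /negbTE hp'; rewrite h hp' mulr0n mulr0 addr0.
case: (ltrP 0 (ccp z p %/ m)%Z) => [pos|neg].
  have hz' : Omega (z - shp' p).
    apply/OmegaP => p' l; have := (OmegaP z).1 hz p' l.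
    have := ccp_shp (z - shp' p) p p'; rewrite subrK => ->.
    case: (eqVneq p' p) => [->|_]; last by rewrite mulr0n addr0.
    rewrite mulr1n; have := ccp_shp (z - shp' p) p p; rewrite subrK eqxx mulr1n => e1 _.
    by have := divz_eq (ccp z p) m; have := modz_ge0 (ccp z p) m0; nia.
  have [|a ha] := IH (z - shp' p) _ hz'.
    apply: (bound _ (-1)); last by lia.
    move=> p'; have := ccp_shp (z - shp' p) p p'; rewrite subrK => ->.
    by case: (p' == p); rewrite ?mulr1n ?mulr0n; ring.
  exists (fun c => eps (pk p) (pj p) * a c).
  have := inND (@inN_rel p _ (inM_t hz')) (inNU (eps (pk p) (pj p))%:A ha).
  rewrite /rel Sh_t subrK scDr addrA subrK scalerN sc_sumr.
  by under eq_bigr do rewrite scA.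
have hneg : (ccp z p %/ m)%Z < 0 by move: hp; lia.
have cneg : ccp z p < 0 by have := divz_eq (ccp z p) m; have := ltz_pmod (ccp z p) (_ : 0 < m%:Z); nia.
have [|a ha] := IH (z + shp' p) _ (Omega_shp (pjP p) (pkP p) hz).
  apply: (bound _ 1); last by lia.
  by move=> p'; rewrite ccp_shp; case: (p' == p); rewrite ?mulr1n ?mulr0n; ring.
have e1 : eps (pk p) (pj p) = 1.
  case: (eps01 (pk p) (pj p)) => // /eps0_lk l.
  by have := (OmegaP z).1 hz p l; lia.
exists a; have := inND (inNN (@inN_rel p _ (inM_t hz))) ha.
rewrite /rel Sh_t e1 sc1 opprB addrA.
by rewrite subrK.
Qed.

End Choice.

Lemma basis_crit (M : lmodType U) (I : finType) (b : I -> M) (Phi : I -> M -> C) :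
  (forall i x y, Phi i (x + y) = Phi i x + Phi i y) ->
  (forall i a x, Phi i (a *' x) = a * Phi i x) ->
  (forall i i', Phi i (b i') = (i == i')%:R) ->
  (forall x, exists a : I -> C, x = \sum_i a i *' b i) -> ground_basis b.
Proof.
move=> PD PZ Pb sp x; have [a hx] := sp x.
have P0 i : Phi i 0 = 0 by rewrite -(sc0 0) PZ mul0r.
have Psum (s : seq I) (c : I -> C) i : uniq s ->
    Phi i (\sum_(i' <- s) c i' *' b i') = if i \in s then c i else 0.
  elim: s => [|i' s IH] /=; first by rewrite big_nil P0.
  case/andP => is' us; rewrite big_cons PD PZ Pb IH // inE.
  case: (eqVneq i i') => [->|_] /=; first by rewrite (negbTE is') mulr1 addr0.
  by rewrite mulr0 add0r.
pose f : {fsfun I -> C with 0} := [fsfun i in seq_fset tt (enum I) => a i].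
have fE i : f i = a i by rewrite fsfunE seq_fsetE mem_enum.
exists f; split.
  rewrite [LHS]hx; under eq_bigr do rewrite -fE; rewrite (bigID (mem (finsupp f))) /= [X in _ + X]big1 ?addr0; last first.
    by move=> z; rewrite memNfinsupp => /eqP ->; rewrite sc0.
  rewrite -big_filter; apply: perm_big; apply: uniq_perm; rewrite ?filter_uniq ?fset_uniq //; first exact: index_enum_uniq.
  by move=> z; rewrite mem_filter mem_index_enum andbT.
move=> f' hf'; apply/fsfunP => i; rewrite fE.
have h1 := Psum (index_enum I) a i (index_enum_uniq I); rewrite mem_index_enum -hx in h1.
have h2 := Psum (finsupp f') f' i (fset_uniq _); rewrite -hf' in h2.
by rewrite -h1 h2; case: finsuppP.
Qed.

Definition ev (i : 'I_#|{: box}|) : box := enum_val i.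

Section Part1.
Variable W : nat -> nat -> {pred V}.
Hypothesis Wch : is_choice v T W.
Local Notation Vb := (Vbar v T W).

Definition Phi (c : box) (y : Vb) : C := phi W c (val (repr y)).

Lemma Phi_piM c x : inM x -> Phi c (piM W x) = phi W c x.
Proof.
move=> hx; rewrite /Phi; set y := repr _.
have : piM W (val y) = piM W x by rewrite {1}/piM toMV /y reprK.
move/(piM_eq Wch (@UqT_val y) hx)/(phi_inN c) => h.
apply/eqP; rewrite -subr_eq0 -h phiD; apply/eqP; congr (_ + _).
by rewrite -[x]sc1 phiZ -[- (1 *' x)]scN phiZ mul1r mulN1r.
Qed.

Lemma Vbar_basis : ground_basis (fun i : 'I_#|{: box}| => piM W (t (zc (ev i)))).
Proof.
apply: (basis_crit (Phi := fun i y => Phi (ev i) y)).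
- move=> i x y; have [x' hx ->] := piM_surj x; have [y' hy ->] := piM_surj y.
  by rewrite -piMD // !Phi_piM ?phiD //; apply: inMD.
- move=> i a x; have [x' hx ->] := piM_surj x.
  by rewrite -piMZ // !Phi_piM ?phiZ //; apply: inMZ.
- by move=> i j; rewrite Phi_piM ?phi_zc ?(inj_eq enum_val_inj) //; apply/inM_t/Omega_zc.
move=> x; have [x' hx ->] := piM_surj x.
have [a ha] : exists a : box -> C, inN W (x' - \sum_c a c *' t (zc c)).
  move: x' hx; apply: inM_ind => [|y y' [a ha] [a' ha']|c z /(reduce W) [a ha]].
  - exists (fun=> 0); rewrite big1 ?subrr; first exact: inN0.
    by move=> c _; rewrite sc0.
  - exists (fun c => a c + a' c); under eq_bigr do rewrite scDl.
    by rewrite big_split /= opprD addrACA; apply: inND.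
  - exists (fun c' => c * a c'); have := inNU c%:A ha; rewrite scalerBr sc_sumr.
    by under eq_bigr do rewrite scA.
exists (fun i => a (ev i)).
have hs (s : seq 'I_#|{: box}|) : inM (\sum_(i <- s) a (ev i) *' t (zc (ev i))).
  by apply: inM_sum => i _; apply/inMZ/inM_t/Omega_zc.
transitivity (piM W (\sum_i a (ev i) *' t (zc (ev i)))).
  apply/(piM_eq Wch) => //; move: ha; rewrite (reindex ev) //=.
  by apply: onW_bij; apply: enum_val_bij.
elim: (index_enum _) => [|i s IH]; first by rewrite !big_nil piM0.
rewrite !big_cons piMD //; last by apply/inMZ/inM_t/Omega_zc.
by rewrite piMZ ?IH //; apply/inM_t/Omega_zc.
Qed.

Lemma Vbar_dim : ground_dim Vb (m ^ (n * n.-1)./2).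
Proof.
have <- : #|{: box}| = (m ^ (n * n.-1)./2)%N by rewrite card_ffun card_ord card_pos' mmE.
by exists (fun i : 'I_#|{: box}| => piM W (t (zc (ev i)))); apply: Vbar_basis.
Qed.

Lemma Vbar_action z : Omega z -> gt_action (Tbar v T W) (shift v z).
Proof.
move=> hz; have hM := inM_t hz.
have scN' (M : lmodType U) (x : M) : - x = (-1) *' x by rewrite scN sc1.
split=> k hk.
- by rewrite TbarE -piMZ // actK // piMZ.
- by rewrite TbarE -piMZ // actKi // piMZ.
- have h i : (1 <= i <= k)%N -> inM (cE k i z *' t (z + dl n k i)).
    move=> hi; case: (eqVneq (cE k i z) 0) => [->|h]; first by rewrite sc0; apply: inM0.
    by apply/inMZ/inM_t/Omega_E.
  rewrite TbarE -piMZ // actE // [in LHS]scN' piMZ; last first.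
    by rewrite big_seq; apply: inM_sum => i; rewrite mem_index_iota ltnS; apply: h.
  rewrite -scN'; congr (- _); rewrite big_seq [RHS]big_seq piM_sum; last first.
    by move=> i; rewrite mem_index_iota ltnS; apply: h.
  apply: eq_bigr => i; rewrite mem_index_iota ltnS => hi.
  rewrite shiftD_dl ?TbarE; last by case/andP: hk.
  case: (eqVneq (cE k i z) 0) => [c0|c0].
    by rewrite -/(cE k i z) c0 !sc0 piM0.
  by rewrite piMZ //; apply: inM_t; apply: Omega_E.
- have h i : (1 <= i <= k)%N -> inM (cF k i z *' t (z - dl n k i)).
    move=> hi; case: (eqVneq (cF k i z) 0) => [->|h]; first by rewrite sc0; apply: inM0.
    by apply/inMZ/inM_t/Omega_F.
  rewrite TbarE -piMZ // actF //.
  rewrite big_seq [RHS]big_seq piM_sum; last first.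
    by move=> i; rewrite mem_index_iota ltnS; apply: h.
  apply: eq_bigr => i; rewrite mem_index_iota ltnS => hi.
  rewrite shiftB_dl ?TbarE; last by case/andP: hk.
  case: (eqVneq (cF k i z) 0) => [c0|c0].
    by rewrite -/(cF k i z) c0 !sc0 piM0.
  by rewrite piMZ //; apply: inM_t; apply: Omega_F.
Qed.

Lemma tr_shp k j : (1 <= j <= k)%N -> (k < n)%N -> tr 0 (shp k j).
Proof.
move=> hj hk; rewrite /shp -mulNrn; elim: (m) => [|a IH]; first by rewrite mulr0n; apply: tr0.
rewrite mulrSr; apply: tr_comp => //; apply: tr_rho => // k' hk'.
rewrite add0r cc_mulrn ccN cc_rho //; try by lia.
by rewrite (_ : (k' == k) = false) /= ?oppr0 ?mul0rn ?dvdz0 //; lia.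
Qed.

Lemma op_kill p (u : U) : (forall z, u *: t z = (cl top z == cl top 0)%:R *' t (z + shp' p)) ->
  eps W (pk p) (pj p) = 0 -> forall y : Vb, u *: y = 0.
Proof.
move=> hu e0' y; have [x hx ->] := piM_surj y; rewrite -piMZ // -[RHS](piM0 W).
apply/(piM_eq Wch); [exact: inM_U|exact: inM0|rewrite subr0].
move: x hx; apply: inM_ind => [|x x' h h'|c z hz]; first by rewrite scaler0; apply: inN0.
  by rewrite scalerDr; apply: inND.
rewrite scC hu; do 2!apply: inNU.
have := inN_rel W p (inM_t hz); rewrite /rel e0' sc0 subr0 Sh_t.
exact.
Qed.

Lemma op_fix p (u : U) : (forall z, u *: t z = (cl top z == cl top 0)%:R *' t (z + shp' p)) ->
  eps W (pk p) (pj p) = 1 -> exists2 y : Vb, y != 0 & u *: y = y.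
Proof.
move=> hu e1; exists (piM W (t 0)).
  apply/eqP => h; have := Phi_piM [ffun=> ord0] (inM_t Omega0).
  have t0 : zc [ffun=> ord0] = 0 by apply: ccp_inj => p'; rewrite ccp_zc ffunE /ccp cc0.
  rewrite -[X in t X]t0 phi_zc eqxx t0 h -(piM0 W) Phi_piM; last exact: inM0.
  by rewrite -(sc0 0) phiZ mul0r => /esym/eqP; rewrite oner_eq0.
rewrite -piMZ; last exact/inM_t/Omega0.
apply/(piM_eq Wch); [by apply/inM_U/inM_t/Omega0|exact/inM_t/Omega0|].
rewrite hu eqxx sc1; have := inN_rel W p (inM_t Omega0).
by rewrite /rel e1 sc1 Sh_t.
Qed.

End Part1.

Lemma choice_eps (W W' : nat -> nat -> {pred V}) : is_choice v T W -> is_choice v T W' ->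
  (forall p, eps W (pk p) (pj p) = eps W' (pk p) (pj p)) -> @same_choice R n m V W W'.
Proof.
move=> h h' he k j hj hk; have [p [<- <-]] := posE hj hk => x.
by rewrite (W_span h) (W_span h') /rel he.
Qed.

Lemma not_iso (W W' : nat -> nat -> {pred V}) : is_choice v T W -> is_choice v T W' ->
  ~ @same_choice R n m V W W' -> ~ exists f : {linear Vbar v T W -> Vbar v T W'}, bijective f.
Proof.
move=> h h' ns [f bf].
have [p hp] : exists p, eps W (pk p) (pj p) != eps W' (pk p) (pj p).
  apply: contrapT => no; apply: ns; apply: choice_eps => // p; apply/eqP/negPn/negP => hp.
  by apply: no; exists p.
have [u hu] := tr_shp (pjP p) (pkP p).
case: (eps01 W (pk p) (pj p)) => e; case: (eps01 W' (pk p) (pj p)) => e';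
  move: hp; rewrite e e' ?eqxx // => _.
  have [y y0 uy] := op_fix h' hu e'; have [g fg gf] := bf.
  by move: y0; rewrite -uy -(gf y) -linearZ (op_kill h hu e) linear0 eqxx.
have [y y0 uy] := op_fix h hu e.
have : f y = 0 by rewrite -uy linearZ /= (op_kill h' hu e').
move=> fy; have [g fg gf] := bf.
by move: y0; rewrite -(fg y) fy -(linear0 f) fg eqxx.
Qed.

Lemma part1 (W : nat -> nat -> {pred V}) : is_choice v T W ->
  ground_dim (Vbar v T W) (m ^ (n * n.-1)./2) /\
  (forall z : lattice n, T (shift v z) \in UqT v T ->
     let w := shift v z in
     gt_action (Tbar v T W) w /\
     (forall k j, (1 <= j <= k)%N -> (k < n)%N ->
        (gt_coefE m w k j != 0 -> T (w + delta_tab n R[i] k j) \in UqT v T) /\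
        (gt_coefF m w k j != 0 -> T (w - delta_tab n R[i] k j) \in UqT v T))).
Proof.
move=> h; split; first exact: Vbar_dim.
move=> z /UqT_tP hz w; split; first exact: Vbar_action.
move=> k j hj hk; have hk' : (1 <= k < n)%N by lia.
split=> hc; first by rewrite shiftD_dl //; apply/UqT_tP/Omega_E.
by rewrite shiftB_dl //; apply/UqT_tP/Omega_F.
Qed.

(** * The eigenvalues of the central elements *)

Section Part2.
Variables (Lp Lm : 'M[U]_n).
Hypothesis LP : is_Lpair Lp Lm.
Local Notation lp := (fun_of_matrix Lp).
Local Notation lm := (fun_of_matrix Lm).
Local Notation lam := (q - q^-1).
Local Notation D := (Am q lp lm).

Let qn0 := qpar_neq0 R m.
Let q2N := q2_neqN1 R m_ge3 m_odd.
Let lam0 := qlam_neq0 R m_ge3 m_odd.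
Let infC : injective (fun k : nat => k%:R : C).
Proof. by move=> x y /eqP; rewrite eqr_nat => /eqP. Qed.
Let Rpp : RLLe q lp lp. Proof. by case: LP => _ _ _ [/RLL_RLLe]. Qed.
Let Rmm : RLLe q lm lm. Proof. by case: LP => _ _ _ [_ /RLL_RLLe]. Qed.
Let Rpm : RLLe q lp lm. Proof. by case: LP => _ _ _ [_ _ /RLL_RLLe]. Qed.
Let lp0 (i k : 'I_n) : (k < i)%N -> lp i k = 0. Proof. by case: LP => _ _ h _ /h []. Qed.
Let lm0 (i k : 'I_n) : (i < k)%N -> lm i k = 0. Proof. by case: LP => _ _ h _ /h []. Qed.

Lemma KKi k : (1 <= k <= n)%N -> uqK R n m k * uqKi R n m k = 1.
Proof. by move=> hk; rewrite [LHS]uq_mulE; apply/uq_pi/cong_rel/rel_KKi. Qed.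
Lemma KiK k : (1 <= k <= n)%N -> uqKi R n m k * uqK R n m k = 1.
Proof. by move=> hk; rewrite [LHS]uq_mulE; apply/uq_pi/cong_rel/rel_KiK. Qed.

Let lpK (i : 'I_n) : lp i i = uqK R n m i.+1. Proof. by case: LP => /(_ i) []. Qed.
Let lmK (i : 'I_n) : lm i i = uqKi R n m i.+1. Proof. by case: LP => /(_ i) []. Qed.
Let lpm (i : 'I_n) : lp i i * lm i i = 1. Proof. by rewrite lpK lmK KKi //=. Qed.
Let lmp (i : 'I_n) : lm i i * lp i i = 1. Proof. by rewrite lpK lmK KiK //=. Qed.
Let lpF (i j : 'I_n) : j = i.+1 :> nat -> lp i j = lam *: (uqK R n m i.+1 * uqF R n m i.+1).
Proof. by case: LP => _ h _ _ /h []. Qed.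
Let lmE (i j : 'I_n) : j = i.+1 :> nat -> lm j i = - lam *: (uqE R n m i.+1 * uqKi R n m i.+1).
Proof. by case: LP => _ h _ _ /h []. Qed.

Lemma ord_pair k : (1 <= k < n)%N -> exists a b : 'I_n, [/\ b = a.+1 :> nat, a.+1 = k & b = k :> nat].
Proof.
move=> hk; have ha : (k.-1 < n)%N by lia.
have hb : (k < n)%N by lia.
by exists (Ordinal ha), (Ordinal hb) => /=; split; lia.
Qed.

Lemma D_commK r x k : (r <= n)%N -> (1 <= k <= n)%N -> GRing.comm (D r x) (uqK R n m k).
Proof.
move=> rn hk; have ha : (k.-1 < n)%N by lia.
have := Am_commKp qn0 q2N lam0 Rmm Rpm lm0 lpm lmp x (Ordinal ha) rn.
by rewrite lpK /= prednK //; lia.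
Qed.

Lemma lmEK (a b : 'I_n) : b = a.+1 :> nat -> lm b a * uqK R n m a.+1 = - lam *: uqE R n m a.+1.
Proof. by move=> /lmE ->; rewrite -scalerAl -mulrA KiK ?mulr1 //=. Qed.

Lemma lpFK (a b : 'I_n) : b = a.+1 :> nat -> uqKi R n m a.+1 * lp a b = lam *: uqF R n m a.+1.
Proof. by move=> /lpF ->; rewrite -scalerAr mulrA KiK ?mul1r //=. Qed.

Lemma D_commE r x k : (r <= n)%N -> (1 <= k < r)%N -> GRing.comm (D r x) (uqE R n m k).
Proof.
move=> rn hk; have [|a [b [ab ak bk]]] := @ord_pair k; first by lia.
have br : (b < r)%N by rewrite bk; case/andP: hk.
have -> : uqE R n m k = (- lam)^-1 *: (lm b a * uqK R n m a.+1).
  by rewrite lmEK // scalerA mulVf ?oppr_eq0 // scale1r ak.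
apply/commZ/commrM; last by apply: D_commK => //=.
exact/commr_sym/(Am_commE qn0 q2N lam0 Rpp Rmm Rpm lm0 ab x br rn).
Qed.

Lemma D_commF r x k : (r <= n)%N -> (1 <= k < r)%N -> GRing.comm (D r x) (uqF R n m k).
Proof.
move=> rn hk; have [|a [b [ab ak bk]]] := @ord_pair k; first by lia.
have br : (b < r)%N by rewrite bk; case/andP: hk.
have -> : uqF R n m k = lam^-1 *: (lm a a * lp a b).
  by rewrite lmK lpFK // scalerA mulVf // scale1r ak.
apply/commZ/commrM; first exact: (Am_commKm qn0 q2N lam0 Rmm Rpm lm0 x a rn).
exact/commr_sym/(Am_commF qn0 q2N lam0 Rpp Rmm Rpm lp0 ab x br rn).
Qed.

Lemma D_gen_by r x u : (r <= n)%N -> gen_by r u -> GRing.comm (D r x) u.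
Proof.
move=> rn; apply=> i hi; first by split; [apply: D_commE|apply: D_commF].
by apply: D_commK => //; lia.
Qed.

Lemma Cm_EK (a b : 'I_n) x : b = a.+1 :> nat ->
  Cm q lp lm a b x = D b x * uqE R n m b - q *: (uqE R n m b * D b x).
Proof.
move=> ab; have bn := ltn_ord b; have := Cm_E qn0 q2N lam0 Rmm Rpm lm0 ab x.
move/(congr1 (fun y => lam^-1 *: (y * uqK R n m a.+1))).
rewrite mulrDl -!scalerAl -!mulrA lmK KiK; last by rewrite /=; lia.
rewrite mulr1 scalerDr ![lam^-1 *: (lam *: _)]scalerA mulVf // scale1r lmEK // D_commK; last 2 first.
- exact: ltnW.
- by rewrite /=; lia.
rewrite mulrA lmEK // -scalerAl -scalerAr !scalerA -ab => E.
move: E; have -> : lam^-1 * (q * - lam) = - q by rewrite mulrCA mulrN mulVf // mulrN1.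
have -> : lam^-1 * (- lam) = -1 by rewrite mulrN mulVf.
by rewrite scaleN1r => E; rewrite -scaleNr E addrA subrr add0r.
Qed.

Lemma Bm_FK (a b : 'I_n) x : b = a.+1 :> nat ->
  Bm q lp lm a b x = uqF R n m b * D b x - q^-1 *: (D b x * uqF R n m b).
Proof.
move=> ab; have bn := ltn_ord b; have := Bm_F qn0 q2N lam0 Rpp Rpm lp0 ab x.
have hk : (1 <= a.+1 <= n)%N by rewrite /=; lia.
have cD : uqKi R n m a.+1 * D b x = D b x * uqKi R n m a.+1.
  have := Am_commKm qn0 q2N lam0 Rmm Rpm lm0 x a (ltnW bn).
  by rewrite lmK => ->.
move/(congr1 (fun y => lam^-1 *: (uqKi R n m a.+1 * y))).
rewrite mulrDr -!scalerAr !mulrA lpK KiK // mul1r cD -[D b x * _ * lp a b]mulrA lpFK //.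
rewrite scalerDr -scalerAl -scalerAr !scalerA mulVf // scale1r -ab => E.
move: E; have -> : lam^-1 * (q^-1 - q) = -1 by rewrite -[q^-1 - q]opprB mulrN mulVf.
have -> : lam^-1 * q^-1 * lam = q^-1 by rewrite mulrAC mulVf ?mul1r.
by rewrite scaleN1r => <-; rewrite opprB addrC subrK.
Qed.

Definition gal N (x : C) z : C :=
  \prod_(1 <= i < N.+1) (Q (wt z N i) + x * q ^- 2 * Q (- wt z N i)).
Definition al N x z : C := q ^+ 'C(N.+1, 2) * gal N x z.

Lemma gal_fac0 (w y : C) : Q y + (- q ^+ 2 * Q (w *+ 2)) * q ^- 2 * Q (- y) = (- lam * Q w) * qn (w - y).
Proof.
have Qw0 := qpow_neq0 m w; have Qy0 := qpow_neq0 m y.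
rewrite qnumE [- (w - y)]opprB mulr2n !qpowD !qpowN; field.
by rewrite qn0 Qw0 Qy0 subr_eq0 -expr2 q2_neq1.
Qed.

Lemma gal_fac1 (w y : C) : Q y + (q ^+ 2 * (- q ^+ 2 * Q (w *+ 2))) * q ^- 2 * Q (- y) =
  (- lam * q * Q w) * qn (w - y + 1).
Proof.
have Qw0 := qpow_neq0 m w; have Qy0 := qpow_neq0 m y.
rewrite qnumE [- (w - y + 1)]opprD [- (w - y)]opprB mulr2n !qpowD !qpowN qpow1; field.
by rewrite qn0 Qw0 Qy0 subr_eq0 -expr2 q2_neq1.
Qed.

Lemma galE0 N b p z z' : (1 <= p <= b)%N ->
  gal N (- q ^+ 2 * Q (wt z b p *+ 2)) z' =
  (- lam * Q (wt z b p)) ^+ N * \prod_(1 <= i < N.+1) qn (wt z b p - wt z' N i).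
Proof.
move=> hp; rewrite /gal; under eq_bigr do rewrite gal_fac0.
by rewrite big_split prodr_const_nat subn1.
Qed.

Lemma galE1 N b p z z' :
  gal N (q ^+ 2 * (- q ^+ 2 * Q (wt z b p *+ 2))) z' =
  (- lam * q * Q (wt z b p)) ^+ N * \prod_(1 <= i < N.+1) qn (wt z b p - wt z' N i + 1).
Proof.
rewrite /gal; under eq_bigr do rewrite gal_fac1.
by rewrite big_split prodr_const_nat subn1.
Qed.

Lemma al0 b p z z' : (1 <= p <= b)%N -> wt z' b p = wt z b p -> al b (- q ^+ 2 * Q (wt z b p *+ 2)) z' = 0.
Proof.
move=> hp hw; rewrite /al galE0 // (bigD1_seq p) ?mem_index_iota ?iota_uniq //= hw subrr qnum0.
by rewrite mul0r !mulr0.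
Qed.

Lemma al1 b p z z' : (1 <= p <= b)%N -> wt z' b p = wt z b p + 1 ->
  al b (q ^+ 2 * (- q ^+ 2 * Q (wt z b p *+ 2))) z' = 0.
Proof.
move=> hp hw; rewrite /al galE1 // (bigD1_seq p) ?mem_index_iota ?iota_uniq //= hw.
have -> : wt z b p - (wt z b p + 1) + 1 = 0 by ring.
by rewrite qnum0 mul0r !mulr0.
Qed.

Lemma wt_dlD z k j k' j' : (1 <= j' <= k')%N -> (k' <= n)%N -> (k < n)%N ->
  wt (z + dl n k j) k' j' = wt z k' j' + ((k' == k) && (j' == j))%:R.
Proof.
by move=> h1 h2 h3; rewrite !wtE eD e_dl_le // intrD addrA; case: (_ && _).
Qed.

Lemma al_row N x z z' : (forall i, (1 <= i <= N)%N -> wt z N i = wt z' N i) -> al N x z = al N x z'.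
Proof.
move=> h; rewrite /al /gal big_seq [in RHS]big_seq; congr (_ * _); apply: eq_bigr => i.
by rewrite mem_index_iota ltnS => /h ->.
Qed.

(* The two factors that survive in the product of C and B at a zero of the eigenvalue. *)
Lemma coef_identity b p z (x0 := - q ^+ 2 * Q (wt z b p *+ 2)) : (1 <= p <= b)%N -> (b < n)%N ->
  - (cE b p z * cF b p (z + dl n b p) * al b x0 (z + dl n b p) * al b (q ^+ 2 * x0) z) =
  al b.-1 (q ^+ 2 * x0) z * al b.+1 x0 z.
Proof.
move=> hp hb; have b0 : (0 < b)%N by lia.
have hb' : (1 <= b < n)%N by rewrite b0.
have d0 := denom_neq0 z hb' hp; have d1 := denom_neq0 (z + dl n b p) hb' hp.
rewrite /al !galE1 /x0 !galE0 // -/x0; set w := wt z b p.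
rewrite /cE /cF /gt_coefE /gt_coefF -!/(wt _ _ _) -/w.
have wp : wt (z + dl n b p) b p = w + 1 by rewrite wt_dlD ?eqxx //; lia.
have pE : \prod_(1 <= i < b.+1) qn (w - wt (z + dl n b p) b i) = - gt_denom m (shift v z) b p.
  rewrite (bigD1_seq p) ?mem_index_iota ?iota_uniq //= wp.
  have -> : w - (w + 1) = -1 by ring.
  have hN y : qn (- y) = - qn y by rewrite !qnumE opprK -[RHS]mulNr [- (_ - _)]opprB.
  rewrite hN qnum1 //.
  rewrite mulN1r /gt_denom; congr (- _); rewrite big_seq_cond [RHS]big_seq_cond.
  apply: eq_big => i; first by rewrite eq_sym.
  rewrite mem_index_iota ltnS => /andP[hi ip]; rewrite wt_dlD // ?(negbTE ip) ?andbF ?addr0 //; lia.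
have pF : \prod_(1 <= i < b.+1) qn (w - wt z b i + 1) = gt_denom m (shift v (z + dl n b p)) b p.
  rewrite (bigD1_seq p) ?mem_index_iota ?iota_uniq //= subrr add0r (qnum1 R m_ge3 m_odd) mul1r.
  rewrite /gt_denom big_seq_cond [RHS]big_seq_cond.
  apply: eq_big => i; first by rewrite eq_sym.
  rewrite mem_index_iota ltnS => /andP[hi ip]; rewrite -!/(wt _ _ _) wp wt_dlD // ?(negbTE ip) ?andbF ?addr0 //; last by lia.
  by rewrite addrAC.
rewrite pE pF wp.
have -> : \prod_(1 <= i < b) qn (w + 1 - wt (z + dl n b p) b.-1 i) = \prod_(1 <= i < b.-1.+1) qn (w - wt z b.-1 i + 1).
  rewrite prednK // big_seq_cond [RHS]big_seq_cond; apply: eq_bigr => i; rewrite mem_index_iota => /andP[hi _].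
  rewrite wt_dlD; [|lia|lia|lia]; rewrite (_ : (b.-1 == b) = false) ?addr0; last by lia.
  by rewrite addrAC.
case: b b0 hp hb hb' d0 d1 x0 w wp pE pF => // a _ hp hb hb' d0 d1 x0 w wp pE pF; rewrite [a.+1.-1]/=.
set P1 := \prod_(_ <= _ < _) _; set P2 := \prod_(_ <= _ < _) _.
have -> : 'C(a.+3, 2) = ('C(a.+1, 2) + a.+1 + a.+2)%N by rewrite !binS !bin1 !bin0; lia.
have -> : 'C(a.+2, 2) = ('C(a.+1, 2) + a.+1)%N by rewrite !binS !bin1 !bin0; lia.
move: d0 d1; move: (gt_denom _ _ _ _) (gt_denom _ _ _ _) => d d' d0 d1.
have lq : - lam * q * Q w = (- lam * Q w) * q by rewrite mulrAC.
rewrite lq; move: (- lam * Q w) => l; clearbody P1 P2.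
move: ('C(a.+1, 2)) => c; move: (qpar R m) => q1.
by rewrite !exprD [(l * q1) ^+ _]exprMn [(l * q1) ^+ _]exprMn ![_ ^+ a.+2]exprS ![_ ^+ a.+1]exprS; field; rewrite d0 d1.
Qed.

Lemma Sh_inv d x : Sh (- d) (Sh d x) = x.
Proof.
move: x; apply: t_ind => [|x y hx hy|c z]; first by rewrite !Sh0.
  by rewrite !ShD hx hy.
by rewrite !ShZ !Sh_t addrK.
Qed.

Definition alP N z : {poly C} :=
  q ^+ 'C(N.+1, 2) *: \prod_(1 <= i < N.+1) ((Q (wt z N i))%:P + (q ^- 2 * Q (- wt z N i)) *: 'X).

Lemma alPE N z x : (alP N z).[x] = al N x z.
Proof.
rewrite hornerZ /al /gal; congr (_ * _); rewrite horner_prod; apply: eq_bigr => i _.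
by rewrite hornerD hornerC hornerZ hornerX mulrC mulrA.
Qed.

Lemma prod_lin_coef (I : Type) (s : seq I) (f g : I -> C) (P := \prod_(i <- s) ((f i)%:P + g i *: 'X)) :
  [/\ (size P <= (size s).+1)%N, P`_0 = \prod_(i <- s) f i & P`_(size s) = \prod_(i <- s) g i].
Proof.
rewrite {}/P; elim: s => [|i s [h1 h2 h3]]; first by rewrite !big_nil size_poly1 coefC.
rewrite !big_cons; split.
- apply: leq_trans (size_polyMleq _ _) _.
  have : (size ((f i)%:P + g i *: 'X)%R <= 2)%N.
    rewrite (leq_trans (size_polyD _ _)) // geq_max (leq_trans (size_polyC_leq1 _)) //=.
    by rewrite (leq_trans (size_scale_leq _ _)) ?size_polyX.
  by move: h1; rewrite [size (i :: s)]/=; move: (size _) (size _) => x y; lia.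
- by rewrite mulrDl coefD -scalerAl coefZ coefXM mulr0 addr0 coefCM h2.
- rewrite mulrDl coefD -scalerAl coefZ coefXM coefCM /= h3.
  by rewrite [X in f i * X]nth_default // mulr0 add0r.
Qed.

Lemma size_alP N z : (size (alP N z) <= N.+1)%N.
Proof.
rewrite (leq_trans (size_scale_leq _ _)) //.
by have [+ _ _] := prod_lin_coef (index_iota 1 N.+1) (fun i => Q (wt z N i)) (fun i => q ^- 2 * Q (- wt z N i)); rewrite size_iota subn1.
Qed.

Lemma alP_0 N z : (alP N z)`_0 = q ^+ 'C(N.+1, 2) * \prod_(1 <= i < N.+1) Q (wt z N i).
Proof.
rewrite coefZ; congr (_ * _).
by have [_ + _] := prod_lin_coef (index_iota 1 N.+1) (fun i => Q (wt z N i)) (fun i => q ^- 2 * Q (- wt z N i)).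
Qed.

Lemma alP_N N z : (alP N z)`_N = q ^+ 'C(N.+1, 2) * \prod_(1 <= i < N.+1) (q ^- 2 * Q (- wt z N i)).
Proof.
rewrite coefZ; congr (_ * _).
by have [_ _] := prod_lin_coef (index_iota 1 N.+1) (fun i => Q (wt z N i)) (fun i => q ^- 2 * Q (- wt z N i)); rewrite size_iota subn1.
Qed.

Lemma Qgt_a_prod N z : Q (gt_a (shift v z) N.+1) =
  \prod_(1 <= i < N.+2) Q (wt z N.+1 i) / \prod_(1 <= i < N.+1) Q (wt z N i) * q ^+ N.+1.
Proof.
have Qs K (a b : nat) : Q (\sum_(a <= i < b) wt z K i) = \prod_(a <= i < b) Q (wt z K i).
  by elim/big_ind2: _ => //; [exact: qpow0|move=> x y x' y' <- <-; rewrite qpowD].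
by rewrite /gt_a !qpowD !qpowN -!/(wt _ _ _) !Qs qpow_nat.
Qed.

Lemma prodQ_neq0 N K z : \prod_(1 <= i < N) Q (wt z K i) != 0.
Proof. by rewrite prodf_seq_neq0; apply/allP => i _; rewrite qpow_neq0. Qed.

Lemma prod_lp N z : (N <= n)%N -> (\prod_(i <- rows n N) lp i i) *: t z =
  (q ^+ 'C(N.+1, 2) * \prod_(1 <= i < N.+1) Q (wt z N i)) *' t z.
Proof.
elim: N => [|N IH] hN; first by rewrite big_nil scale1r big_geq // mulr1 expr0 sc1.
rewrite (rowsS (i := Ordinal hN)) // big_cat big_seq1 /= -scalerA lpK actK //= scC IH; last exact: ltnW.
rewrite scA Qgt_a_prod; congr (_ *' _).
have := prodQ_neq0 N.+1 N z; set P := \prod_(1 <= i < N.+1) _ => P0.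
have -> : 'C(N.+2, 2) = ('C(N.+1, 2) + N.+1)%N by rewrite binS bin1.
rewrite exprD; move: ('C(N.+1, 2)) => c; move: (\prod_(_ <= _ < _) _) => P'; move: (q) => q1.
by field.
Qed.

Lemma prod_lm N z : (N <= n)%N -> (\prod_(i <- rows n N) lm i i) *: t z =
  (q ^+ 'C(N.+1, 2) * \prod_(1 <= i < N.+1) Q (wt z N i))^-1 *' t z.
Proof.
elim: N => [|N IH] hN; first by rewrite big_nil scale1r big_geq // mulr1 expr0 invr1 sc1.
rewrite (rowsS (i := Ordinal hN)) // big_cat big_seq1 /= -scalerA lmK actKi //= scC IH; last exact: ltnW.
rewrite scA qpowN Qgt_a_prod; congr (_ *' _).
have := prodQ_neq0 N.+1 N z; have := prodQ_neq0 N.+2 N.+1 z; set P := \prod_(1 <= i < N.+1) _ => P0' P0.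
have -> : 'C(N.+2, 2) = ('C(N.+1, 2) + N.+1)%N by rewrite binS bin1.
rewrite exprD; have := expf_neq0 N.+1 qn0; have := expf_neq0 'C(N.+1, 2) qn0.
move: P0'; move: (q ^+ _) (q ^+ _) (\prod_(_ <= _ < _) _) => P' c d h1 h2 h3.
by field; rewrite ?h1 ?h2 ?h3.
Qed.

Lemma Dt_0 N z : (N <= n)%N -> Dt q lp lm N 0 *: t z = (alP N z)`_0 *' t z.
Proof. by move=> hN; rewrite (Dt0 qn0 q2N lam0 lm lp0 hN) prod_lp // alP_0. Qed.

Lemma bin2_double N : ('C(N.+1, 2)).*2 = (N * N.+1)%N.
Proof. by rewrite bin2 mulnC -divn2 -muln2 divnK // dvdn2 oddM oddS andbN. Qed.

Lemma Dt_N N z : (N <= n)%N -> Dt q lp lm N N *: t z = (alP N z)`_N *' t z.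
Proof.
move=> hN; rewrite (Dtr qn0 q2N lam0 lp lm0 hN) sc_Z prod_lm // alP_N scA; congr (_ *' _).
rewrite [in RHS]big_split [in RHS]prodr_const_nat subn1 /=.
have -> : \prod_(1 <= i < N.+1) Q (- wt z N i) = (\prod_(1 <= i < N.+1) Q (wt z N i))^-1.
  by rewrite -prodfV; apply: eq_bigr => i _; rewrite qpowN.
have P0 := prodQ_neq0 N.+1 N z; move: (\prod_(_ <= _ < _) _) P0 => P P0.
rewrite invfM mulrA [RHS]mulrA; congr (_ / _).
apply: (@mulIf _ (q ^+ 'C(N.+1, 2))); first by rewrite expf_neq0.
rewrite mulfVK ?expf_neq0 //; apply: (@mulIf _ (q ^+ (2 * N))); first by rewrite expf_neq0.
rewrite exprVn -exprM [in RHS]mulrAC mulfVK ?expf_neq0 // -!exprD; congr (_ ^+ _).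
rewrite addnn bin2_double; case: N {hN P P0} => [|N] //=; lia.
Qed.

(* A difference of two polynomials of degree N with the same extreme coefficients
   and N - 1 common non-zero roots. *)
Lemma coef_of_points N z (rs : seq C) : (N <= n)%N -> uniq rs -> 0 \notin rs -> (N <= (size rs).+1)%N ->
  (forall x, x \in rs -> D N x *: t z = al N x z *' t z) ->
  forall d, (d <= N)%N -> Dt q lp lm N d *: t z = (alP N z)`_d *' t z.
Proof.
move=> hN urs z0 hs h d dN; apply: (co_eq (b_basis := t_basis)) => y; rewrite coZ.
pose P := \poly_(d < N.+1) (co t_basis (Dt q lp lm N d *: t z) y - (alP N z)`_d * co t_basis (t z) y).
suff P0 : P = 0.
  by have := congr1 (fun p : {poly C} => p`_d) P0; rewrite coef_poly ltnS dN coef0 => /eqP; rewrite subr_eq0 => /eqP.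
have PN0 : P`_0 = 0 by rewrite coef_poly /= Dt_0 // coZ subrr.
have PN : P`_N = 0 by rewrite coef_poly ltnSn Dt_N // coZ subrr.
have sP : (size P <= N)%N.
  apply/leq_sizeP => j Nj; case: (eqVneq j N) => [-> //|jN].
  by rewrite coef_poly ltnS leqNgt ltn_neqAle eq_sym jN Nj.
case: (eqVneq P 0) => // P0; case: (ssrnat.posnP N) => hN0.
  by move: sP; rewrite hN0 leqn0 size_poly_eq0 (negbTE P0).
have := @max_poly_roots _ P (0 :: rs) P0; rewrite /= z0 urs /= => hh.
suff /hh /(_ isT) /leq_trans /(_ sP) : root P 0 && all (root P) rs by rewrite ltnNge hs.
rewrite rootE horner_coef0 PN0 eqxx /=; apply/allP => x /h; rewrite (Am_Dt qn0 q2N lam0) // => E.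
rewrite rootE horner_poly; apply/eqP.
transitivity (co t_basis (al N x z *' t z) y - al N x z * co t_basis (t z) y); last by rewrite coZ subrr.
rewrite -E -alPE (horner_coef_wide _ (size_alP N z)) mulr_suml.
under eq_bigr do rewrite mulrBl; rewrite sumrB; congr (_ - _).
  rewrite scaler_suml.
  have cs (s : seq 'I_N.+1) (F : 'I_N.+1 -> V) : co t_basis (\sum_(i <- s) F i) y = \sum_(i <- s) co t_basis (F i) y.
    elim: s => [|i s IH]; first by rewrite !big_nil co0.
    by rewrite !big_cons coD IH.
  by rewrite cs; apply: eq_bigr => i _; rewrite [(x ^+ i *: _) *: _]sc_Z coZ mulrC.
by apply: eq_bigr => i _; rewrite mulrAC.
Qed.

Lemma D_of_coef N z x : (N <= n)%N ->
  (forall d, (d <= N)%N -> Dt q lp lm N d *: t z = (alP N z)`_d *' t z) ->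
  D N x *: t z = al N x z *' t z.
Proof.
move=> hN h; rewrite (Am_Dt qn0 q2N lam0) // -alPE (horner_coef_wide _ (size_alP N z)) scaler_suml sc_suml.
apply: eq_bigr => d _; rewrite [(x ^+ d *: _) *: _]sc_Z h ?scA; last by rewrite -ltnS.
by rewrite mulrC.
Qed.

Lemma act2 (x y : U) (s : V) : (x * y) *: s = x *: (y *: s).
Proof. by rewrite scalerA. Qed.

Definition eigen N := forall x z, D N x *: t z = al N x z *' t z.

Lemma eigen_at b p z (x0 := - q ^+ 2 * Q (wt z b p *+ 2)) : eigen b -> eigen b.-1 ->
  (1 <= p <= b)%N -> (b < n)%N ->
  al b.-1 (q ^+ 2 * x0) z *' (D b.+1 x0 *: t z) = (al b.-1 (q ^+ 2 * x0) z * al b.+1 x0 z) *' t z.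
Proof.
move=> hb ha hp bn; have hb' : (1 <= b < n)%N by lia.
have [a [b' [ab ak bk]]] := ord_pair hb'; have ab' : a = b.-1 :> nat by lia.
have bi (i : nat) : i \in index_iota 1 b.+1 -> (1 <= i <= b)%N by rewrite mem_index_iota ltnS.
have wne y i : (1 <= i <= b)%N -> i != p -> wt (y + dl n b i) b p = wt y b p.
  by move=> hi ip; rewrite wt_dlD // ?[p == i]eq_sym ?(negbTE ip) ?andbF ?addr0 //; lia.
have wpp y : wt (y + dl n b p) b p = wt y b p + 1.
  by rewrite wt_dlD // ?eqxx //; lia.
have hC : Cm q lp lm a b' x0 *: t z =
    - ((cE b p z * al b x0 (z + dl n b p)) *' t (z + dl n b p)).
  rewrite (Cm_EK x0 ab) bk scalerBl sc_Z !act2 hb (al0 (z' := z) hp) // sc0 scaler0 scx0 subr0.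
  rewrite actE // scalerN scaler_sumr (@big_pick _ _ p b) // => [|i hi ip].
    by rewrite scC hb scA.
  by rewrite scC hb (al0 hp) ?sc0 ?scx0 //; apply: wne.
have hB : Bm q lp lm a b' (q ^+ 2 * x0) *: t (z + dl n b p) =
    - ((q^-1 * (cF b p (z + dl n b p) * al b (q ^+ 2 * x0) z)) *' t z).
  rewrite (Bm_FK _ ab) bk scalerBl sc_Z !act2 hb (al1 (z' := z + dl n b p) hp) ?wpp // sc0 scaler0 sub0r.
  congr (- _); rewrite actF // scaler_sumr (@big_pick _ _ p b) // => [|i hi ip].
    by rewrite scC hb addrK !scA; congr (_ *' _); exact: esym (mulrA _ _ _).
  rewrite scC hb (al1 hp) ?sc0 ?scx0 // -wpp -[in RHS](subrK (dl n b i) (z + dl n b p)) wne //.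
have := Sylvester qn0 q2N lam0 Rpp Rmm Rpm lp0 lm0 lpm lmp infC x0 ab.
move/(congr1 (fun u => u *: t z)); rewrite !act2 bk ab' ha scC => ->.
rewrite scalerBl act2 hb (al0 (z' := z) hp) // sc0 scaler0 sub0r sc_Z act2 hC scalerN scC hB.
rewrite scalerN opprK scA -!scN scA; congr (_ *' _).
rewrite -coef_identity // -/x0.
move: (cE _ _ _) (cF _ _ _) (al _ _ _) (al _ _ _) => c1 c2 c3 c4.
by rewrite !mulrN; field.
Qed.

Definition bad b z p : bool := lk b p && (m %| e z b p - e z b.-1 p + 1)%Z.

Lemma al_neq0 b p z : (1 <= p <= b)%N -> (b < n)%N -> ~~ bad b z p ->
  al b.-1 (q ^+ 2 * (- q ^+ 2 * Q (wt z b p *+ 2))) z != 0.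
Proof.
move=> hp bn nbad; rewrite /al galE1 mulf_neq0 ?expf_neq0 // mulf_neq0 //.
  by apply/expf_neq0/mulf_neq0/qpow_neq0; rewrite mulf_neq0 ?oppr_eq0.
apply/negP; rewrite prodf_seq_eq0 => hh; move/negP: nbad; apply.
case: (elimT (seq.hasP) hh) => i; rewrite mem_index_iota /= => hi /eqP h0.
have b2 : (2 <= b <= n)%N by lia.
have hi' : (1 <= i < b)%N by lia.
have hZ : in_Z (ent v b p - ent v b.-1 i).
  by apply: (@wt_diff_inZ z _ _ _ _ 1) => //; lia.
have [h1 h2] := inZ_lk b2 hi' hp hZ; have pi := h2 bn; subst i.
by rewrite /bad h1 /= -(lk_dvd z 1 h1) h0 eqxx.
Qed.

Lemma points_neq b p p' z : (1 <= b < n)%N -> (1 <= p <= b)%N -> (1 <= p' <= b)%N -> p != p' ->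
  - q ^+ 2 * Q (wt z b p *+ 2) != - q ^+ 2 * Q (wt z b p' *+ 2).
Proof.
move=> hb hp hp' pp'; apply/eqP => /mulfI; rewrite oppr_eq0 expf_neq0 // => /(_ isT) h.
have := generic_neq0 z 0 hb hp hp' pp'; rewrite addr0 (qnum_eq0 m_ge3 m_odd) mulrnBl qpowB h.
by rewrite divff ?eqxx ?qpow_neq0.
Qed.

(* The operator F_b^(p) shifts T(z) to T(z - dl b p) with a non-zero coefficient when p is bad;
   it commutes with D, which preserves the classes modulo m. *)
Lemma eigen_transfer b p z x : (1 <= p <= b)%N -> (b < n)%N -> bad b z p ->
  D b.+1 x *: t (z - dl n b p) = al b.+1 x (z - dl n b p) *' t (z - dl n b p) ->
  D b.+1 x *: t z = al b.+1 x z *' t z.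
Proof.
move=> hp bn /andP[l hbad] h; have hb : (1 <= b < n)%N by lia.
have hproj y : exists u, isproj b y u by apply: proj_exists.
have [u [gu hu]] : exists u, gen_by b.+1 u /\
    forall y, u *: t y = ((cl b y == cl b z)%:R * cF b p y) *' t (y - dl n b p).
  by apply: stepF_op => //; lia.
have [w [gw hw]] := hproj z.
have c0 : cF b p z != 0.
  rewrite cF_eq0 // l /=; apply/negP => h'.
  have : (m %| (e z b p - e z b.-1 p + 1)%R - (e z b p - e z b.-1 p)%R)%Z by rewrite rpredB.
  by rewrite addrAC subrr add0r dvdz1; lia.
set X := D b.+1 x *: t z.
have wX : w *: X = X.
  rewrite /X -act2 -(D_gen_by x bn (gen_byW (leqnSn b) gw)) act2 hw eqxx sc1 //.
have uS Y : u *: (w *: Y) = cF b p z *' Sh (- dl n b p) (w *: Y).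
  move: Y; apply: t_ind => [|Y Y' hY hY'|c y]; first by rewrite !scaler0 Sh0 scx0.
    by rewrite !scalerDr ShD hY hY' scDr.
  rewrite scC hw; case: (eqVneq (cl b y) (cl b z)) => [yz|_]; last by rewrite sc0 !scx0 scaler0 Sh0 scx0.
  rewrite sc1 scC hu yz eqxx mul1r ShZ Sh_t !scA mulrC; congr ((_ * _) *' _).
  by apply: cF_cong => //; apply: (cl_row bn) => //; lia.
have E1 : u *: X = cF b p z *' Sh (- dl n b p) X by rewrite -{1}wX uS wX.
have E2 : u *: X = cF b p z *' (al b.+1 x z *' t (z - dl n b p)).
  rewrite /X -[LHS]act2 -(D_gen_by x bn gu) act2 hu eqxx mul1r scC h; congr (_ *' (_ *' _)).
  apply: al_row => i hi; rewrite -[z in RHS](subrK (dl n b p)) wt_dlD //.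
  by rewrite (_ : (b.+1 == b) = false) ?addr0 //; lia.
have E3 : Sh (- dl n b p) X = al b.+1 x z *' t (z - dl n b p).
  apply/eqP; rewrite -subr_eq0; apply/eqP; apply: (sc_inj c0).
  by rewrite scalerBr -E1 -E2 subrr.
have := Sh_inv (- dl n b p) X; rewrite E3 ShZ Sh_t opprK subrK => <- //.
Qed.

Lemma eigen_step b : (1 <= b < n)%N -> eigen b -> eigen b.-1 -> eigen b.+1.
Proof.
move=> hb hb1 hb2; have bn : (b < n)%N by case/andP: hb.
suff H c z : (count (bad b z) (iota 1 b) <= c)%N -> forall x, D b.+1 x *: t z = al b.+1 x z *' t z.
  by move=> x z; apply: (H _ z (leqnn _)).
elim: c z => [|c IH] z hc.
  have good p : (1 <= p <= b)%N -> ~~ bad b z p.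
    move=> hp; apply/negP => hbad; move: hc; rewrite leqNgt -has_count => /negP; apply.
    by apply: (introT (seq.hasP)); exists p => //; rewrite mem_iota; lia.
  pose rs := [seq - q ^+ 2 * Q (wt z b p *+ 2) | p <- iota 1 b].
  move=> x; apply: D_of_coef => //; apply: (@coef_of_points _ _ rs) => //.
  - rewrite map_inj_in_uniq ?iota_uniq // => p p'; rewrite !mem_iota => hp hp' E.
    case: (eqVneq p p') => // ne; have := @points_neq b p p' z hb _ _ ne; rewrite E eqxx => h.
    have hb0 : (1 <= p <= b)%N by lia.
    have hb1' : (1 <= p' <= b)%N by lia.
    by have := h hb0 hb1'.
  - apply/negP => h0; case: (elimT (seq.mapP) h0) => p _ /eqP; rewrite eq_sym mulf_eq0 oppr_eq0 expf_eq0.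
    by rewrite (negbTE qn0) andbF (negbTE (qpow_neq0 m _)).
  - by rewrite size_map size_iota.
  - move=> x0 h0; case: (elimT (seq.mapP) h0) => p; rewrite mem_iota => hp ->.
    have hp' : (1 <= p <= b)%N by lia.
    have := eigen_at z hb1 hb2 hp' bn; rewrite -scA.
    move/eqP; rewrite -subr_eq0 -scalerBr => /eqP /(sc_inj (al_neq0 hp' bn (good p hp'))).
    by move/eqP; rewrite subr_eq0 => /eqP.
case: (boolP (has (bad b z) (iota 1 b))) => [hh|]; last first.
  by rewrite has_count -leqNgt leqn0 => /eqP h0; apply: IH; rewrite h0.
case: (elimT (seq.hasP) hh) => p; rewrite mem_iota => hp hbad x.
have hp' : (1 <= p <= b)%N by lia.
apply: (eigen_transfer hp' bn hbad); apply: IH.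
rewrite -ltnS; apply: leq_trans hc.
have eb i : (1 <= i <= b)%N -> bad b (z - dl n b p) i = bad b z i && (i != p).
  move=> hi; rewrite /bad; case: (boolP (lk b i)) => // li /=.
  have hib : (1 <= i <= b.-1)%N by case/andP: li; lia.
  have pb : (b.-1 == b) = false by lia.
  rewrite !eD !eN !e_dl //; try lia; rewrite pb eqxx /= oppr0 addr0.
  case: (eqVneq i p) => [->|_]; last by rewrite oppr0 addr0 andbT.
  rewrite andbF; apply/negP => h'; case/andP: hbad => _ h''.
  have : (m %| (e z b p - e z b.-1 p + 1)%R - (e z b p - 1 - e z b.-1 p + 1)%R)%Z by rewrite rpredB.
  by rewrite (_ : _ - _ = 1) ?dvdz1; [lia|ring].
have -> : count (bad b (z - dl n b p)) (iota 1 b) = count (fun i => bad b z i && (i != p)) (iota 1 b).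
  by apply: eq_in_count => i; rewrite mem_iota => hi; apply: eb; lia.
rewrite -[X in (_ < X)%N]size_filter -(count_predC (fun i => i != p)) !count_filter -addn1 leq_add //.
  by apply: eq_leq; apply: eq_count => i /=; rewrite andbC.
rewrite -has_count; apply: (introT (seq.hasP)); exists p; rewrite ?mem_iota //=.
by rewrite negbK eqxx hbad.
Qed.

Lemma eigen_all N : (N <= n)%N -> eigen N.
Proof.
suff H : forall N, (N.+1 <= n)%N -> eigen N /\ eigen N.+1.
  case: N => [|N] hN; first by have [|h _] := H 0%N; first exact: ltnW n_ge2.
  by have [_ h] := H N hN.
have E0 : eigen 0.
  move=> x z; apply: D_of_coef => // d; rewrite leqn0 => /eqP ->; exact: Dt_0.
elim=> [|b IH] hN; last first.
  have [h1 h2] := IH (ltnW hN); split=> //.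
  by apply: eigen_step.
split=> // x z; apply: D_of_coef => // -[|[|d]] // _; first exact: Dt_0.
exact: Dt_N.
Qed.

Lemma Dt_eigen N d z : (N <= n)%N -> (d <= N)%N -> Dt q lp lm N d *: t z = (alP N z)`_d *' t z.
Proof.
move=> hN dN; apply: (@coef_of_points _ _ [seq (i.+1)%:R | i <- iota 0 N]) => //.
- by rewrite map_inj_uniq ?iota_uniq // => x y /eqP; rewrite eqr_nat eqSS => /eqP.
- apply/negP => h0; case: (elimT (seq.mapP) h0) => p _ /eqP.
  by rewrite eq_sym pnatr_eq0.
- by rewrite size_map size_iota.
- by move=> x _; apply: eigen_all.
Qed.

Lemma alP_coef N d z : (alP N z)`_d = q ^+ 'C(N.+1, 2) *
  \sum_(J : {set 'I_N} | #|J| == d) \prod_(i < N) (if i \in J then q ^- 2 * Q (- wt z N i.+1) else Q (wt z N i.+1)).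
Proof.
rewrite coefZ; congr (_ * _); rewrite big_add1 big_mkord /=.
under eq_bigr do rewrite addrC.
rewrite bigA_distr coef_sum [RHS]big_mkcond; apply: eq_bigr => J _.
have -> : \prod_(i < N) (if i \in J then (q ^- 2 * Q (- wt z N i.+1)) *: 'X else (Q (wt z N i.+1))%:P) =
  (\prod_(i < N) (if i \in J then q ^- 2 * Q (- wt z N i.+1) else Q (wt z N i.+1))) *: 'X^#|J| :> {poly C}.
  rewrite -mul_polyC rmorph_prod /= -prodr_const [X in _ * X]big_mkcond -big_split /=.
  by apply: eq_bigr => i _; case: ifP; rewrite ?mulr1 ?mul_polyC.
by rewrite coefZ coefXn eq_sym; case: eqP; rewrite ?mulr1 ?mulr0.
Qed.

Lemma qnumS j : qn j.+1%:R = q ^+ j * \sum_(y < j.+1) q^-1 ^+ (2 * y).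
Proof.
elim: j => [|j IH]; first by rewrite (qnum1 R m_ge3 m_odd) big_ord_recl big_ord0 expr0 addr0 mul1r.
rewrite big_ord_recr /= mulrDr [q ^+ j.+1]exprS -mulrA -IH !qnumE !qpowN !qpow_nat.
rewrite exprVn mulnC exprM [in RHS]exprS [q ^+ j.+2]exprS [q ^+ j.+1]exprS.
have := expf_neq0 j qn0; move: (q ^+ j) (q) lam0 qn0 (q2_neq1 R m_ge3) => c q1 h1 h2 h3 h4.
by field; rewrite h2 h4 subr_eq0 -expr2 h3.
Qed.

Lemma Nq_qfact d : Nq q d * q ^+ 'C(d, 2) = qfact R m d.
Proof.
elim: d => [|d IH]; first by rewrite /Nq /qfact big_ord0 big_geq // mulr1.
rewrite NqS /qfact big_nat_recr //= -[\prod_(1 <= i < d.+1) _]/(qfact R m d) -IH qnumS.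
by rewrite binS bin1 exprD; ring.
Qed.

Lemma central_scalar r s z : (s <= r)%N ->
  Nq q s * Nq q (r - s) / kap q r (r - s) * (alP r z)`_(r - s) = gamma m r s (shift v z).
Proof.
move=> sr; rewrite alP_coef -sum_shuffle // /gamma -!Nq_qfact.
set Sg := \sum_(u | _) qpow _ _.
have -> : \sum_(u : 'S_r | is_shuffle s u) \prod_(i < r) (if i \in tail_set s u then q ^- 2 * Q (- wt z r i.+1)
     else Q (wt z r i.+1)) = q ^- (2 * (r - s)) * Sg.
  rewrite mulr_sumr; apply: eq_bigr => u _; rewrite (reindex_inj (@perm_inj _ u)) /=.
  under eq_bigr do rewrite mem_tail_set.
  have Qs (P : pred 'I_r) : Q (\sum_(i < r | P i) ent (shift v z) r (u i).+1) = \prod_(i < r | P i) Q (wt z r (u i).+1).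
    by elim/big_ind2: _ => //; [exact: qpow0|move=> x y x' y' <- <-; rewrite qpowD].
  rewrite qpowB !Qs (bigID (fun i : 'I_r => (i < s)%N)) /= [RHS]mulrCA; congr (_ * _).
    by apply: eq_bigr => i si; rewrite leqNgt si.
  rewrite -prodfV; under [in RHS]eq_bigl do rewrite leqNgt.
  transitivity (\prod_(i < r | ~~ (i < s)%N) (q ^- 2 * (Q (wt z r (u i).+1))^-1)).
    by apply: eq_bigr => i si; rewrite leqNgt si qpowN.
  rewrite big_split /=; congr (_ * _); rewrite prodr_const exprVn -exprM; congr ((_ ^+ (_ * _)) ^-1).
  have := cardC [pred i : 'I_r | (i < s)%N]; rewrite card_ord.
  have -> : #|[pred i : 'I_r | (i < s)%N]| = s.
    by rewrite -sum1_card (eq_bigl (fun i : 'I_r => (i < s)%N)) // (big_ord_narrow sr) sum1_card card_ord.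
  by move=> /(congr1 (fun k => (k - s)%N)); rewrite addKn => <-; apply: eq_card.
set t := (r - s)%N; have -> : r = (s + t)%N by rewrite subnKC.
rewrite !qpowD qpowN !qpow_nat.
have nz k : q ^+ k != 0 by rewrite expf_neq0.
have key : q ^+ 'C((s + t).+1, 2) * q ^+ ((s + t) ^ 2) =
   q ^+ ((s + t) * s) * q ^+ s * q ^+ (2 * t) * q ^+ 'C(s, 2) * q ^+ 'C(t, 2) * q ^+ (t * t.-1 + 2 * t * s).
  rewrite -!exprD; congr (_ ^+ _); have := bin2_double (s + t); have := bin2_double s; have := bin2_double t.
  rewrite !binS !bin1; case: t => [|t'] /=; nia.
rewrite /kap (_ : (s + t - t)%N = s); last by rewrite addnK.
move: key (nz (t * t.-1 + 2 * t * s)%N) (nz (2 * t)%N) (nz ((s + t) ^ 2)%N).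
move: (q ^+ (t * t.-1 + 2 * t * s)) (q ^+ 'C((s + t).+1, 2)) (q ^+ (2 * t)) (q ^+ 'C(s, 2)) (q ^+ 'C(t, 2))
  (q ^+ ((s + t) * s)) (q ^+ ((s + t) ^ 2)) (q ^+ s) (Nq q s) (Nq q t) => x1 x2 x3 x4 x5 x6 x7 x8 n1 n2.
clearbody Sg; move=> key h1 h3 h7; have -> : x2 = x6 * x8 * x3 * x4 * x5 * x1 / x7 by rewrite -key mulfK.
by field; rewrite h1 h3 h7.
Qed.

Lemma central_eigen r s (rn : (r <= n)%N) z : (s <= r)%N ->
  central Lp Lm s rn *: t z = gamma m r s (shift v z) *' t z.
Proof.
move=> sr; have -> : central Lp Lm s rn = (Nq q s * Nq q (r - s) / kap q r (r - s)) *: Dt q lp lm r (r - s).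
  rewrite -(central_Dt qn0 q2N lam0 Rpp Rmm Rpm) //; apply: eq_bigr => u _; apply: eq_bigr => u' _.
  by congr (_ *: _); apply: eq_bigr => i _; case: ifP.
by rewrite [LHS]sc_Z Dt_eigen ?leq_subr // scA central_scalar.
Qed.

End Part2.

Lemma part2 (W : nat -> nat -> {pred V}) : is_choice v T W ->
  forall Lp Lm : 'M[U]_n, is_Lpair Lp Lm ->
  forall (r s : nat) (le_rn : (r <= n)%N), (1 <= r)%N -> (s <= r)%N ->
  forall z : lattice n, T (shift v z) \in UqT v T ->
    central Lp Lm s le_rn *: Tbar v T W (shift v z) =
    (gamma m r s (shift v z))%:A *: Tbar v T W (shift v z).
Proof.
move=> hW Lp Lm LP r s rn r1 sr z /UqT_tP hz.
by rewrite TbarE -!piMZ ?central_eigen //; apply: inM_t.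
Qed.

End Main.

Theorem theorem3p4 (R : realType) (n m : nat)
  (n_ge2 : (2 <= n)%N) (m_ge3 : (3 <= m)%N) (m_odd : odd m)
  (v : tableau n R[i])
  (v_generic : generic v) (v_A : conventionA v) (v_B : conventionB v)
  (V : lmodType (Uq R n m)) (T : tableau n R[i] -> V)
  (V_gt : is_gt_module v T) :
  [/\ forall W : nat -> nat -> {pred V}, is_choice v T W ->
        ground_dim (Vbar v T W) (m ^ (n * n.-1)./2) /\
        (forall z : lattice n, T (shift v z) \in UqT v T ->
           let w := shift v z in
           gt_action (Tbar v T W) w /\
           (* vectors occurring with a nonzero coefficient do have an image *)
           (forall k j, (1 <= j <= k)%N -> (k < n)%N ->
              (gt_coefE m w k j != 0 ->
                 T (w + delta_tab n R[i] k j) \in UqT v T) /\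
              (gt_coefF m w k j != 0 ->
                 T (w - delta_tab n R[i] k j) \in UqT v T))),
      forall W : nat -> nat -> {pred V}, is_choice v T W ->
        forall Lp Lm : 'M[Uq R n m]_n, is_Lpair Lp Lm ->
        forall (r s : nat) (le_rn : (r <= n)%N), (1 <= r)%N -> (s <= r)%N ->
        forall z : lattice n, T (shift v z) \in UqT v T ->
          central Lp Lm s le_rn *: Tbar v T W (shift v z) =
          (gamma m r s (shift v z))%:A *: Tbar v T W (shift v z)
    & forall W W' : nat -> nat -> {pred V},
        is_choice v T W -> is_choice v T W' -> ~ same_choice W W' ->
        ~ exists f : {linear Vbar v T W -> Vbar v T W'}, bijective f].
Proof.
split=> [W hW|W hW Lp Lm LP r s rn r1 sr z hz|W W' hW hW' ns].
- exact: (part1 n_ge2 m_ge3 m_odd v_generic v_A v_B V_gt hW).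
- exact: (part2 n_ge2 m_ge3 m_odd v_generic v_A v_B V_gt hW LP rn r1 sr hz).
- exact: (not_iso n_ge2 m_ge3 m_odd v_generic v_A v_B V_gt hW hW' ns).
Qed.
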